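(* For each integer $d\geqslant2$, let $E_d\subset T_\lambda\mathscr{P}(\mathbb{S}^1)=L^2_0(\lambda)$ be the vector space of tangent vectors $v$ at $\lambda$ that are invariant under $D_\lambda\Phi_{d\#}$, i.e. $D_\lambda\Phi_{d\#}(v)=v$. The vector space $E_2\cap E_3$ of tangent vectors at $\lambda$ that are simultaneously invariant under both $D_\lambda\Phi_{2\#}$ and $D_\lambda\Phi_{3\#}$ is infinite-dimensional. The vector space $\bigcap_{d=2}^\infty E_d$ of tangent vectors at $\lambda$ that are simultaneously invariant under all the $D_\lambda\Phi_{d\#}$ is $2$-dimensional.
   Context: $\mathbb{S}^1=\mathbb{R}/\mathbb{Z}$, $\lambda$ is the Lebesgue probability measure, $\Phi_d(x)=dx\bmod1$, $\mathscr{P}(\mathbb{S}^1)$ is the set of Borel probability measures on $\mathbb{S}^1$ and $\Phi_{d\#}$ is push-forward of measures. The tangent space $T_\lambda\mathscr{P}(\mathbb{S}^1)$ is identified with the real Hilbert space $L^2_0(\lambda)=\{v\in L^2(\lambda;\mathbb{R}):\int v\,d\lambda=0\}$. For $\mu\in\mathscr{P}(\mathbb{S}^1)$ and $v\in L^2(\mu)$, $\mu+v:=(\mathrm{Id}+v)_\#\mu$. $\mathrm{W}$ is the quadratic Wasserstein metric: $\mathrm{W}(\mu,\nu)=\left(\inf_\Pi\int|x-y|^2\,\Pi(dx\,dy)\right)^{1/2}$, infimum over probability measures $\Pi$ on $\mathbb{S}^1\times\mathbb{S}^1$ with marginals $\mu,\nu$. $D_\lambda\Phi_{d\#}:L^2_0(\lambda)\to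 L^2_0(\lambda)$ denotes the G\^ateaux derivative of $\Phi_{d\#}$ at $\lambda$ (note $\Phi_{d\#}\lambda=\lambda$): the continuous linear operator $L$ such that for all $v\in L^2_0(\lambda)$, $\mathrm{W}(\Phi_{d\#}(\lambda+tv),\lambda+tLv)=o(t)$ as $t\to0$. It exists and is the operator $D_\lambda\Phi_{d\#}\,v(x)=v(x/d)+v((x+1)/d)+\dots+v((x+d-1)/d)$. *)

(* Defs.v *)
From HB Require Import structures.
From mathcomp Require Import all_boot all_order all_algebra.
From mathcomp Require Import all_classical all_reals all_analysis.
From mathcomp Require Import measurable_realfun.
From mathcomp Require Import generic_quotient ring_quotient.
Set Implicit Arguments.
Unset Strict Implicit.
Unset Printing Implicit Defensive.
Import Order.TTheory GRing.Theory Num.Theory.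
Import numFieldNormedType.Exports.
Local Open Scope classical_set_scope.
Local Open Scope ring_scope.
Local Open Scope quotient_scope.

Definition Zsub (R : realType) : zmodClosed R :=
  GRing.ZmodClosed.clone R (@Num.int_num_subdef R) _.

(* The circle R/Z, with the quotient group structure, the quotient topology and
   its Borel sigma-algebra. *)
Definition circle (R : realType) : Type := Quotient.quot (Zsub R).

HB.instance Definition _ (R : realType) :=
  Topological.copy (circle R) (quotient_topology (Quotient.quot (Zsub R))).
HB.instance Definition _ (R : realType) :=
  GRing.Zmodule.copy (circle R) (Quotient.quot (Zsub R)).
HB.instance Definition _ (R : realType) :=
  Quotient.copy (circle R) (Quotient.quot (Zsub R)).
HB.instance Definition _ (R : realType) := isPointed.Build (circle R) 0.
HB.instance Definition _ (R : realType) :=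
  Measurable.copy (circle R) (g_sigma_algebraType (@open (circle R))).

Section circle_maps.
Variable R : realType.
Implicit Types x y : circle R.

Definition circle_proj (r : R) : circle R := \pi_(circle R) r.

(* The quotient distance: the infimum is taken over the real lifts of x - y. *)
Definition circle_dist x y : R :=
  inf [set `|r| | r in [set r : R | circle_proj r = x - y]].

Lemma circle_proj_eq (r s : R) :
  circle_proj r = circle_proj s <-> r - s \is a Num.int.
Proof.
have /(_ r s) rsE := Quotient.idealrBE (Zsub R).
split=> [rs|]; first by rewrite -[_ \is a _]/(_ \in Zsub R) rsE; exact/eqP.
by rewrite -[_ \is a _]/(_ \in Zsub R) rsE => /eqP.
Qed.

Lemma circle_projD (r s : R) :
  circle_proj (r + s) = circle_proj r + circle_proj s.
Proof. exact: Quotient.pi_add. Qed.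

Lemma circle_projMn (r : R) n : circle_proj (r *+ n) = circle_proj r *+ n.
Proof.
elim: n => [|n IH]; last by rewrite !mulrS circle_projD IH.
by rewrite !mulr0n; apply: (addIr (circle_proj 0)); rewrite -circle_projD !add0r.
Qed.

Lemma circle_projK x : circle_proj (repr x) = x.
Proof. exact: reprK. Qed.

Lemma continuous_circle_proj : continuous circle_proj.
Proof. exact: pi_continuous. Qed.

Lemma open_circleE (U : set (circle R)) : open U = open (circle_proj @^-1` U).
Proof. by []. Qed.

Lemma measurable_circle_proj : measurable_fun [set: R] circle_proj.
Proof.
apply: (measurability (@open (circle R))) => //.
move=> _ [U oU <-]; rewrite setTI; exact: open_measurable.
Qed.

Definition circle_proj_mfun : {mfun measurableTypeR R >-> circle R} :=
  HB.pack circle_proj (@isMeasurableFun.Build _ _ (measurableTypeR R) (circle R)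
    circle_proj measurable_circle_proj).

(* x |-> d x mod 1 *)
Definition circle_mul (d : nat) x : circle R := x *+ d.

Lemma measurable_circle_mul (d : nat) :
  measurable_fun [set: circle R] (circle_mul d).
Proof.
apply: (measurability (@open (circle R))) => //.
move=> _ [U oU <-]; rewrite setTI; apply: sub_sigma_algebra.
rewrite open_circleE.
have -> : circle_proj @^-1` (circle_mul d @^-1` U) =
          (fun r => r *+ d) @^-1` (circle_proj @^-1` U).
  by apply/seteqP; split=> r /=; rewrite /circle_mul circle_projMn.
apply: open_comp => // r _.
elim: (d) => [|n IH]; first exact: cst_continuous.
under eq_fun do rewrite mulrS.
exact: cvgD.
Qed.

HB.instance Definition _ d := isMeasurableFun.Build _ _ _ _
  (circle_mul d) (measurable_circle_mul d).

(* the representative of a class in [0, 1[ *)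
Definition circle_sec x : R := repr x - (Num.floor (repr x))%:~R.

Lemma circle_secK x : circle_proj (circle_sec x) = x.
Proof.
rewrite -[RHS]circle_projK; apply/circle_proj_eq.
by rewrite /circle_sec addrAC subrr sub0r rpredN intr_int.
Qed.

Lemma circle_sec_itv x : 0 <= circle_sec x < 1.
Proof.
rewrite /circle_sec subr_ge0 floor_le/= ltrBlDr.
by have := floorD1_gt (repr x); rewrite intrD addrC.
Qed.

Lemma circle_projKE (r : R) : circle_sec (circle_proj r) = r - (Num.floor r)%:~R.
Proof.
rewrite /circle_sec; have := circle_projK (circle_proj r).
set s := repr _ => /circle_proj_eq/intrP[n snr].
have -> : s = r + n%:~R by rewrite -snr addrC subrK.
by rewrite floorDrz ?intr_int// intrKfloor intrD opprD addrACA subrr addr0.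
Qed.

Lemma measurable_circle_sec : measurable_fun [set: circle R] circle_sec.
Proof.
apply: (measurability (@RGenOInfty.G R) (RGenOInfty.measurableE R)).
move=> _ [_ [y ->] <-]; rewrite setTI; apply: sub_sigma_algebra.
rewrite open_circleE; have [y0|y0] := ltP y 0.
  rewrite [X in open X](_ : _ = setT); first exact: openT.
  apply/seteqP; split=> // r _ /=; rewrite in_itv/= andbT (lt_le_trans y0)//.
  by have /andP[] := circle_sec_itv (circle_proj r).
rewrite [X in open X](_ : _ = \bigcup_(n : int) `]n%:~R + y, n%:~R + 1[%classic).
  by apply: bigcup_open => n _; exact: interval_open.
apply/seteqP; split=> r /=; rewrite in_itv/= andbT circle_projKE.
  move=> yr; exists (Num.floor r) => //=; rewrite in_itv/= -ltrBrDl yr/=.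
  by have := floorD1_gt r; rewrite intrD.
case=> n _ /=; rewrite in_itv/= => /andP[nyr rn1].
rewrite (@floor_def _ r n) ?ltrBrDl// intrD rn1 andbT.
by rewrite (le_trans _ (ltW nyr))// lerDl.
Qed.

(* Id + v, where the real number v x acts on the circle by translation *)
Definition circle_shift (v : circle R -> R) x : circle R :=
  x + circle_proj (v x).

Lemma measurable_circle_shift (v : circle R -> R) :
  measurable_fun [set: circle R] v ->
  measurable_fun [set: circle R] (circle_shift v).
Proof.
move=> mv; rewrite [X in measurable_fun _ X](_ : _ =
    circle_proj \o (circle_sec \+ v)); last first.
  by apply/funext => x; rewrite /circle_shift /= circle_projD circle_secK.
apply: measurableT_comp; first exact: measurable_circle_proj.
by apply: measurable_funD => //; exact: measurable_circle_sec.
Qed.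

End circle_maps.
(* L^2(mu; R) as the normed space of square-integrable functions modulo equality
   mu-almost everywhere. The library quotient LspaceType carries no module
   structure, hence this quotient of LfunType by the almost-everywhere null
   functions. *)
Section L2.
Context {d : measure_display} {T : measurableType d} {R : realType}.
Variable mu : {measure set T -> \bar R}.

Local Notation L2fun := (LfunType mu (lee1n 2)).

Definition ae0 : {pred L2fun} := fun f => `[< {ae mu, forall x, f x = 0} >].

Lemma ae0_zmod_closed : zmod_closed ae0.
Proof.
split=> [|f g /asboolP f0 /asboolP g0]; first exact/asboolP/aeW.
apply/asboolP; apply: filterS2 f0 g0 => x fx0 gx0.
by rewrite -[LHS]/(f x - g x) fx0 gx0 subrr.
Qed.

HB.instance Definition _ := GRing.isZmodClosed.Build L2fun ae0 ae0_zmod_closed.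

Definition L2 : Type := Quotient.quot ae0.
HB.instance Definition _ := GRing.Zmodule.on L2.
HB.instance Definition _ := Quotient.on L2.

Definition L2_class (f : L2fun) : L2 := \pi_L2 f.
Definition L2_repr (v : L2) : L2fun := repr v.

Lemma L2_classE (f g : L2fun) :
  L2_class f = L2_class g <-> {ae mu, forall x, f x = g x}.
Proof.
have /(_ f g) fgE := Quotient.idealrBE ae0.
split=> [fg|fg].
  have : f - g \in ae0 by rewrite fgE; exact/eqP.
  by move/asboolP; apply: filterS => x; rewrite -[LHS]/(f x - g x) => /subr0_eq.
apply/eqP; rewrite -fgE; apply/asboolP; move: fg; apply: filterS => x fgx.
by rewrite -[LHS]/(f x - g x) fgx subrr.
Qed.

Lemma L2_reprK v : L2_class (L2_repr v) = v.
Proof. exact: reprK. Qed.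

Lemma L2_classK (f : L2fun) : {ae mu, forall x, L2_repr (L2_class f) x = f x}.
Proof. exact/L2_classE/L2_reprK. Qed.

Lemma L2_classD (f g : L2fun) : L2_class (f + g) = L2_class f + L2_class g.
Proof. exact: Quotient.pi_add. Qed.

Lemma L2_class0 : L2_class 0 = 0.
Proof. by apply: (addIr (L2_class 0)); rewrite -L2_classD !add0r. Qed.

Definition L2_scale (a : R) (v : L2) : L2 := L2_class (a *: L2_repr v).

Lemma L2_scale_class (a : R) (f : L2fun) :
  L2_scale a (L2_class f) = L2_class (a *: f).
Proof.
apply/L2_classE; apply: filterS (L2_classK f) => x fx.
by rewrite -[LHS]/(a * L2_repr (L2_class f) x) fx.
Qed.

Fact L2_scaleA a b v : L2_scale a (L2_scale b v) = L2_scale (a * b) v.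
Proof. by rewrite -[v]L2_reprK !L2_scale_class scalerA. Qed.

Fact L2_scale1 : left_id 1 L2_scale.
Proof. by move=> v; rewrite -[v]L2_reprK L2_scale_class scale1r. Qed.

Fact L2_scaleDr : right_distributive L2_scale +%R.
Proof.
move=> a u v; rewrite -[u]L2_reprK -[v]L2_reprK.
by rewrite -L2_classD !L2_scale_class scalerDr L2_classD.
Qed.

Fact L2_scaleDl v : {morph L2_scale^~ v : a b / a + b}.
Proof.
move=> a b; rewrite -[v]L2_reprK.
by rewrite !L2_scale_class scalerDl L2_classD.
Qed.

HB.instance Definition _ := GRing.Zmodule_isLmodule.Build R L2
  L2_scaleA L2_scale1 L2_scaleDr L2_scaleDl.

Lemma L2_classZ a (f : L2fun) : L2_class (a *: f) = a *: L2_class f.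
Proof. by rewrite -L2_scale_class. Qed.

Definition L2_norm (v : L2) : R := fine ('N[mu]_2%:R%:E[EFin \o L2_repr v])%E.

Lemma L2_norm_class (f : L2fun) :
  L2_norm (L2_class f) = fine ('N[mu]_2%:R%:E[EFin \o f])%E.
Proof.
rewrite /L2_norm unlock; congr (fine (_ `^ _)%E).
have mf (h : L2fun) : measurable_fun [set: T]
    (fun x => (`|(EFin \o h) x| `^ 2%:R)%E).
  apply: (measurableT_comp (measurable_poweR _)) => //.
  by apply: measurableT_comp => //; exact/measurable_EFinP.
apply: ge0_ae_eq_integral => //; try by move=> x _; exact: poweR_ge0.
by apply: filterS (L2_classK f) => x fx _ /=; rewrite fx.
Qed.

Fact ler_L2_normD u v : L2_norm (u + v) <= L2_norm u + L2_norm v.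
Proof.
rewrite -[u]L2_reprK -[v]L2_reprK -L2_classD !L2_norm_class.
exact: ler_LnormD.
Qed.

Fact L2_normZ a v : L2_norm (a *: v) = `|a| * L2_norm v.
Proof.
rewrite -[v]L2_reprK -L2_classZ !L2_norm_class.
rewrite (_ : EFin \o _ = EFin \o (a \*: L2_repr v))//.
by rewrite LnormZ fineM// fin_numElt (lt_le_trans ltNy0 (Lnorm_ge0 _ _ _))/=;
  exact: Lfunction_finite.
Qed.

Fact L2_norm_eq0 v : L2_norm v = 0 -> v = 0.
Proof.
rewrite -[v]L2_reprK L2_norm_class => /fine_Lnormr_eq0 v0.
by rewrite -L2_class0; apply/L2_classE; apply: filterS v0 => x /(_ I).
Qed.

HB.instance Definition _ := @Lmodule_isNormed.Build R L2 L2_norm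
  ler_L2_normD L2_normZ L2_norm_eq0.

End L2.

(* The closed subspace of L^2(P; R) of the classes with zero mean, with the norm
   of L^2(P; R). *)
Section L20.
Context {d : measure_display} {T : measurableType d} {R : realType}.
Variable P : probability T R.

Definition mean0 : {pred L2 P} :=
  fun v => (\int[P]_x L2_repr v x)%R == 0.

Lemma L2_integrable (f : LfunType P (lee1n 2)) :
  P.-integrable [set: T] (EFin \o f).
Proof.
apply/Lfun1_integrable.
apply: (@Lfun_subset12 _ _ _ P) => //; first by rewrite fin_num_measure.
exact: LfunP.
Qed.

Lemma mean0_class (f : LfunType P (lee1n 2)) :
  (L2_class f \in mean0) = ((\int[P]_x f x)%R == 0).
Proof.
rewrite [LHS]/(_ == _) /Rintegral; congr (fine _ == 0).
apply: ae_eq_integral => //; do 1?[exact/measurable_EFinP].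
by apply: filterS (L2_classK f) => x fx _ /=; rewrite fx.
Qed.

Lemma mean0_submod_closed : submod_closed mean0.
Proof.
split=> [|a u v]; first by rewrite -L2_class0 mean0_class; apply/eqP;
    rewrite /Rintegral integral0.
rewrite -[u]L2_reprK -[v]L2_reprK -L2_classZ -L2_classD !mean0_class.
move: (L2_repr u) (L2_repr v) => f g /eqP f0 /eqP g0.
rewrite [X in X == _](_ : _ = \int[P]_x (a * f x + g x))//.
rewrite RintegralD//; last exact: L2_integrable.
  by rewrite RintegralZl//; [rewrite f0 g0 mulr0 addr0|exact: L2_integrable].
exact: (L2_integrable (a *: f)).
Qed.

HB.instance Definition _ :=
  GRing.isSubmodClosed.Build R (L2 P) mean0 mean0_submod_closed.

Record L20 := MkL20 { L20_val : L2 P ; L20_mean0 : L20_val \in mean0 }.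

HB.instance Definition _ := [isSub for L20_val].
HB.instance Definition _ := [Choice of L20 by <:].
HB.instance Definition _ := [SubChoice_isSubLmodule of L20 by <:].

Definition L20_norm (v : L20) : R := `|L20_val v|.

Fact ler_L20_normD u v : L20_norm (u + v) <= L20_norm u + L20_norm v.
Proof. exact: ler_normD. Qed.

Fact L20_normZ a v : L20_norm (a *: v) = `|a| * L20_norm v.
Proof. exact: normrZ. Qed.

Fact L20_norm_eq0 v : L20_norm v = 0 -> v = 0.
Proof. by move=> /normr0_eq0 v0; exact/val_inj. Qed.

HB.instance Definition _ := @Lmodule_isNormed.Build R L20 L20_norm
  ler_L20_normD L20_normZ L20_norm_eq0.

End L20.

Section wasserstein.
Variable R : realType.

HB.instance Definition _ (v : {mfun circle R >-> R}) :=
  isMeasurableFun.Build _ _ _ _ (circle_shift v)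
    (measurable_circle_shift (@measurable_funPT _ _ _ _ v)).

Definition circle_lebesgue : probability (circle R) R :=
  distribution (uniform_prob (@ltr01 R))
    (circle_proj_mfun R).

(* mu + v; the result does not depend on the representative of v. *)
Definition displace (mu : probability (circle R) R) (v : L2 mu) :
  probability (circle R) R := distribution mu (circle_shift (L2_repr v)).

Definition coupling (mu nu : probability (circle R) R) :
  set (probability (circle R * circle R)%type R) :=
  [set Pi | (forall A, measurable A -> Pi (A `*` setT) = mu A) /\
            (forall B, measurable B -> Pi (setT `*` B) = nu B)].

(* The infimum is finite (product coupling, bounded distance), so fine is
   harmless. *)
Definition wasserstein (mu nu : probability (circle R) R) : R :=
  Num.sqrt (fine (ereal_inf
    [set (\int[Pi]_z ((circle_dist z.1 z.2) ^+ 2)%:E)%E | Pi in coupling mu nu])).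

Local Notation lambda := circle_lebesgue.

(* L is the Gateaux derivative at lambda of a map F that fixes lambda. *)
Definition is_gateaux_derivative
    (F : probability (circle R) R -> probability (circle R) R)
    (L : L20 lambda -> L20 lambda) : Prop :=
  [/\ linear L, continuous L &
      forall v : L20 lambda,
        wasserstein (F (displace (L20_val (t *: v))))
                    (displace (L20_val (t *: L v))) / t
          @[t --> (0 : R)^'] --> (0 : R)].

Definition Phi_push (d : nat) (mu : probability (circle R) R) :
  probability (circle R) R := distribution mu (@circle_mul R d).

(* Meaningful for d >= 2, where the derivative exists and is unique. *)
Definition D_Phi (d : nat) : L20 lambda -> L20 lambda :=
  get (is_gateaux_derivative (Phi_push d)).

Definition E (d : nat) : set (L20 lambda) := [set v | D_Phi d v = v].

End wasserstein.
Arguments E : clear implicits.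

Section dimension.
Context {R : realType} {V : lmodType R}.

(* Linear algebra in a module that is not assumed finite-dimensional. *)
Definition spanned {n : nat} (e : 'I_n -> V) : set V :=
  [set v | exists c : 'I_n -> R, v = \sum_(i < n) c i *: e i].

Definition linearly_independent {n : nat} (e : 'I_n -> V) : Prop :=
  forall c : 'I_n -> R, \sum_(i < n) c i *: e i = 0 -> forall i, c i = 0.

Definition has_dimension (S : set V) (n : nat) : Prop :=
  exists e : 'I_n -> V, linearly_independent e /\ S = spanned e.

(* S lies in no finite-dimensional subspace; for a subspace S this says that S is
   not finite-dimensional. *)
Definition infinite_dimensional (S : set V) : Prop :=
  forall (n : nat) (e : 'I_n -> V), ~ (S `<=` spanned e).

End dimension.

(* Main.v *)
(** The Gateaux derivative of [Phi_d#] at [lam] is the transfer operator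
    [v |-> sum_j v((x + j)/d)].  For existence, move from [d X] by [t d v(X)], with
    [X] uniform, and couple the result with a second uniform point moved by [t] times
    the conditional mean of [d v(X)] given [d X]; for Lipschitz data the two end points
    differ by [O(t^2)], and Lipschitz functions are dense in [L^2].  Uniqueness follows
    by testing against [cos (2 pi k x + th)], and shows that the derivative [L]
    satisfies [(L v)^(k) = d v^(d k)] for the Fourier coefficients [v^].  Hence
    invariance under all [d] gives [v^(k) = v^(1) / k], so that [v] is determined by the
    complex number [v^(1)]; the sawtooth [1/2 - x] and [log |2 sin (pi x)|] are
    invariant by their classical multiplication formulas and span the space.  For
    [d = 2, 3] only, every dilation [x |-> m x] with [m = 1 mod 6] maps an invariant
    function to an invariant one, and the dilated sawtooths are linearly independent. *)

From HB Require Import structures.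
Require Import Defs.
From mathcomp Require Import all_boot all_order all_algebra.
From mathcomp Require Import all_classical all_reals all_analysis.
From mathcomp Require Import measurable_realfun.
From mathcomp Require Import ring lra complex.
Set Implicit Arguments.
Unset Strict Implicit.
Unset Printing Implicit Defensive.
Import Order.TTheory GRing.Theory Num.Theory.
Import numFieldNormedType.Exports.
Local Open Scope classical_set_scope.
Local Open Scope ring_scope.

(** * Lebesgue measure on the circle *)

(** With a common base point the coupling would fail: the two end points would differ by
    [t (d v(X) - L v(d X))], which is of order [t]. Moving the second base point by this difference
    cancels the first-order term. Since the difference has conditional mean 0 given [d X], the moved
    point is uniform to first order, and defining it implicitly makes it exactly uniform.

    No Fourier coefficient of the sawtooth or of the logarithm is ever computed. An invariant vector
    with vanishing coefficients at frequency 1 is 0, so linear independence of the two functions,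
    read off from their signs, already shows that their coefficients at frequency 1 form an
    invertible matrix. The same argument gives the nonzero diagonal entries for the dilated
    sawtooths. Square-integrability of the logarithm is likewise drawn from its invariance, for
    [d = 2], and not from estimates near the singularity. *)

Lemma circle_sec_proj (R : realType) (r : R) :
  0 <= r < 1 -> circle_sec (circle_proj r) = r.
Proof.
move=> /andP[r0 r1]; rewrite circle_projKE.
by rewrite (@floor_def _ r 0) ?subr0// r0 add0r r1.
Qed.

Lemma circle_lebesgue_integral (R : realType) (F : circle R -> \bar R) :
  measurable_fun [set: circle R] F -> (forall x, 0 <= F x)%E ->
  (\int[circle_lebesgue R]_x F x =
   \int[lebesgue_measure]_(r in `[0%R, 1%R[) F (circle_proj r))%E.
Proof.
move=> mF F0; have mFp : measurable_fun [set: R] (F \o @circle_proj R).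
  by apply: measurableT_comp => //; exact: measurable_circle_proj.
rewrite ge0_integral_distribution//.
rewrite integral_uniform//=; rewrite subr0 invr1 mul1e.
by rewrite -integral_itv_bndo_bndc//; exact: measurable_funTS.
Qed.

Lemma measurable_circle_sec_le (R : realType) (c : R) :
  measurable [set x : circle R | circle_sec x <= c].
Proof.
rewrite -[X in measurable X]setTI.
apply: (@measurable_circle_sec R measurableT [set r | r <= c]).
by rewrite -set_itvNyc; exact: measurable_itv.
Qed.

Lemma circle_lebesgue_le (R : realType) (c : R) : 0 <= c <= 1 ->
  circle_lebesgue R [set x | circle_sec x <= c] = c%:E.
Proof.
move=> /andP[c0 c1].
have mS := @measurable_circle_sec_le R c.
transitivity (\int[circle_lebesgue R]_x
    (\1_[set x : circle R | circle_sec x <= c] x)%:E)%E.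
  by rewrite integral_indic// setIT.
rewrite circle_lebesgue_integral//; last first.
  by apply/measurable_EFinP; exact: measurable_indic.
transitivity (\int[lebesgue_measure]_(r in `[0%R, 1%R[) (\1_(`[0, c]) r)%:E)%E.
  apply: eq_integral => r; rewrite inE/= in_itv/= => r01.
  have r0 : 0 <= r by case/andP: r01.
  rewrite !indicE; have [rc|rc] := leP r c.
    by rewrite !mem_set//= ?in_itv/= ?r0// circle_sec_proj.
  rewrite !memNset//= ?in_itv/= ?circle_sec_proj//; last by apply/negP; rewrite -ltNge.
  by rewrite r0 leNgt rc.
rewrite integral_indic//; have [{}c1|] := ltP c 1.
  have -> : `[0, c]%classic `&` `[0, 1[%classic = `[0, c]%classic.
    apply/seteqP; split => [x []//|x /=]; rewrite !in_itv/= => /andP[-> xc].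
    by rewrite xc (le_lt_trans xc).
  rewrite [LHS](lebesgue_measure_itv `[0, c])/= lte_fin lt_neqAle c0 andbT.
  by case: eqP => [<-//|_] /=; rewrite sube0.
move=> c1'; have -> : `[0, c]%classic `&` `[0, 1[%classic = `[0%R, 1%R[%classic :> set R.
  apply/seteqP; split => [x []//|x /=]; rewrite !in_itv/= => /andP[-> xc].
  by rewrite xc (le_trans (ltW xc)).
rewrite [LHS](lebesgue_measure_itv `[0, 1[)/= lte_fin ltr01 sube0.
by congr _%:E; apply/le_anti; rewrite c1 c1'.
Qed.

(** Through [circle_sec] the circle is a measurable copy of [[0, 1[], so a probability is determined
    by its distribution function there. *)
Lemma circle_probability_eq (R : realType) (P Q : probability (circle R) R) :
  (forall c : R, 0 <= c <= 1 ->
     P [set x | circle_sec x <= c] = Q [set x | circle_sec x <= c]) ->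
  forall A, measurable A -> P A = Q A.
Proof.
move=> PQ A mA.
pose s : {mfun circle R >-> measurableTypeR R} :=
  HB.pack (@circle_sec R) (@isMeasurableFun.Build _ _ (circle R) (measurableTypeR R)
    (@circle_sec R) (@measurable_circle_sec R)).
have sA : A = s @^-1` (@circle_proj R @^-1` A).
  by apply/seteqP; split=> x /=; rewrite circle_secK.
have mpA : measurable (@circle_proj R @^-1` A : set (measurableTypeR R)).
  by rewrite -[X in measurable X]setTI; exact: measurable_circle_proj.
have cdfE r : distribution P s `]-oo, r] = distribution Q s `]-oo, r].
  rewrite /distribution /pushforward /=; have [r0|r0] := ltP r 0.
    have -> : @circle_sec R @^-1` `]-oo, r] = set0.
      apply/seteqP; split => // x /=; rewrite in_itv/= => sx.
      have /andP[s0 _] := circle_sec_itv x.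
      by have := le_lt_trans s0 (le_lt_trans sx r0); rewrite ltxx.
    by rewrite !measure0.
  have [r1|r1] := leP r 1.
    have -> : @circle_sec R @^-1` `]-oo, r] = [set x | circle_sec x <= r].
      by apply/seteqP; split => x /=; rewrite in_itv.
    by apply: PQ; rewrite r0.
  have -> : @circle_sec R @^-1` `]-oo, r] = setT.
    apply/seteqP; split => // x _ /=; rewrite in_itv/=.
    have /andP[_ s1] := circle_sec_itv x.
    by rewrite (le_trans (ltW s1) (ltW r1)).
  by rewrite !probability_setT.
rewrite sA -[LHS]/(distribution P s _) -[RHS]/(distribution Q s _).
(* A law on the line is the Stieltjes measure of its distribution function, so comparison on
   half-open intervals suffices. *)
rewrite -[LHS]lebesgue_stieltjes_cdf_id//.
apply: lebesgue_stieltjes_measure_unique => // X oX.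
rewrite [LHS]lebesgue_stieltjes_cdf_id; last exact: sub_sigma_algebra.
case: oX => -[a b] /= _ <-; have [ab|ba] := leP a b; last first.
  by rewrite set_itv_ge ?measure0// bnd_simp -leNgt ltW.
have abE : `]a, b]%classic = `]-oo, b] `\` `]-oo, a] :> set R.
  by rewrite -[RHS]setCK setCD setCitvl setUC -[LHS]setCK setCitv.
have saI : `]-oo, b]%classic `&` `]-oo, a] = `]-oo, a]%classic :> set R.
  by apply/setIidr; apply: subset_itvl; rewrite bnd_simp.
rewrite abE !measureD//.
- by rewrite saI; congr (_ - _)%E; exact: cdfE.
- by rewrite -ge0_fin_numE// fin_num_measure.
- by rewrite -ge0_fin_numE// fin_num_measure.
Qed.

Lemma circle_lebesgue_eq (R : realType) (P : probability (circle R) R) :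
  (forall c : R, 0 <= c <= 1 -> P [set x | circle_sec x <= c] = c%:E) ->
  forall A, measurable A -> P A = circle_lebesgue R A.
Proof.
move=> PE; apply: circle_probability_eq => c c01.
by rewrite PE// circle_lebesgue_le.
Qed.

(* [psi_j x = (x + j) / d], the [j]-th preimage of [x] under multiplication by [d]. *)
Definition circle_branch (R : realType) (d j : nat) (x : circle R) : circle R :=
  circle_proj ((circle_sec x + j%:R) / d%:R).

Section branch.
Variables (R : realType) (d : nat).
Hypothesis d_gt0 : (0 < d)%N.
Local Notation lam := (circle_lebesgue R).

Lemma measurable_circle_branch j :
  measurable_fun [set: circle R] (@circle_branch R d j).
Proof.
apply: measurableT_comp; first exact: measurable_circle_proj.
apply: measurable_funM => //; apply: measurable_funD => //.
exact: measurable_circle_sec.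
Qed.

HB.instance Definition _ j := isMeasurableFun.Build _ _ _ _
  (@circle_branch R d j) (measurable_circle_branch j).

Lemma circle_branch_itv j (s : R) : (j < d)%N -> 0 <= s < 1 ->
  0 <= (s + j%:R) / d%:R < 1.
Proof.
move=> jd /andP[s0 s1]; have d0 : 0 < d%:R :> R by rewrite ltr0n.
have jd1 : j.+1%:R <= d%:R :> R by rewrite ler_nat.
rewrite -natr1 in jd1; rewrite divr_ge0 ?addr_ge0// ?ler0n//=.
by rewrite ltr_pdivrMr// mul1r; lra.
Qed.

Lemma circle_branch_sec j (x : circle R) : (j < d)%N ->
  circle_sec (circle_branch d j x) = (circle_sec x + j%:R) / d%:R.
Proof.
by move=> jd; rewrite circle_sec_proj// circle_branch_itv// circle_sec_itv.
Qed.

Lemma circle_mul_branch j (x : circle R) :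
  circle_mul d (circle_branch d j x) = x.
Proof.
rewrite /circle_mul /circle_branch -circle_projMn -[_ *+ d]mulr_natr divfK ?pnatr_eq0 -?lt0n//.
rewrite -[RHS]circle_secK; apply/circle_proj_eq.
by rewrite addrAC subrr add0r.
Qed.

(** On branch [j] the condition reads [circle_sec x <= d c - j], so the measure is [d c - j] clamped
    to [[0, 1]]. As a difference of consecutive terms it telescopes when summed over [j]. *)
Lemma branch_le_measure j (c : R) : (j < d)%N -> 0 <= c <= 1 ->
  lam (@circle_branch R d j @^-1` [set x | circle_sec x <= c]) =
  (Num.max (d%:R * c - j%:R) 0 - Num.max (d%:R * c - j.+1%:R) 0)%:E.
Proof.
move=> jd /andP[c0 c1]; have d0 : 0 < d%:R :> R by rewrite ltr0n.
have -> : @circle_branch R d j @^-1` [set x | circle_sec x <= c] =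
    [set x | circle_sec x <= d%:R * c - j%:R].
  apply/seteqP; split=> x /=; rewrite circle_branch_sec// ler_pdivrMr// => h;
  lra.
rewrite -natr1 opprD addrA; set u := _ - _.
have [u0|u0] := ltP u 0.
  have -> : [set x : circle R | circle_sec x <= u] = set0.
    apply/seteqP; split=> // x /= sx; have /andP[s0 _] := circle_sec_itv x.
    by have := le_lt_trans (le_trans s0 sx) u0; rewrite ltxx.
  by rewrite measure0 !max_r ?subrr//; lra.
have [u1|u1] := leP u 1.
  by rewrite circle_lebesgue_le ?u0// max_r ?subr0//; lra.
have -> : [set x : circle R | circle_sec x <= u] = setT.
  apply/seteqP; split=> // x _ /=; have /andP[_ s1] := circle_sec_itv x.
  exact: ltW (lt_trans s1 u1).
by rewrite probability_setT max_l; first congr (_%:E); lra.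
Qed.

(** Lebesgue measure is the mean of its images under the [d] branches; on arcs, which suffice, the
    sum over [j] telescopes to [d c]. *)
Lemma ge0_integral_branch (F : circle R -> \bar R) :
  measurable_fun [set: circle R] F -> (forall x, 0 <= F x)%E ->
  (\int[lam]_x F x =
   (d%:R^-1)%:E * \sum_(j < d) \int[lam]_x F (circle_branch d j x))%E.
Proof.
move=> mF F0.
have d0 : 0 <= d%:R^-1 :> R by rewrite invr_ge0.
pose s : {measure set (circle R) -> \bar R} :=
  msum (fun j => distribution lam (@circle_branch R d j)) d.
pose m : {measure set (circle R) -> \bar R} := mscale (NngNum d0) s.
have mE A : m A = ((d%:R^-1)%:E * \sum_(j < d)
    lam (@circle_branch R d j @^-1` A))%E by [].
have m1 : m setT = 1%:E.
  rewrite mE (eq_bigr (fun=> 1%:E)); last first.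
    by move=> j _; rewrite preimage_setT probability_setT.
  rewrite sumEFin sumr_const card_ord -EFinM mulVf// pnatr_eq0 -lt0n//.
pose P : probability (circle R) R :=
  HB.pack (Measure.sort m) (Measure.class m)
  (Measure_isProbability.Build _ _ _ m m1).
have PE : forall A, measurable A -> P A = lam A.
  apply: circle_lebesgue_eq => c c01.
  rewrite -[LHS]/(m _) mE (eq_bigr (fun j : 'I_d =>
    ((fun k => - Num.max (d%:R * c - k%:R) 0) j.+1 -
     (fun k => - Num.max (d%:R * c - k%:R) 0) j)%:E)); last first.
    by move=> j _; rewrite branch_le_measure//= opprK addrC.
  rewrite sumEFin -(big_mkord xpredT (fun j =>
    (fun k => - Num.max (d%:R * c - k%:R) 0) j.+1 -
     (fun k => - Num.max (d%:R * c - k%:R) 0) j)).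
  rewrite telescope_sumr//= subr0 max_r; last first.
    by rewrite subr_le0 ler_piMr//; case/andP: c01.
  rewrite oppr0 add0r opprK max_l; last by rewrite mulr_ge0//; case/andP: c01.
  by rewrite -EFinM mulKf// pnatr_eq0 -lt0n.
transitivity (\int[m]_x F x)%E.
  apply: eq_measure_integral => A mA _; exact: (esym (PE A mA)).
rewrite ge0_integral_mscale// ge0_integral_measure_sum//=.
congr (_ * _)%E; apply: eq_bigr => j _.
by rewrite ge0_integral_distribution.
Qed.

End branch.

(** * Square-integrable functions and the transfer operator *)

Section Lfun2.
Context d (T : measurableType d) (R : realType) (P : probability T R).
Local Notation sq := (Lfun P 2%:E).

Lemma Lfun2_measurable (f : T -> R) : f \in sq -> measurable_fun [set: T] f.
Proof. by move=> /andP[/[!inE]/= mf _]. Qed.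

Lemma Lfun2I (f : T -> R) : measurable_fun [set: T] f ->
  (\int[P]_x (f x ^+ 2)%:E < +oo)%E -> f \in sq.
Proof.
move=> mf f2; rewrite inE; apply/andP; split; rewrite !inE//=.
rewrite /finite_norm unlock poweR_lty//.
by under eq_integral => x _ do rewrite /= powR_mulrn// real_normK ?num_real//.
Qed.

Lemma Lfun2_sqr_fin (f : T -> R) : f \in sq ->
  (\int[P]_x (f x ^+ 2)%:E)%E \is a fin_num.
Proof.
by move=> /Lfun2_integrable_sqr; exact: integrable_fin_num.
Qed.

Lemma Lfun2_integrable (f : T -> R) : f \in sq -> P.-integrable [set: T] (EFin \o f).
Proof.
move=> f2; apply/Lfun1_integrable.
by apply: (@Lfun_subset12 _ _ _ P) => //; rewrite fin_num_measure.
Qed.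

Lemma Lfun2_mul (f g : T -> R) : f \in sq -> g \in sq ->
  P.-integrable [set: T] (EFin \o (fun x => f x * g x)).
Proof. by move=> f2 g2; apply/Lfun1_integrable; exact: Lfun2_mul_Lfun1. Qed.

Lemma Lfun2_bounded (f : T -> R) (M : R) : measurable_fun [set: T] f ->
  (forall x, `|f x| <= M) -> f \in sq.
Proof.
move=> mf fM; apply: Lfun2I => //.
have M0 (x : T) : 0 <= M by exact: le_trans (normr_ge0 _) (fM x).
apply: (@le_lt_trans _ _ (\int[P]_x (cst (M ^+ 2)%:E x))%E).
  apply: ge0_le_integral => //.
  - by move=> x _; rewrite lee_fin sqr_ge0.
  - by apply/measurable_EFinP; exact: measurable_funX.
  - by move=> x _; rewrite lee_fin -real_normK ?num_real// lerXn2r ?nnegrE// (M0 x).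
by rewrite integral_cst// [X in (_ * X)%E](@probability_setT _ _ _ P) mule1 ltry.
Qed.


Lemma Lfun2_norm2 (f : LfunType P (lee1n 2)) :
  `|L2_class f| ^+ 2 = \int[P]_x (f x ^+ 2).
Proof.
rewrite -[X in X ^+ _]/(L2_norm _) L2_norm_class unlock.
under eq_integral => x _ do rewrite /= powR_mulrn// real_normK ?num_real//.
have /fineK <- := Lfun2_sqr_fin (LfunP f).
rewrite poweR_EFin/= -/(Rintegral _ _ _) -powR_mulrn ?powR_ge0// -powRrM.
by rewrite mulVf// powRr1// Rintegral_ge0// => x _; rewrite sqr_ge0.
Qed.

Lemma Lfun20 : (fun=> 0) \in sq.
Proof. by have [] := Lfun_addr_closed P (lee1n 2). Qed.

Lemma Lfun2D (f g : T -> R) : f \in sq -> g \in sq -> (fun x => f x + g x) \in sq.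
Proof. by have [_] := Lfun_addr_closed P (lee1n 2); exact. Qed.

Lemma Lfun2Z a (f : T -> R) : f \in sq -> (fun x => a * f x) \in sq.
Proof.
move=> f2; have [f0 /(_ a f (fun=> 0) f2 f0)] := Lfun_submod_closed P (lee1n 2).
suff <- : a *: f + (fun=> 0) = (fun x => a * f x) by [].
by apply/funext => x; exact: addr0.
Qed.

Lemma Lfun2B (f g : T -> R) : f \in sq -> g \in sq -> (fun x => f x - g x) \in sq.
Proof.
move=> f2 g2; have := Lfun2D f2 (Lfun2Z (- 1) g2).
suff -> : (fun x => f x + - 1 * g x) = (fun x => f x - g x) by [].
by apply/funext => x; rewrite mulN1r.
Qed.

End Lfun2.

Lemma Rintegral_sum_ord d (T : measurableType d) (R : realType)
    (mu : {measure set T -> \bar R}) n (h : 'I_n -> T -> R) :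
  (forall j, mu.-integrable [set: T] (EFin \o h j)) ->
  \int[mu]_x (\sum_(j < n) h j x) = \sum_(j < n) \int[mu]_x h j x.
Proof.
move=> hi; rewrite /Rintegral.
under eq_integral => x _ do rewrite -sumEFin.
rewrite (integral_sum _ (f := fun j x => (h j x)%:E))// -sum_fine// => j _.
by apply: (integrable_fin_num _ (hi j)).
Qed.

(** Cauchy-Schwarz, from the nonnegativity of the sum of the squares [(n a_j - S)^2]. *)
Lemma sqr_sum_ord_le (R : realFieldType) n (a : 'I_n -> R) :
  (\sum_(j < n) a j) ^+ 2 <= n%:R * \sum_(j < n) a j ^+ 2.
Proof.
case: n a => [|n] a; first by rewrite !big_ord0 expr0n mulr0.
set S := \sum_(j < _) a j; set Q := \sum_(j < _) _.
have : 0 <= \sum_(j < n.+1) (n.+1%:R * a j - S) ^+ 2.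
  by apply: sumr_ge0 => j _; exact: sqr_ge0.
under eq_bigr do rewrite sqrrB exprMn.
rewrite big_split sumrB /= sumr_const card_ord -mulr_sumr.
rewrite sumrMnl -/Q.
under [X in _ - X *+ 2]eq_bigr do rewrite mulrAC.
rewrite -mulr_sumr -/S -[S ^+ 2 *+ _]mulr_natl.
have n0 : 0 < n.+1%:R :> R by rewrite ltr0n.
rewrite (_ : _ + _ = n.+1%:R * (n.+1%:R * Q - S ^+ 2)).
  by rewrite pmulr_rge0// subr_ge0.
by ring.
Qed.

Section transfer.
Variables (R : realType) (d : nat).
Hypothesis d_gt0 : (0 < d)%N.
Local Notation lam := (circle_lebesgue R).

Definition transfer (f : circle R -> R) (x : circle R) : R :=
  \sum_(j < d) f (circle_branch d j x).

(** In the branch decomposition of the integral of [|f|] all terms are nonnegative, so an infinite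
    one would make the whole infinite. *)
Lemma integrable_branch (f : circle R -> R) j : (j < d)%N ->
  lam.-integrable [set: circle R] (EFin \o f) ->
  lam.-integrable [set: circle R] (EFin \o (f \o @circle_branch R d j)).
Proof.
move=> jd /integrableP[mf fi]; apply/integrableP; split.
  by apply: measurableT_comp mf _; exact: measurable_circle_branch.
move: fi; rewrite (@ge0_integral_branch _ _ d_gt0)//; last exact: measurableT_comp.
rewrite (bigD1 (Ordinal jd))//=; apply: contraTT; rewrite -!leNgt !leye_eq => /eqP ->.
rewrite addye; first by rewrite gt0_muley ?lte_fin ?invr_gt0 ?ltr0n.
by rewrite gt_eqF// (lt_le_trans ltNy0)// sume_ge0// => j' _; exact: integral_ge0.
Qed.

Lemma Rintegral_branch (f : circle R -> R) :
  lam.-integrable [set: circle R] (EFin \o f) ->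
  \int[lam]_x f x = d%:R^-1 * \sum_(j < d) \int[lam]_x f (circle_branch d j x).
Proof.
move=> fi; have ge0 (g : circle R -> R) : (forall x, 0 <= g x) ->
  lam.-integrable [set: circle R] (EFin \o g) ->
  \int[lam]_x g x = d%:R^-1 * \sum_(j < d) \int[lam]_x g (circle_branch d j x).
  move=> g0 gi; have ig (j : 'I_d) := integrable_branch (ltn_ord j) gi.
  rewrite {1}/Rintegral (@ge0_integral_branch _ _ d_gt0)//; last first.
    exact: (measurable_int lam).
  have -> : (\sum_(j < d) \int[lam]_x (g (circle_branch d j x))%:E)%E =
      (\sum_(j < d) \int[lam]_x g (circle_branch d j x))%:E.
    rewrite -sumEFin; apply: eq_bigr => j _.
    by rewrite /Rintegral fineK//; apply: (integrable_fin_num _ (ig j)).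
  by [].
have fp := integrable_funrpos measurableT fi.
have fn := integrable_funrneg measurableT fi.
have fE x : f x = f^\+ x - f^\- x by rewrite -[in LHS](funrposBneg f).
under eq_Rintegral do rewrite fE.
rewrite RintegralB// (ge0 f^\+)// (ge0 f^\-)// -mulrBr -sumrB.
congr (_ * _); apply: eq_bigr => j _; rewrite -RintegralB//.
- by apply: eq_Rintegral => x _; rewrite fE.
- exact: (integrable_branch (ltn_ord j) fp).
- exact: (integrable_branch (ltn_ord j) fn).
Qed.

Lemma measurable_transfer (f : circle R -> R) :
  measurable_fun [set: circle R] f ->
  measurable_fun [set: circle R] (transfer f).
Proof.
move=> mf; apply: measurable_sum => j.
by apply: measurableT_comp mf _; exact: measurable_circle_branch.
Qed.

Lemma Lfun2_branch (f : circle R -> R) j : (j < d)%N -> f \in Lfun lam 2%:E ->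
  f \o @circle_branch R d j \in Lfun lam 2%:E.
Proof.
move=> jd f2; apply: Lfun2I.
  apply: measurableT_comp (measurable_circle_branch _ _); exact: Lfun2_measurable f2.
have := integrable_branch jd (Lfun2_integrable_sqr f2).
by move=> /integrable_fin_num; rewrite fin_numElt => /(_ measurableT) /andP[].
Qed.

Lemma Lfun2_transfer (f : circle R -> R) : f \in Lfun lam 2%:E ->
  transfer f \in Lfun lam 2%:E.
Proof.
move=> f2; rewrite /transfer.
rewrite (_ : (fun x => _) = \sum_(j < d) (f \o @circle_branch R d j)).
  apply: (big_ind (fun g : circle R -> R => g \in Lfun lam 2%:E)).
  - exact: Lfun20.
  - by move=> g h; exact: Lfun2D.
  - by move=> j _; exact: Lfun2_branch.
by apply/funext => x; rewrite fct_sumE.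
Qed.

(** Up to the factor [d], the transfer operator is the adjoint in [L^2] of composition with
    multiplication by [d]. *)
Lemma Rintegral_transfer_mul (f g : circle R -> R) :
  f \in Lfun lam 2%:E -> g \in Lfun lam 2%:E ->
  \int[lam]_x (transfer f x * g x) = d%:R * \int[lam]_x (f x * g (circle_mul d x)).
Proof.
move=> f2 g2.
have fgi : lam.-integrable [set: circle R]
    (EFin \o (fun x => f x * g (circle_mul d x))).
  apply: Lfun2_mul => //; apply: Lfun2I.
    by apply: measurableT_comp (Lfun2_measurable g2) _.
  rewrite (@ge0_integral_branch _ _ d_gt0)//; last 2 first.
    apply/measurable_EFinP; apply: measurable_funX.
    exact: measurableT_comp (Lfun2_measurable g2) _.
    by move=> x; rewrite lee_fin sqr_ge0.
  under eq_bigr do under eq_integral do rewrite circle_mul_branch//.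
  rewrite -(fineK (Lfun2_sqr_fin g2)) sumEFin -EFinM ltry//.
rewrite (Rintegral_branch fgi) mulVKf ?pnatr_eq0 -?lt0n//.
rewrite -Rintegral_sum_ord; last first.
  by move=> j; exact: (integrable_branch (ltn_ord j) fgi).
apply: eq_Rintegral => x _; rewrite mulr_suml; apply: eq_bigr => j _.
by rewrite circle_mul_branch.
Qed.

Lemma Rintegral_transfer (f : circle R -> R) : f \in Lfun lam 2%:E ->
  \int[lam]_x transfer f x = d%:R * \int[lam]_x f x.
Proof.
move=> f2; have := Rintegral_transfer_mul f2 (Lfun_cst lam 1 2).
by under eq_Rintegral do rewrite mulr1; under [X in _ * X]eq_Rintegral do rewrite mulr1.
Qed.

(** Pointwise Cauchy-Schwarz over the branches costs one factor [d], and [Rintegral_branch] the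
    other. *)
Lemma le_sqr_transfer (f : circle R -> R) : f \in Lfun lam 2%:E ->
  \int[lam]_x (transfer f x ^+ 2) <= d%:R ^+ 2 * \int[lam]_x (f x ^+ 2).
Proof.
move=> f2; have f2i := Lfun2_integrable_sqr f2.
rewrite (Rintegral_branch f2i) -mulrA mulVKf ?pnatr_eq0 -?lt0n//.
have fji (j : 'I_d) := integrable_branch (ltn_ord j) f2i.
rewrite -Rintegral_sum_ord// -RintegralZl//; last first.
  rewrite [X in integrable _ _ X](_ : _ = (fun x => \sum_(j < d)
    (f (circle_branch d j x) ^+ 2)%:E)%E).
    by apply: integrable_sum => // j _; exact: fji.
  by apply/funext => x /=; rewrite sumEFin.
apply: le_Rintegral => //.
- exact: (Lfun2_integrable_sqr (Lfun2_transfer f2)).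
- rewrite [X in integrable _ _ X](_ : _ = (fun x => d%:R%:E * \sum_(j < d)
    (f (circle_branch d j x) ^+ 2)%:E)%E).
    apply: integrableZl => //.
    by apply: integrable_sum => // j _; exact: fji.
  by apply/funext => x /=; rewrite sumEFin EFinM.
- by move=> x _; exact: sqr_sum_ord_le.
Qed.
End transfer.

(** * Wasserstein distance *)

(** Jensen's inequality: integrate the tangent bound [2 m f - m^2 <= f^2] at the mean [m]. *)
Lemma sqr_Rintegral_le d (T : measurableType d) (R : realType)
    (P : probability T R) (f : T -> R) : f \in Lfun P 2%:E ->
  (\int[P]_x f x) ^+ 2 <= \int[P]_x (f x ^+ 2).
Proof.
move=> f2; have fi := Lfun2_integrable f2; set m := \int[P]_x f x.
have mfi : P.-integrable [set: T] (EFin \o (fun x => (2 * m) * f x)).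
  exact: (Lfun2_integrable (Lfun2Z _ f2)).
have ci : P.-integrable [set: T] (EFin \o (fun=> m ^+ 2)).
  exact: (Lfun2_integrable (Lfun_cst P _ _)).
have P1 : fine (P [set: T]) = 1 by rewrite probability_setT.
have : \int[P]_x ((2 * m) * f x - m ^+ 2) <= \int[P]_x (f x ^+ 2).
  apply: le_Rintegral => //.
  - exact: (Lfun2_integrable (Lfun2B (Lfun2Z _ f2) (Lfun_cst P _ _))).
  - exact: Lfun2_integrable_sqr.
  - by move=> x _; have := sqr_ge0 (f x - m); rewrite sqrrB; lra.
rewrite RintegralB// RintegralZl// Rintegral_cst// P1 -/m.
by apply: le_trans; lra.
Qed.

Section wasserstein.
Variable R : realType.
Local Notation lam := (circle_lebesgue R).

Lemma circle_projB (r s : R) :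
  circle_proj (r - s) = circle_proj r - circle_proj s.
Proof.
by apply: (addIr (circle_proj s)); rewrite -circle_projD !subrK.
Qed.

Lemma circle_dist_le (x y : circle R) (r : R) :
  circle_proj r = x - y -> circle_dist x y <= `|r|.
Proof.
move=> rE; apply: ge_inf; last by exists r.
by exists 0 => _ [s _ <-].
Qed.

Lemma circle_dist_ge (x y : circle R) (a : R) :
  (forall r, circle_proj r = x - y -> a <= `|r|) -> a <= circle_dist x y.
Proof.
move=> ha; apply: lb_le_inf; last by move=> _ [r /= rE <-]; exact: ha.
by exists `|circle_sec (x - y)|; exists (circle_sec (x - y)) => //=; rewrite circle_secK.
Qed.

Lemma circle_dist_ge0 (x y : circle R) : 0 <= circle_dist x y.
Proof. exact: circle_dist_ge. Qed.

(** The lift of least absolute value is the representative [s] in [[0, 1[] or [s - 1]. This closed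
    form yields measurability of the distance and the bound by 1. *)
Lemma circle_distE (x y : circle R) :
  circle_dist x y = Num.min (circle_sec (x - y)) (1 - circle_sec (x - y)).
Proof.
have /andP[s0 s1] := circle_sec_itv (x - y).
have sK := circle_secK (x - y).
set s := circle_sec _ in s0 s1 sK *.
apply/le_anti/andP; split; last first.
  apply: circle_dist_ge => r; rewrite -sK => /circle_proj_eq/intrP[n rsn].
  have -> : r = s + n%:~R by rewrite -rsn addrC subrK.
  have [n0|n0] := leP 0 n.
    have {}n0 : 0 <= n%:~R :> R by rewrite ler0z.
    by rewrite ger0_norm; [rewrite ge_min lerDl n0|lra].
  have : n%:~R <= -1 :> R by rewrite (_ : -1 = (-1)%:~R)// ler_int -ltzD1.
  move=> n1; rewrite ler0_norm; last lra.
  by rewrite ge_min; apply/orP; right; lra.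
rewrite le_min; apply/andP; split.
  by apply: le_trans (circle_dist_le sK) _; rewrite ger0_norm.
apply: le_trans (@circle_dist_le _ _ (s - 1) _) _; last by rewrite ler0_norm; lra.
rewrite -sK; apply/circle_proj_eq.
by rewrite addrAC subrr add0r rpredN int_num1.
Qed.

Lemma measurable_circle_dist :
  measurable_fun [set: circle R * circle R] (fun z => circle_dist z.1 z.2).
Proof.
rewrite (_ : (fun z => _) = (fun z : circle R * circle R =>
  let s := circle_sec (circle_proj (circle_sec z.1 - circle_sec z.2)) in
  Num.min s (1 - s))); last first.
  by apply/funext => z; rewrite circle_distE /= circle_projB !circle_secK.
have ms : measurable_fun [set: circle R * circle R] (fun z =>
    circle_sec (circle_proj (circle_sec z.1 - circle_sec z.2)) : R).
  apply: measurableT_comp; first exact: measurable_circle_sec.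
  apply: measurableT_comp; first exact: measurable_circle_proj.
  by apply: measurable_funB; apply: measurableT_comp => //; exact: measurable_circle_sec.
by apply: measurable_minr => //; exact: measurable_funB.
Qed.

Section upper.
Context d (T : measurableType d) (P : probability T R).
Variables A B : {mfun T >-> circle R}.

Let AB_measurable : measurable_fun [set: T] (fun x => (A x, B x)).
Proof. exact: measurable_fun_pair. Qed.

Let AB : {mfun T >-> (circle R * circle R)%type} :=
  HB.pack (fun x => (A x, B x)) (isMeasurableFun.Build _ _ _ _
    (fun x => (A x, B x)) AB_measurable).

Lemma coupling_distribution :
  coupling (distribution P A) (distribution P B) (distribution P AB).
Proof.
split=> C mC; rewrite /distribution /pushforward /=; congr (P _);
  by apply/seteqP; split => x //= [].
Qed.

(** The joint law of [A] and [B] is a coupling, and any real lift of [A - B] dominates the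
    distance. *)
Lemma wasserstein_sqr_le (r : T -> R) : r \in Lfun P 2%:E ->
  (forall x, circle_proj (r x) = A x - B x) ->
  wasserstein (distribution P A) (distribution P B) ^+ 2 <= \int[P]_x (r x ^+ 2).
Proof.
move=> r2 rE.
have rfin := Lfun2_sqr_fin r2.
rewrite /wasserstein; set I := ereal_inf _.
have I0 : (0 <= I)%E.
  apply/ereal_infP => _ [Pi _ <-]; apply: integral_ge0 => z _.
  by rewrite lee_fin sqr_ge0.
have Ir : (I <= \int[P]_x (r x ^+ 2)%:E)%E.
  apply: ge_ereal_inf; eexists.
    by exists (distribution P AB); [exact: coupling_distribution|reflexivity].
  rewrite ge0_integral_distribution//; last 2 first.
    apply/measurable_EFinP; apply: measurable_funX; exact: measurable_circle_dist.
    by move=> z; rewrite lee_fin sqr_ge0.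
  apply: ge0_le_integral => //.
  - by move=> z _; rewrite /= lee_fin sqr_ge0.
  - apply/measurable_EFinP; apply: measurable_funX.
    exact: (measurableT_comp measurable_circle_dist AB_measurable).
  - apply/measurable_EFinP; apply: measurable_funX; exact: Lfun2_measurable r2.
  - move=> x _; rewrite lee_fin /= -[leRHS]real_normK ?num_real//.
    by rewrite lerXn2r ?nnegrE ?circle_dist_ge0//; exact: circle_dist_le.
rewrite sqr_sqrtr ?fine_ge0// /Rintegral fine_le//.
by rewrite ge0_fin_numE// (le_lt_trans Ir)// ltey_eq rfin.
Qed.

(** The easy half of Kantorovich duality: along any coupling the difference of the means is the
    integral of [phi z.1 - phi z.2], and Jensen's inequality passes from the mean of the distance to
    its quadratic mean. *)
Lemma wasserstein_dual (phi : circle R -> R) (K : R) : 0 < K ->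
  measurable_fun [set: circle R] phi -> (forall x, `|phi x| <= 1) ->
  (forall x y, `|phi x - phi y| <= K * circle_dist x y) ->
  `|\int[P]_x phi (A x) - \int[P]_x phi (B x)| <=
  K * wasserstein (distribution P A) (distribution P B).
Proof.
move=> K0 mphi phi1 phiL; rewrite /wasserstein; set I := ereal_inf _.
set D := _ - _.
have dist1 (x y : circle R) : `|circle_dist x y| <= 1.
  rewrite ger0_norm ?circle_dist_ge0// circle_distE ge_min.
  by have /andP[_ /ltW ->] := circle_sec_itv (x - y).
have mdist2 : measurable_fun [set: circle R * circle R]
    (fun z => ((circle_dist z.1 z.2) ^+ 2)%:E).
  apply/measurable_EFinP; apply: measurable_funX; exact: measurable_circle_dist.
have marginal (Pi : probability (circle R * circle R)%type R)
    (C : {mfun T >-> circle R}) (p : {mfun (circle R * circle R)%type >-> circle R}) :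
    (forall S, measurable S -> Pi (p @^-1` S) = distribution P C S) ->
  \int[P]_x phi (C x) = \int[Pi]_z phi (p z).
  move=> pC; rewrite /Rintegral; congr fine.
  transitivity (\int[distribution P C]_y (phi y)%:E)%E.
    rewrite integral_distribution//; first exact/measurable_EFinP.
    apply: Lfun2_integrable; apply: (@Lfun2_bounded _ _ _ _ _ 1) => //.
    exact: measurableT_comp.
  transitivity (\int[distribution Pi p]_y (phi y)%:E)%E.
    apply: eq_measure_integral => S mS _; exact: (esym (pC _ mS)).
  rewrite integral_distribution//; first exact/measurable_EFinP.
  apply: Lfun2_integrable; apply: (@Lfun2_bounded _ _ _ _ _ 1) => //.
  exact: measurableT_comp.
have DI : ((D ^+ 2 / K ^+ 2)%:E <= I)%E.
  apply/ereal_infP => _ [Pi [PiA PiB] <-].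
  have mp1 : measurable_fun [set: circle R * circle R] (fun z => phi z.1).
    exact: measurableT_comp.
  have mp2 : measurable_fun [set: circle R * circle R] (fun z => phi z.2).
    exact: measurableT_comp.
  have p1_2 : (fun z => phi z.1) \in Lfun Pi 2%:E by exact: (@Lfun2_bounded _ _ _ _ _ 1).
  have p2_2 : (fun z => phi z.2) \in Lfun Pi 2%:E by exact: (@Lfun2_bounded _ _ _ _ _ 1).
  have DE : D = \int[Pi]_z (phi z.1 - phi z.2).
    rewrite RintegralB//; try exact: Lfun2_integrable.
    congr (_ - _).
      apply: (marginal _ A
        (HB.pack fst (isMeasurableFun.Build _ _ _ _ fst measurable_fst)))
        => S mS; rewrite -PiA//; congr (Pi _).
      by apply/seteqP; split => z //= [].
    apply: (marginal _ B
      (HB.pack snd (isMeasurableFun.Build _ _ _ _ snd measurable_snd)))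
      => S mS; rewrite -PiB//; congr (Pi _).
    by apply/seteqP; split => z //= [].
  have d2 : (fun z => circle_dist z.1 z.2) \in Lfun Pi 2%:E.
    apply: (@Lfun2_bounded _ _ _ _ _ 1) => //; exact: measurable_circle_dist.
  rewrite -(fineK (Lfun2_sqr_fin d2)) lee_fin ler_pdivrMr ?exprn_gt0// DE.
  apply: le_trans (sqr_Rintegral_le (Lfun2B p1_2 p2_2)) _.
  rewrite -/(Rintegral _ _ _) -RintegralZr//; last exact: Lfun2_integrable_sqr.
  apply: le_Rintegral => //.
  - exact: (Lfun2_integrable_sqr (Lfun2B p1_2 p2_2)).
  - rewrite [X in integrable _ _ X](_ : _ = EFin \o (fun z => (K * circle_dist z.1 z.2) ^+ 2)).
      exact: (Lfun2_integrable_sqr (Lfun2Z K d2)).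
    by apply/funext => z /=; rewrite exprMn mulrC.
  - move=> z _; rewrite mulrC -exprMn -[leLHS]real_normK ?num_real//.
    by rewrite lerXn2r ?nnegrE// mulr_ge0 ?circle_dist_ge0// ltW.
have I0 : (0 <= I)%E by apply: le_trans DI; rewrite lee_fin divr_ge0// sqr_ge0.
(* [fine] would send an infinite infimum to 0 and falsify the lower bound; the joint law of [A] and
   [B] has finite cost. *)
have If : I \is a fin_num.
  rewrite ge0_fin_numE//.
  apply: (@le_lt_trans _ _
    (\int[distribution P AB]_z ((circle_dist z.1 z.2) ^+ 2)%:E)%E).
    by apply: ge_ereal_inf; eexists;
      [exists (distribution P AB); [exact: coupling_distribution|reflexivity]|].
  rewrite ltey_eq; apply/orP; left.
  apply: (@Lfun2_sqr_fin _ _ _ _ (fun z => circle_dist z.1 z.2)).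
  apply: (@Lfun2_bounded _ _ _ _ _ 1) => //; exact: measurable_circle_dist.
rewrite -(@ler_pXn2r _ 2)// ?nnegrE ?mulr_ge0 ?sqrtr_ge0// ?(ltW K0)//.
rewrite exprMn sqr_sqrtr ?fine_ge0// real_normK ?num_real//.
by rewrite mulrC -ler_pdivrMr ?exprn_gt0// -lee_fin fineK.
Qed.

End upper.
End wasserstein.

(** * Density of Lipschitz functions *)

Lemma ae_circle_sec (R : realType) (Q : R -> Prop) :
  {ae (@lebesgue_measure R), forall r, Q r} ->
  {ae circle_lebesgue R, forall x, Q (circle_sec x)}.
Proof.
move=> [N [mN N0 QN]]; have mN' : measurable (@circle_sec R @^-1` N).
  by rewrite -[X in measurable X]setTI; exact: (@measurable_circle_sec R).
exists (@circle_sec R @^-1` N); split => //; last by move=> x /= /QN.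
transitivity (\int[circle_lebesgue R]_x (\1_(@circle_sec R @^-1` N) x)%:E)%E.
  by rewrite integral_indic// setIT.
rewrite circle_lebesgue_integral//; last first.
  by apply/measurable_EFinP; exact: measurable_indic.
transitivity (\int[lebesgue_measure]_(r in `[0%R, 1%R[) (\1_N r)%:E)%E.
  apply: eq_integral => r; rewrite inE/= in_itv/= => r01.
  rewrite !indicE (_ : (circle_proj r \in _) = (r \in N))//.
  by apply/idP/idP; rewrite !inE /preimage /= circle_sec_proj.
rewrite integral_indic//.
apply/eqP; rewrite -measure_le0 -N0; apply: le_measure; rewrite ?inE//.
exact: measurableI.
Qed.

Section average.
Variables (R : realType) (h : R -> R) (M : R).
Hypotheses (mh : measurable_fun [set: R] h) (hM : forall x, `|h x| <= M)
  (h_itv : forall x, ~~ (0 <= x <= 1) -> h x = 0).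
Local Notation mu := (@lebesgue_measure R).

Lemma bounded_itv_integrable : mu.-integrable [set: R] (EFin \o h).
Proof.
have hE : EFin \o h = (EFin \o h) \_ `[0, 1].
  apply/funext => x; rewrite patchE /=; case: ifPn => //.
  by rewrite mem_setE in_itv/= => /h_itv ->.
rewrite hE -integrable_mkcond//; apply: measurable_bounded_integrable => //.
- by rewrite [ltLHS](lebesgue_measure_itv `[0, 1])/= lte01 sube0 ltry.
- exact: measurable_funTS.
- exists M; split; first exact: num_real.
  by move=> y My x _ /=; exact: le_trans (hM x) (ltW My).
Qed.

Definition itv_primitive (y : R) : R := \int[mu]_(t in `]-oo, y]) h t.

Lemma itv_primitiveB x y : x <= y ->
  itv_primitive y - itv_primitive x = \int[mu]_(t in `]x, y]) h t.
Proof.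
move=> xy; rewrite /itv_primitive Rintegral_itvB//.
by apply: integrableS bounded_itv_integrable.
Qed.

Lemma itv_primitive_le x y : x <= y ->
  `|itv_primitive y - itv_primitive x| <= M * (y - x).
Proof.
move=> xy; rewrite itv_primitiveB//.
have mxy : fine (mu `]x, y]) = y - x.
  rewrite [X in fine X](lebesgue_measure_itv `]x, y])/= lte_fin.
  by case: ltP => //= yx; apply/esym/eqP; rewrite subr_eq0 eq_le xy yx.
have hi : mu.-integrable `]x, y] (EFin \o h).
  by apply: integrableS bounded_itv_integrable.
apply: le_trans (le_normr_Rintegral _ hi) _ => //.
rewrite -mxy -Rintegral_cst//; apply: le_Rintegral => //.
- by rewrite (_ : _ \o _ = abse \o (EFin \o h))//; exact: integrable_abse.
- apply: measurable_bounded_integrable => //.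
    by rewrite [ltLHS](lebesgue_measure_itv `]x, y])/=; case: ifP => _; rewrite ?ltry// -EFinB ltry.
  exists M; split; first exact: num_real.
  move=> z Mz t _ /=; rewrite ger0_norm ?(ltW Mz)//.
  exact: le_trans (normr_ge0 _) (hM 0).
Qed.

(** The mean of [h] over an interval of length [1 / (k + 1)] to the right of [x]. As a difference
    quotient of an [M]-Lipschitz primitive it is bounded by [M] and Lipschitz. *)
Definition average (k : nat) (x : R) : R :=
  k.+1%:R * (itv_primitive (x + k.+1%:R^-1) - itv_primitive x).

Lemma average_le k x : `|average k x| <= M.
Proof.
rewrite /average normrM ger0_norm//.
have k0 : 0 < k.+1%:R :> R by rewrite ltr0n.
have xk : x <= x + k.+1%:R^-1 by rewrite lerDl invr_ge0 ltW.
apply: le_trans (ler_wpM2l (ltW k0) (itv_primitive_le xk)) _.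
by rewrite addrAC subrr add0r mulrCA divff ?mulr1// gt_eqF.
Qed.

Lemma average_lipschitz k x y : `|average k x - average k y| <= k.+1%:R * (2 * M) * `|x - y|.
Proof.
wlog xy : x y / x <= y.
  move=> wl; have [xy|/ltW yx] := leP x y; first exact: wl.
  by rewrite distrC (distrC x); exact: wl.
rewrite /average -mulrBr normrM ger0_norm// -!mulrA ler_wpM2l//.
rewrite (_ : _ - _ = (itv_primitive y - itv_primitive x) -
  (itv_primitive (y + k.+1%:R^-1) - itv_primitive (x + k.+1%:R^-1))); last by ring.
apply: le_trans (ler_normB _ _) _.
have xy' : x + k.+1%:R^-1 <= y + k.+1%:R^-1 by rewrite lerD2r.
have Gxy := itv_primitive_le xy; have Gxy' := itv_primitive_le xy'.
rewrite (addrC x) (addrC y) opprD addrACA subrr add0r in Gxy'.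
rewrite (distrC x y) (ger0_norm (_ : 0 <= y - x)) ?subr_ge0//.
by rewrite mulr_natl mulr2n lerD// (addrC y) (addrC x).
Qed.

Lemma average_eq0 k x : (forall t, x < t <= x + k.+1%:R^-1 -> h t = 0) ->
  average k x = 0.
Proof.
move=> ht; rewrite /average itv_primitiveB ?lerDl ?invr_ge0//.
rewrite (@eq_Rintegral _ _ _ _ _ (fun=> 0)) ?Rintegral_cst ?mul0r ?mulr0//.
by move=> t; rewrite inE/= in_itv/= => /ht.
Qed.

(** At a Lebesgue point the primitive is differentiable with derivative [h x], and the averages are
    its difference quotients along [1 / (k + 1)]. *)
Lemma average_cvg : {ae mu, forall x, average k x @[k --> \oo] --> h x}.
Proof.
have hi := bounded_itv_integrable.
have := lebesgue_differentiation (open_integrable_locally openT hi).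
apply: filterS; first exact: (ae_filter_ringOfSetsType mu).
move=> x hx.
have xu : x < x + 1 by rewrite ltrDl.
have hiu : mu.-integrable `]-oo, x + 1] (EFin \o h) by exact: integrableS hi.
have [dG GE] := FTC1_lebesgue_pt xu hiu (ltNyr x) hx.
have Gx : t^-1 *: (itv_primitive (t + x) - itv_primitive x) @[t --> 0^'] --> h x.
  rewrite -GE; move: dG; rewrite /derivable /=.
  by under eq_fun do rewrite scaler1.
have /cvgr_dnbhsP/(_ (fun k => k.+1%:R^-1)) := Gx.
rewrite (_ : (fun k => average k x) = (fun k : nat => (k.+1%:R^-1)^-1 *:
  (itv_primitive (k.+1%:R^-1 + x) - itv_primitive x))); last first.
  by apply/funext => k; rewrite invrK [_ + x]addrC.
apply; split; first by move=> n; rewrite invr_neq0.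
exact: cvg_harmonic.
Qed.

End average.

Lemma lipschitz_continuous (R : realType) (g : R -> R) (l : R) :
  (forall x y, `|g x - g y| <= l * `|x - y|) -> continuous g.
Proof.
move=> gl x.
(* The sign of [l] is unknown; [|l| + 1] is a positive Lipschitz constant. *)
have l0 : 0 < `|l| + 1 by rewrite ltr_wpDl.
apply/cvgrPdist_lt => e e0; near=> y.
apply: le_lt_trans (gl x y) _.
apply: (@le_lt_trans _ _ ((`|l| + 1) * `|x - y|)).
  by rewrite ler_wpM2r// ler_wpDr// ler_norm.
rewrite mulrC -ltr_pdivlMr//; near: y.
exact: (@cvgr_dist_lt _ R^o _ _ _ id x cvg_id _ (divr_gt0 e0 l0)).
Unshelve. all: by end_near. Qed.

Lemma lipschitz_measurable (R : realType) (g : R -> R) (l : R) :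
  (forall x y, `|g x - g y| <= l * `|x - y|) -> measurable_fun [set: R] g.
Proof. by move=> /lipschitz_continuous; exact: continuous_measurable_fun. Qed.

(** Taking the index beyond [N] makes it possible to average over a window shorter than the gap left
    by the cutoff. *)
Lemma cvg0_exists (R : realType) (u : nat -> R) (e : R) (N : nat) : 0 < e ->
  u @ \oo --> 0 -> exists n, (N < n)%N /\ u n < e.
Proof.
move=> e0 /cvgr_lt/(_ e e0)[n _ un]; exists (maxn n N.+1); split.
  by rewrite leq_max leqnn orbT.
by apply: un => /=; exact: leq_maxl.
Qed.

Section density.
Variable R : realType.
Local Notation lam := (circle_lebesgue R).

(* Besides truncating the values, the cutoff leaves a gap at both ends of the unit
   interval, so that its averages vanish at [0] and [1]. *)
Definition cutoff (f : circle R -> R) (n : nat) (r : R) : R :=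
  if (`|f (circle_proj r)| <= n%:R) && (n.+1%:R^-1 <= r <= 1 - n.+1%:R^-1)
  then f (circle_proj r) else 0.

Lemma measurable_cutoff (f : circle R -> R) n :
  measurable_fun [set: circle R] f -> measurable_fun [set: R] (cutoff f n).
Proof.
move=> mf; have mfp : measurable_fun [set: R] (f \o @circle_proj R).
  by apply: measurableT_comp => //; exact: measurable_circle_proj.
apply: measurable_fun_if => //; last exact: measurable_funTS.
apply: measurable_and; last apply: measurable_and.
- by apply: measurable_fun_ler => //; exact: measurableT_comp.
- exact: measurable_fun_ler.
- exact: measurable_fun_ler.
Qed.

Lemma cutoff_le (f : circle R -> R) n r : `|cutoff f n r| <= n%:R.
Proof. by rewrite /cutoff; case: ifPn => [/andP[]//|_]; rewrite normr0. Qed.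

Lemma cutoff_eq0 (f : circle R -> R) n r :
  ~~ (n.+1%:R^-1 <= r <= 1 - n.+1%:R^-1) -> cutoff f n r = 0.
Proof. by rewrite /cutoff => /negbTE ->; rewrite andbF. Qed.

Lemma sqr_dominated_cvg (g_ : nat -> circle R -> R) (g : circle R -> R)
    (k : circle R -> R) :
  (forall n, measurable_fun setT (g_ n)) -> measurable_fun setT g ->
  k \in Lfun lam 2%:E -> (forall n x, `|g_ n x - g x| <= k x) ->
  {ae lam, forall x, g_ n x @[n --> \oo] --> g x} ->
  \int[lam]_x ((g_ n x - g x) ^+ 2) @[n --> \oo] --> 0.
Proof.
move=> mg_ mg k2 gk gcvg.
have [||||//|_ _] := @dominated_convergence _ _ _ lam setT measurableT
  (fun n x => ((g_ n x - g x) ^+ 2)%:E) (cst 0) (fun x => (k x ^+ 2)%:E).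
- by move=> n; apply/measurable_EFinP/measurable_funX/measurable_funB.
- exact: measurable_cst.
- apply: filterS gcvg => x gx _; apply: cvg_EFin; first exact: nearW.
  have gx0 : g_ n x - g x @[n --> \oo] --> 0.
    by rewrite -(subrr (g x)); apply: cvgB => //; exact: cvg_cst.
  have gg := cvgM gx0 gx0; rewrite mulr0 in gg.
  rewrite (_ : fine \o _ = fun n => (g_ n x - g x) * (g_ n x - g x)); first exact: gg.
  by apply/funext => n /=; rewrite expr2.
- exact: Lfun2_integrable_sqr.
- apply: aeW => x n _; rewrite lee_fin ger0_norm ?sqr_ge0//.
  by rewrite -real_normK ?num_real// lerXn2r ?nnegrE// (le_trans _ (gk n x)).
by rewrite integral0 => /fine_cvgP[].
Qed.

Lemma sqr_add_le (a b : R) : (a + b) ^+ 2 <= 2 * a ^+ 2 + 2 * b ^+ 2.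
Proof. by have := sqr_ge0 (a - b); rewrite sqrrB sqrrD; lra. Qed.

(** The cutoffs tend to [f] in [L^2], and the averages of a cutoff tend to that cutoff, both by
    dominated convergence. *)
Lemma lipschitz_dense (f : circle R -> R) (e : R) : f \in Lfun lam 2%:E -> 0 < e ->
  exists (g : R -> R) (M l : R),
  [/\ forall x, `|g x| <= M, forall x y, `|g x - g y| <= l * `|x - y|,
   g 0 = 0, g 1 = 0 & \int[lam]_x ((f x - g (circle_sec x)) ^+ 2) < e].
Proof.
move=> f2 e0; have mf := Lfun2_measurable f2.
have ms := @measurable_circle_sec R.
have c2 n : (fun x => cutoff f n (circle_sec x)) \in Lfun lam 2%:E.
  apply: (@Lfun2_bounded _ _ _ _ _ n%:R) => [|x]; last exact: cutoff_le.
  by apply: measurableT_comp => //; exact: measurable_cutoff.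
have near_invn (a : R) : 0 < a -> \forall n \near \oo, n.+1%:R^-1 <= a.
  move=> a0; near=> n.
  rewrite -[leRHS]invrK lef_pV2 ?posrE ?invr_gt0 ?ltr0n// (@le_trans _ _ n%:R)//.
    by near: n; exact: nbhs_infty_ger.
  by rewrite ler_nat.
have step1 : \int[lam]_x ((cutoff f n (circle_sec x) - f x) ^+ 2) @[n --> \oo] --> 0.
  apply: (@sqr_dominated_cvg _ _ (fun x => `|f x|)) => //.
  - by move=> n; exact: Lfun2_measurable (c2 n).
  - apply: Lfun2I; first exact: measurableT_comp.
    under eq_integral do rewrite /= real_normK ?num_real//.
    by have := Lfun2_sqr_fin f2; rewrite fin_numElt => /andP[].
  - move=> n x /=; rewrite /cutoff circle_secK; case: ifPn; rewrite ?subrr ?normr0//.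
    by rewrite sub0r normrN.
  (* The point 0 lies in the gap of every cutoff, so convergence can fail there. *)
  have : {ae lam, forall x, 0 < circle_sec x}.
    exists [set x | circle_sec x <= 0]; split; first exact: measurable_circle_sec_le.
      by rewrite circle_lebesgue_le ?lexx ?ler01.
    by move=> x /= /negP; rewrite -leNgt.
  apply: filterS => x x0; have /andP[_ x1] := circle_sec_itv x.
  apply: cvg_near_cst; near=> n.
  rewrite /cutoff circle_secK ifT//; apply/andP; split.
    by near: n; exact: nbhs_infty_ger.
  apply/andP; split; first by near: n; exact: near_invn.
  by rewrite lerBrDr -lerBrDl; near: n; apply: near_invn; rewrite subr_gt0.
(* The square of a sum of two errors is at most twice the sum of their squares, so each may take
   [e / 4]. *)
have e4 : 0 < e / 4 by rewrite divr_gt0.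
have [n [_ fn]] := cvg0_exists 0 e4 step1.
pose h := cutoff f n.
have mh : measurable_fun setT h := measurable_cutoff n mf.
have hM x : `|h x| <= n%:R := cutoff_le f n x.
have h_itv x : ~~ (0 <= x <= 1) -> h x = 0.
  move=> x01; apply: cutoff_eq0; apply: contra x01 => /andP[x0 x1].
  have i0 : 0 <= n.+1%:R^-1 :> R by rewrite invr_ge0.
  by rewrite (le_trans i0 x0) (le_trans x1)// gerBl.
have ma k : measurable_fun [set: circle R] (fun x => average h k (circle_sec x)).
  apply: measurableT_comp => //.
  exact: (lipschitz_measurable (average_lipschitz mh hM h_itv k)).
have a2 k : (fun x => average h k (circle_sec x)) \in Lfun lam 2%:E.
  apply: (@Lfun2_bounded _ _ _ _ _ n%:R) => // x; exact: (average_le mh hM h_itv).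
have step2 : \int[lam]_x ((average h k (circle_sec x) - h (circle_sec x)) ^+ 2) @[k --> \oo] --> 0.
  apply: (@sqr_dominated_cvg _ _ (cst (n%:R + n%:R))) => //.
  - exact: Lfun2_measurable (c2 n).
  - exact: Lfun_cst.
  - by move=> k x; apply: le_trans (ler_normB _ _) _; apply: lerD => //;
      exact: (average_le mh hM h_itv).
  exact: (ae_circle_sec (average_cvg mh hM h_itv)).
have [k [kn hk]] := cvg0_exists n e4 step2.
(* The averaging window starting at 0 then stays inside the gap, whence [g 0 = 0]. *)
have kn1 : k.+1%:R^-1 < n.+1%:R^-1 :> R by rewrite ltf_pV2 ?posrE// ltr_nat.
have n1 : n.+1%:R^-1 <= 1 :> R by rewrite invf_le1// ler1n.
exists (average h k), n%:R, (k.+1%:R * (2 * n%:R)); split.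
- by move=> x; exact: (average_le mh hM h_itv).
- by move=> x y; exact: (average_lipschitz mh hM h_itv).
- apply: (average_eq0 mh hM h_itv) => // t /andP[_ t1]; apply: cutoff_eq0.
  by rewrite add0r in t1; rewrite negb_and -ltNge (le_lt_trans t1).
- apply: (average_eq0 mh hM h_itv) => // t /andP[t1 _]; apply: cutoff_eq0.
  by rewrite negb_and -!ltNge orbC (le_lt_trans _ t1)// gerBl invr_ge0.
have i1 := Lfun2_integrable_sqr (Lfun2B (a2 k) (c2 n)).
have i2 := Lfun2_integrable_sqr (Lfun2B (c2 n) f2).
have i1' : lam.-integrable setT (EFin \o (fun x =>
    2 * (average h k (circle_sec x) - h (circle_sec x)) ^+ 2)).
  exact: (integrableZl measurableT 2 i1).
have i2' : lam.-integrable setT (EFin \o (fun x =>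
    2 * (h (circle_sec x) - f x) ^+ 2)).
  exact: (integrableZl measurableT 2 i2).
apply: (@le_lt_trans _ _ (\int[lam]_x
  (2 * (average h k (circle_sec x) - h (circle_sec x)) ^+ 2 +
   2 * (h (circle_sec x) - f x) ^+ 2))).
  apply: le_Rintegral => //.
  - exact: (Lfun2_integrable_sqr (Lfun2B f2 (a2 k))).
  - exact: (integrableD measurableT i1' i2').
  - move=> x _; apply: le_trans (sqr_add_le _ _); rewrite addrA subrK.
    by rewrite -[leLHS]sqrrN opprB.
rewrite RintegralD// !RintegralZl//; move: hk fn; rewrite /h; lra.
Unshelve. all: by end_near. Qed.

End density.

(** * The coupling *)

Definition mfun_pack d1 d2 (T1 : measurableType d1) (T2 : measurableType d2)
    (f : T1 -> T2) (mf : measurable_fun [set: T1] f) : {mfun T1 >-> T2} :=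
  HB.pack f (isMeasurableFun.Build _ _ _ _ f mf).

Lemma wasserstein_ext (R : realType) (mu mu' nu nu' : probability (circle R) R) :
  (forall S, measurable S -> mu S = mu' S) ->
  (forall S, measurable S -> nu S = nu' S) ->
  wasserstein mu nu = wasserstein mu' nu'.
Proof.
move=> mumu' nunu'; rewrite /wasserstein; congr (Num.sqrt (fine (ereal_inf _))).
congr (_ @` _); apply/seteqP; split => Pi [h1 h2]; split => S mS.
- by rewrite h1// mumu'.
- by rewrite h2// nunu'.
- by rewrite h1// mumu'.
- by rewrite h2// nunu'.
Qed.

Lemma circle_branch_surj (R : realType) (d : nat) (x : circle R) : (0 < d)%N ->
  exists2 j, (j < d)%N & x = circle_branch d j (circle_mul d x).
Proof.
move=> d0; have /andP[s0 s1] := circle_sec_itv x.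
have d0' : 0 < d%:R :> R by rewrite ltr0n.
pose u := d%:R * circle_sec x; have u0 : 0 <= u by rewrite mulr_ge0// ltW.
have xE : circle_mul d x = circle_proj u.
  by rewrite -{1}(circle_secK x) /circle_mul -circle_projMn -[_ *+ _]mulr_natl.
have [n nE] : exists n : nat, Num.floor u = n%:Z.
  by exists `|Num.floor u|%N; rewrite gez0_abs// floor_ge0.
have nu : n%:R <= u by have := floor_le u; rewrite nE.
exists n.
  rewrite -(ltr_nat R); apply: le_lt_trans nu _.
  by rewrite -[ltRHS]mulr1 ltr_pM2l.
rewrite /circle_branch xE circle_projKE nE subrK.
by rewrite /u mulrC mulKf ?gt_eqF// circle_secK.
Qed.

Section perturbation.
Variables (R : realType) (z : R -> R) (q M : R).
Hypotheses (q1 : q < 1) (zq : forall x y, `|z x - z y| <= q * `|x - y|)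
  (zM : forall x, `|z x| <= M).

Lemma perturb_lt x y : x < y -> x - z x < y - z y.
Proof.
move=> xy; have := zq y x; rewrite [X in _ * X]gtr0_norm ?subr_gt0// => h.
have := ler_norm (z y - z x).
have : q * (y - x) < y - x by rewrite gtr_pMl// subr_gt0.
by lra.
Qed.

Lemma perturb_le x y : (x - z x <= y - z y) = (x <= y).
Proof.
have [xy|yx] := leP x y; last by apply/negbTE; rewrite -ltNge perturb_lt.
by move: xy; rewrite le_eqVlt => /predU1P[->|/perturb_lt/ltW ->]; rewrite ?lexx.
Qed.

(** The bound on [z] puts the values at [y - M] and [y + M] on the two sides of [y]. *)
Lemma perturb_surj y : exists x, x - z x = y.
Proof.
have M0 : 0 <= M := le_trans (normr_ge0 _) (zM 0).
have yM : y - M <= y + M by lra.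
have cH : continuous (fun x => x - z x).
  by move=> x; apply: cvgB; [exact: cvg_id|exact: (lipschitz_continuous zq)].
have [|x _ <-] := @IVT R (fun x => x - z x) _ _ y yM (continuous_subspaceT cH);
  last by exists x.
have := zM (y - M); have := zM (y + M).
rewrite !ler_norml ge_min le_max /= => /andP[h1 h2] /andP[h3 h4].
by apply/andP; split; apply/orP; [left|right]; lra.
Qed.

End perturbation.

(* Let [X = psi_j y] be uniform and [U] the solution of [y = U - t g_j(U)].  Since
   [gm] is the mean of the [g_j], the point [Q X = U - t gm(U)] is uniform again.  The
   estimate couples [d X + t d f(X)] with the displacement of [Q X] by [t] times the
   transfer of [f], where [g_j] approximates [d f(psi_j)].  The functions [g_j] vanish
   at [0] and [1] so that all these maps preserve the unit interval. *)
Section gateaux.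
Variables (R : realType) (d : nat) (f : circle R -> R) (g : nat -> R -> R) (l M t e : R).
Local Notation lam := (circle_lebesgue R).
Hypotheses (d_gt0 : (0 < d)%N) (f2 : f \in Lfun lam 2%:E)
  (gM : forall j x, `|g j x| <= M) (gl : forall j x y, `|g j x - g j y| <= l * `|x - y|)
  (g0 : forall j, g j 0 = 0) (g1 : forall j, g j 1 = 0)
  (ge : forall j, (j < d)%N ->
    \int[lam]_x ((d%:R * f (circle_branch d j x) - g j (circle_sec x)) ^+ 2) < e)
  (tl : `|t| * l < 1).

Let gm (x : R) : R := d%:R^-1 * \sum_(j < d) g j x.

Let d0 : 0 < d%:R :> R. Proof. by rewrite ltr0n. Qed.

Let gmM x : `|gm x| <= M.
Proof.
rewrite /gm normrM ger0_norm ?invr_ge0 ?ler0n//.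
rewrite mulrC ler_pdivrMr//; apply: le_trans (ler_norm_sum _ _ _) _.
rewrite mulr_natr -[in leRHS](card_ord d) -sumr_const.
by apply: ler_sum => j _; exact: gM.
Qed.

Let gml x y : `|gm x - gm y| <= l * `|x - y|.
Proof.
rewrite /gm -mulrBr -sumrB normrM ger0_norm ?invr_ge0 ?ler0n//.
rewrite mulrC ler_pdivrMr//; apply: le_trans (ler_norm_sum _ _ _) _.
rewrite mulr_natr -[in leRHS](card_ord d) -sumr_const.
by apply: ler_sum => j _; exact: gl.
Qed.

Let scale_lip (h : R -> R) : (forall x y, `|h x - h y| <= l * `|x - y|) ->
  forall x y, `|t * h x - t * h y| <= `|t| * l * `|x - y|.
Proof.
by move=> hl x y; rewrite -mulrBr normrM -mulrA ler_wpM2l.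
Qed.

Let scale_bnd (h : R -> R) : (forall x, `|h x| <= M) ->
  forall x, `|t * h x| <= `|t| * M.
Proof. by move=> hM x; rewrite normrM ler_wpM2l. Qed.

Let K (j : nat) (y : R) : R :=
  projT1 (cid (perturb_surj (scale_lip (gl j)) (scale_bnd (gM j)) y)).

Let KE j y : K j y - t * g j (K j y) = y.
Proof. by rewrite /K; case: cid. Qed.

Let K_le j x y : (K j x <= K j y) = (x <= y).
Proof. by rewrite -(perturb_le tl (scale_lip (gl j))) !KE. Qed.

Let F (x : R) : R := x - t * gm x.

Let F_le x y : (F x <= F y) = (x <= y).
Proof. exact: (perturb_le tl (scale_lip gml)). Qed.

Let F0 : F 0 = 0.
Proof. by rewrite /F /gm big1 ?mulr0 ?subr0// => j _; rewrite g0. Qed.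

Let F1 : F 1 = 1.
Proof. by rewrite /F /gm big1 ?mulr0 ?subr0// => j _; rewrite g1. Qed.

Let K0 j : K j 0 = 0.
Proof.
have Hle := perturb_le tl (scale_lip (gl j)).
apply/le_anti; rewrite -(Hle (K j 0) 0) -(Hle 0 (K j 0)) !KE.
by rewrite g0 mulr0 subr0 lexx.
Qed.

Let K1 j : K j 1 = 1.
Proof.
have Hle := perturb_le tl (scale_lip (gl j)).
apply/le_anti; rewrite -(Hle (K j 1) 1) -(Hle 1 (K j 1)) !KE.
by rewrite g1 mulr0 subr0 lexx.
Qed.

Let FK_itv j y : 0 <= y < 1 -> 0 <= F (K j y) < 1.
Proof.
move=> /andP[y0 y1]; apply/andP; split.
  by rewrite -F0 F_le -(K0 j) K_le.
by rewrite ltNge -F1 F_le -(K1 j) K_le -ltNge.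
Qed.

Let piece (j : nat) (x : circle R) : R :=
  \1_(`[j%:R / d%:R, j.+1%:R / d%:R[%classic : set R) (circle_sec x).

Let piece_branch i j x : (i < d)%N -> (j < d)%N ->
  piece i (circle_branch d j x) = (i == j)%:R.
Proof.
move=> id jd; rewrite /piece circle_branch_sec// indicE.
have /andP[s0 s1] := circle_sec_itv x.
have [->|ij] := eqVneq i j.
  by rewrite mem_set//= in_itv/= ler_pM2r ?invr_gt0// ltr_pM2r ?invr_gt0// -natr1; lra.
rewrite memNset//= in_itv/= ler_pM2r ?invr_gt0// ltr_pM2r ?invr_gt0//.
move: ij; rewrite neq_ltn => /orP[ij|ji] /andP[h1 h2].
  have : i.+1%:R <= j%:R :> R by rewrite ler_nat.
  lra.
have : j.+1%:R <= i%:R :> R by rewrite ler_nat.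
rewrite -natr1; lra.
Qed.

(** The indicators glue the branches into one visibly measurable function; at each point only the
    term of its own branch survives. *)
Let Q (x : circle R) : R :=
  \sum_(j < d) piece j x * F (K j (circle_sec (circle_mul d x))).

Let Q_branch j x : (j < d)%N -> Q (circle_branch d j x) = F (K j (circle_sec x)).
Proof.
move=> jd; rewrite /Q (bigD1 (Ordinal jd))//= piece_branch// eqxx mul1r.
rewrite circle_mul_branch// big1 ?addr0// => i ij.
by rewrite piece_branch// (negbTE (_ : (i != j :> nat)%N)) ?mul0r.
Qed.

Let mpiece j : measurable_fun [set: circle R] (piece j).
Proof.
apply: measurableT_comp; last exact: measurable_circle_sec.
exact: measurable_indic.
Qed.

Let mQ : measurable_fun [set: circle R] Q.
Proof.
apply: measurable_sum => j; apply: measurable_funM; first exact: mpiece.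
apply: (@measurableT_comp _ _ _ _ _ _ (F \o K j)).
  apply: (@measurable_realfun.nondecreasing_measurable _ setT) => // x y xy /=.
  by rewrite F_le K_le.
apply: measurableT_comp; first exact: measurable_circle_sec.
exact: measurable_circle_mul.
Qed.

Let Y (x : circle R) : circle R := circle_proj (Q x).

Let mY : measurable_fun [set: circle R] Y.
Proof. by apply: measurableT_comp => //; exact: measurable_circle_proj. Qed.

Let Ym : {mfun circle R >-> circle R} := HB.pack Y (isMeasurableFun.Build _ _ _ _ Y mY).

(** For [c = F b], the condition [Q <= c] on branch [j] reads [K j y <= b], that is
    [y <= b - t g_j(b)]. The mean over [j] of these measures is [b - t gm(b) = c]. *)
Let Y_uniform A : measurable A -> distribution lam Ym A = lam A.
Proof.
apply: circle_lebesgue_eq => c /andP[c0 c1].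
have [b bE] : exists b, F b = c := perturb_surj (scale_lip gml) (scale_bnd gmM) c.
have mS := measurable_circle_sec_le c.
transitivity (\int[lam]_x (\1_(Y @^-1` [set x | circle_sec x <= c]) x)%:E)%E.
  rewrite integral_indic// ?setIT//.
  by rewrite -[X in measurable X]setTI; exact: mY.
rewrite (ge0_integral_branch d_gt0)//; last first.
  apply/measurable_EFinP; apply: measurable_indic.
  by rewrite -[X in measurable X]setTI; exact: mY.
rewrite (eq_bigr (fun j : 'I_d => (b - t * g j b)%:E)); last first.
  move=> j _.
  have Hle := perturb_le tl (scale_lip (gl j)).
  have Hb : 0 <= b - t * g j b <= 1.
    have := Hle 0 b; have := Hle b 1.
    have := F_le 0 b; have := F_le b 1; rewrite F0 F1 bE c0 c1 => <- <-.
    by rewrite g0 g1 mulr0 !subr0 => -> ->.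
  transitivity (\int[lam]_x
      (\1_[set x : circle R | circle_sec x <= b - t * g j b] x)%:E)%E; last first.
    rewrite integral_indic//; last exact: (@measurable_circle_sec_le R).
    by rewrite setIT; exact: circle_lebesgue_le.
  apply: eq_integral => x _; rewrite !indicE.
  rewrite (_ : (circle_branch d j x \in _) =
    (x \in [set x : circle R | circle_sec x <= b - t * g j b]))//.
  apply/idP/idP; rewrite !inE /preimage /= /Y Q_branch//;
    rewrite circle_sec_proj ?FK_itv ?circle_sec_itv//;
    by rewrite -bE F_le -(Hle (K j _)) KE.
rewrite sumEFin -EFinM; congr (_%:E).
rewrite -bE /F /gm sumrB sumr_const card_ord -mulr_sumr.
by rewrite -[b *+ d]mulr_natl mulrBr mulKf ?gt_eqF// mulrCA.
Qed.

Let Wr (x : circle R) : R := circle_sec (circle_mul d x) + t * (d%:R * f x)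
  - Q x - t * transfer d f (Y x).

Let Wr_proj x : circle_proj (Wr x) =
  circle_mul d (circle_shift (fun x => t * f x) x) -
  circle_shift (fun x => t * transfer d f x) (Y x).
Proof.
rewrite /Wr /circle_shift /circle_mul !circle_projB circle_projD circle_secK.
by rewrite [t * (d%:R * _)]mulrCA mulr_natl mulrnDl circle_projMn opprD addrA.
Qed.

(** [Er] and [De] are the errors of replacing [d f] and its transfer by the Lipschitz data; the rest
    of [Wr] is of order [t^2]. *)
Let Er (x : circle R) : R := d%:R * f x -
  \sum_(j < d) piece j x * g j (circle_sec (circle_mul d x)).

Let De (x : circle R) : R := transfer d f x - gm (circle_sec x).

Let sum_piece (h : nat -> R) j x : (j < d)%N ->
  \sum_(i < d) piece i (circle_branch d j x) * h i = h j.
Proof.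
move=> jd; rewrite (bigD1 (Ordinal jd))//= piece_branch// eqxx mul1r.
rewrite big1 ?addr0// => i ij.
by rewrite piece_branch// (negbTE (_ : (i != j :> nat)%N)) ?mul0r.
Qed.

Let Er_branch j x : (j < d)%N ->
  Er (circle_branch d j x) = d%:R * f (circle_branch d j x) - g j (circle_sec x).
Proof.
by move=> jd; rewrite /Er circle_mul_branch// (sum_piece (fun i => g i _)).
Qed.

(** Both end points are close to [U]: since [s = U - t g_j(U)] and [F U = U - t gm(U)], the sums
    [s + t g_j(s)] and [F U + t gm(F U)] each miss [U] by at most [t^2 l M]. The square of three
    summands costs a factor 3, and [12 = 3 * 2^2]. *)
Let Wr_le x : Wr x ^+ 2 <= 12 * (t ^+ 2 * (l * M)) ^+ 2 +
  3 * t ^+ 2 * Er x ^+ 2 + 3 * t ^+ 2 * De (Y x) ^+ 2.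
Proof.
have [j jd ->] := circle_branch_surj x d_gt0; set y := circle_mul d x.
rewrite Er_branch// /Wr circle_mul_branch// Q_branch//.
have YE : circle_sec (Y (circle_branch d j y)) = F (K j (circle_sec y)).
  by rewrite /Y Q_branch// circle_sec_proj// FK_itv// circle_sec_itv.
rewrite /De YE; set tf := transfer d f _; set s := circle_sec y.
set fx := f _; set U := K j s; have sU : s = U - t * g j U by rewrite KE.
pose a := s + t * g j s - F U - t * gm (F U).
have aE : s + t * (d%:R * fx) - F U - t * tf =
  a + t * (d%:R * fx - g j s) - t * (tf - gm (F U)) by rewrite /a; ring.
have l0 : 0 <= l.
  have := le_trans (normr_ge0 _) (gl 0%N 1 0).
  by rewrite subr0 normr1 mulr1.
have M0 : 0 <= M := le_trans (normr_ge0 _) (gM 0%N 0).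
have a_le : `|a| <= 2 * (t ^+ 2 * (l * M)).
  have -> : a = t * (g j s - g j U) - t * (gm (F U) - gm U).
    by rewrite /a {1}sU {1}/F; ring.
  apply: le_trans (ler_normB _ _) _; rewrite !normrM.
  have h1 : `|g j s - g j U| <= l * (`|t| * M).
    apply: le_trans (gl _ _ _) _; rewrite ler_wpM2l//.
    by rewrite sU addrAC subrr sub0r normrN scale_bnd.
  have h2 : `|gm (F U) - gm U| <= l * (`|t| * M).
    apply: le_trans (gml _ _) _; rewrite ler_wpM2l//.
    by rewrite /F addrAC subrr sub0r normrN scale_bnd.
  rewrite -[t ^+ 2]real_normK ?num_real//.
  have := ler_wpM2l (normr_ge0 t) h1; have := ler_wpM2l (normr_ge0 t) h2.
  by rewrite expr2; lra.
have a2 : a ^+ 2 <= 4 * (t ^+ 2 * (l * M)) ^+ 2.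
  rewrite -real_normK ?num_real// (_ : 4 * _ = (2 * (t ^+ 2 * (l * M))) ^+ 2); last by ring.
  have tM0 : 0 <= 2 * (t ^+ 2 * (l * M)).
    by apply: mulr_ge0 => //; apply: mulr_ge0; [exact: sqr_ge0|exact: mulr_ge0].
  by rewrite lerXn2r ?nnegrE.
rewrite aE; set b := d%:R * fx - _; set c := tf - _.
have : (a + t * b - t * c) ^+ 2 <= 3 * a ^+ 2 + 3 * (t * b) ^+ 2 + 3 * (t * c) ^+ 2.
  have := sqr_ge0 (a - t * b); have := sqr_ge0 (a + t * c); have := sqr_ge0 (t * b + t * c).
  by rewrite !sqrrD !sqrrN; nra.
by rewrite !exprMn; lra.
Qed.

Let mg j : measurable_fun [set: R] (g j).
Proof. exact: (lipschitz_measurable (gl j)). Qed.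

Let mgm : measurable_fun [set: R] gm.
Proof. exact: (lipschitz_measurable gml). Qed.

Let G (j : nat) (x : circle R) : R :=
  d%:R * f (circle_branch d j x) - g j (circle_sec x).

Let G2 j : (j < d)%N -> G j \in Lfun lam 2%:E.
Proof.
move=> jd; apply: Lfun2B; first exact: (Lfun2Z _ (Lfun2_branch d_gt0 jd f2)).
apply: (@Lfun2_bounded _ _ _ _ _ M) => // x.
by apply: measurableT_comp => //; exact: measurable_circle_sec.
Qed.

Let sum_G_le : d%:R^-1 * \sum_(j < d) \int[lam]_x (G j x ^+ 2) <= e.
Proof.
rewrite mulrC ler_pdivrMr// mulr_natr -[in leRHS](card_ord d) -sumr_const.
by apply: ler_sum => j _; exact: (ltW (ge (ltn_ord j))).
Qed.

Let Er2 : Er \in Lfun lam 2%:E.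
Proof.
apply: Lfun2B; first exact: Lfun2Z.
apply: (@Lfun2_bounded _ _ _ _ _ M).
  apply: measurable_sum => j; apply: measurable_funM; first exact: mpiece.
  apply: measurableT_comp => //; apply: measurableT_comp.
    exact: measurable_circle_sec.
  exact: measurable_circle_mul.
move=> x; have [j jd ->] := circle_branch_surj x d_gt0.
by rewrite (sum_piece (fun i => g i _)).
Qed.

Let int_Er : \int[lam]_x (Er x ^+ 2) <= e.
Proof.
rewrite (Rintegral_branch d_gt0) ?(Lfun2_integrable_sqr Er2)//.
rewrite (eq_bigr (fun j : 'I_d => \int[lam]_x (G j x ^+ 2))) ?sum_G_le//.
by move=> j _; apply: eq_Rintegral => x _; rewrite Er_branch.
Qed.

Let De2 : De \in Lfun lam 2%:E.
Proof.
apply: Lfun2B; first exact: Lfun2_transfer.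
apply: (@Lfun2_bounded _ _ _ _ _ M) => //.
by apply: measurableT_comp => //; exact: measurable_circle_sec.
Qed.

(** [De] is the mean of the [G j], so its square is at most the mean of their squares. *)
Let int_De : \int[lam]_x (De x ^+ 2) <= e.
Proof.
apply: le_trans sum_G_le.
have Gi (j : 'I_d) := Lfun2_integrable_sqr (G2 (ltn_ord j)).
rewrite -Rintegral_sum_ord// -RintegralZl//; last first.
  rewrite [X in integrable _ _ X](_ : _ = (fun x => \sum_(j < d) (G j x ^+ 2)%:E)%E).
    by apply: integrable_sum => // j _; exact: Gi.
  by apply/funext => x /=; rewrite sumEFin.
apply: le_Rintegral => //.
- exact: Lfun2_integrable_sqr.
- rewrite [X in integrable _ _ X](_ : _ = (fun x => d%:R^-1%:E * \sum_(j < d)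
    (G j x ^+ 2)%:E)%E).
    apply: integrableZl => //.
    by apply: integrable_sum => // j _; exact: Gi.
  by apply/funext => x /=; rewrite sumEFin EFinM.
- move=> x _; have -> : De x = d%:R^-1 * \sum_(j < d) G j x.
    by rewrite /De /G sumrB -mulr_sumr mulrBr mulKf// gt_eqF.
  rewrite exprMn expr2 -mulrA ler_pM2l ?invr_gt0// mulrC ler_pdivrMr// mulrC.
  exact: sqr_sum_ord_le.
Qed.

(** Only exact uniformity of [Y] controls this term: [De] is small in [L^2], not pointwise. *)
Let int_DeY : (\int[lam]_x ((De (Y x)) ^+ 2)%:E = \int[lam]_x ((De x) ^+ 2)%:E)%E.
Proof.
have mDe := Lfun2_measurable De2.
transitivity (\int[distribution lam Ym]_x ((De x) ^+ 2)%:E)%E.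
  rewrite ge0_integral_distribution//.
    by apply/measurable_EFinP; exact: measurable_funX.
  by move=> x; rewrite lee_fin sqr_ge0.
by apply: eq_measure_integral => A mA _; exact: Y_uniform.
Qed.

Let DeY2 : (De \o Y) \in Lfun lam 2%:E.
Proof.
apply: Lfun2I; first by apply: measurableT_comp => //; exact: (Lfun2_measurable De2).
by rewrite int_DeY; have := Lfun2_sqr_fin De2; rewrite fin_numElt => /andP[].
Qed.

Let bound (x : circle R) : R := 12 * (t ^+ 2 * (l * M)) ^+ 2 +
  (3 * t ^+ 2 * Er x ^+ 2 + 3 * t ^+ 2 * De (Y x) ^+ 2).

Let c_int : lam.-integrable [set: circle R] (EFin \o (fun=> 12 * (t ^+ 2 * (l * M)) ^+ 2)).
Proof. exact: (Lfun2_integrable (Lfun_cst lam _ _)). Qed.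

Let Er_int : lam.-integrable [set: circle R] (EFin \o (fun x => 3 * t ^+ 2 * Er x ^+ 2)).
Proof. exact: (integrableZl measurableT (3 * t ^+ 2) (Lfun2_integrable_sqr Er2)). Qed.

Let De_int : lam.-integrable [set: circle R] (EFin \o (fun x => 3 * t ^+ 2 * De (Y x) ^+ 2)).
Proof. exact: (integrableZl measurableT (3 * t ^+ 2) (Lfun2_integrable_sqr DeY2)). Qed.

Let bound_int : lam.-integrable [set: circle R] (EFin \o bound).
Proof. exact: (integrableD measurableT c_int (integrableD measurableT Er_int De_int)). Qed.

Let mWr : measurable_fun [set: circle R] Wr.
Proof.
have mf := Lfun2_measurable f2.
apply: measurable_funB; first apply: measurable_funB => //.
- apply: measurable_funD; last by apply: measurable_funM => //; exact: measurable_funM.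
  by apply: measurableT_comp; [exact: measurable_circle_sec|exact: measurable_circle_mul].
- apply: measurable_funM => //; apply: measurableT_comp => //.
  exact: measurable_transfer.
Qed.

Let Wr2 : Wr \in Lfun lam 2%:E.
Proof.
apply: Lfun2I => //; apply: (@le_lt_trans _ _ (\int[lam]_x (bound x)%:E)%E).
  apply: ge0_le_integral => //.
  - by move=> x _; rewrite lee_fin sqr_ge0.
  - by apply/measurable_EFinP; exact: measurable_funX.
  - exact: measurable_int bound_int.
  - by move=> x _; rewrite lee_fin /bound addrA; exact: Wr_le.
have : (\int[lam]_x (bound x)%:E)%E \is a fin_num by exact: integrable_fin_num bound_int.
by rewrite fin_numElt => /andP[].
Qed.

(** As [Y] is uniform, the second law is also that of the displaced [Y], which puts both end points
    on one probability space. [Er] and [De] each contribute [3 t^2 e]. *)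
Lemma gateaux_estimate (mu nu : probability (circle R) R) :
  (forall S, measurable S ->
    mu S = lam ((fun x => circle_mul d (circle_shift (fun x => t * f x) x)) @^-1` S)) ->
  (forall S, measurable S ->
    nu S = lam (circle_shift (fun x => t * transfer d f x) @^-1` S)) ->
  wasserstein mu nu ^+ 2 <= 12 * (t ^+ 2 * (l * M)) ^+ 2 + 6 * t ^+ 2 * e.
Proof.
move=> muE nuE; have mf := Lfun2_measurable f2.
have mA : measurable_fun [set: circle R]
    (fun x => circle_mul d (circle_shift (fun x => t * f x) x)).
  apply: measurableT_comp; first exact: measurable_circle_mul.
  by apply: measurable_circle_shift; exact: measurable_funM.
have ms : measurable_fun [set: circle R] (circle_shift (fun x => t * transfer d f x)).
  by apply: measurable_circle_shift; apply: measurable_funM => //; exact: measurable_transfer.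
have mB : measurable_fun [set: circle R]
    (fun x => circle_shift (fun x => t * transfer d f x) (Y x)).
  exact: measurableT_comp.
pose A : {mfun circle R >-> circle R} := mfun_pack mA.
pose B : {mfun circle R >-> circle R} := mfun_pack mB.
rewrite (@wasserstein_ext _ _ (distribution lam A) _ (distribution lam B)).
- apply: le_trans (@wasserstein_sqr_le R _ _ lam A B Wr Wr2 Wr_proj) _.
  apply: (@le_trans _ _ (\int[lam]_x bound x)).
    apply: le_Rintegral => //; first exact: Lfun2_integrable_sqr.
    by move=> x _; rewrite /bound addrA; exact: Wr_le.
  rewrite RintegralD//; last exact: (integrableD measurableT Er_int De_int).
  have lam1 : fine (lam [set: circle R]) = 1 by rewrite probability_setT.
  rewrite RintegralD// Rintegral_cst// lam1 mulr1 lerD2l.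
  rewrite !RintegralZl//; try exact: Lfun2_integrable_sqr.
  have -> : \int[lam]_x (De (Y x) ^+ 2) = \int[lam]_x (De x ^+ 2) by rewrite /Rintegral int_DeY.
  have t2 : 0 <= 3 * t ^+ 2 by rewrite mulr_ge0// sqr_ge0.
  have := ler_wpM2l t2 int_Er; have := ler_wpM2l t2 int_De; lra.
- by move=> S mS; rewrite muE.
- move=> S mS; rewrite nuE// -Y_uniform//.
  by rewrite -[X in measurable X]setTI; exact: ms.
Qed.

End gateaux.

(** * The transfer operator is a Gateaux derivative *)

Lemma ae_preimage_eq d d' (T : measurableType d) (T' : measurableType d')
    (R : realType) (P : probability T R) (h k : T -> T') (S : set T') :
  measurable_fun [set: T] h -> measurable_fun [set: T] k ->
  {ae P, forall x, h x = k x} -> measurable S -> P (h @^-1` S) = P (k @^-1` S).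
Proof.
move=> mh mk hk mS.
have mhS : measurable (h @^-1` S) by rewrite -[X in measurable X]setTI; exact: mh.
have mkS : measurable (k @^-1` S) by rewrite -[X in measurable X]setTI; exact: mk.
have PE (A : set T) : measurable A -> P A = (\int[P]_x (\1_A x)%:E)%E.
  by move=> mA; rewrite integral_indic// setIT.
rewrite !PE//; apply: ge0_ae_eq_integral => //; try by move=> x _; rewrite lee_fin.
- by apply/measurable_EFinP; exact: measurable_indic.
- by apply/measurable_EFinP; exact: measurable_indic.
- apply: filterS hk => x hkx _; rewrite !indicE.
  rewrite (_ : (x \in h @^-1` S) = (x \in k @^-1` S))//.
  by apply/idP/idP; rewrite !inE /preimage /= hkx.
Qed.

Section L2_repr.
Context d (T : measurableType d) (R : realType) (P : probability T R).

Lemma L2_reprD (u v : L2 P) :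
  {ae P, forall x, L2_repr (u + v) x = L2_repr u x + L2_repr v x}.
Proof.
by apply/(L2_classE _ (L2_repr u + L2_repr v)); rewrite L2_classD !L2_reprK.
Qed.

Lemma L2_reprZ a (v : L2 P) :
  {ae P, forall x, L2_repr (a *: v) x = a * L2_repr v x}.
Proof. by apply/(L2_classE _ (a *: L2_repr v)); rewrite L2_classZ !L2_reprK. Qed.

Lemma L2_repr_Lfun (v : L2 P) : (L2_repr v : T -> R) \in Lfun P 2%:E.
Proof. exact: LfunP. Qed.

Lemma L2_norm_repr (v : L2 P) : `|v| ^+ 2 = \int[P]_x (L2_repr v x ^+ 2).
Proof. by rewrite -Lfun2_norm2 L2_reprK. Qed.

Lemma L20_mean (v : L20 P) : \int[P]_x L2_repr (L20_val v) x = 0.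
Proof. by case: v => v /= /eqP. Qed.

Definition L20_fun (v : L20 P) : T -> R := L2_repr (L20_val v).

Lemma L20_fun_Lfun v : L20_fun v \in Lfun P 2%:E.
Proof. exact: L2_repr_Lfun. Qed.

Lemma L20_fun_eq (u v : L20 P) : {ae P, forall x, L20_fun u x = L20_fun v x} -> u = v.
Proof.
by move=> /L2_classE; rewrite !L2_reprK => uv; exact: val_inj.
Qed.

Definition L2_of (f : T -> R) (f2 : f \in Lfun P 2%:E) : L2 P :=
  L2_class (Lfun_Sub (lee1n 2) f2).

Lemma L2_ofK (f : T -> R) (f2 : f \in Lfun P 2%:E) :
  {ae P, forall x, L2_repr (L2_of f2) x = f x}.
Proof. exact: L2_classK. Qed.

Lemma L2_of_mean0 (f : T -> R) (f2 : f \in Lfun P 2%:E) :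
  \int[P]_x f x = 0 -> L2_of f2 \in @mean0 _ _ _ P.
Proof. by move=> f0; rewrite mean0_class f0. Qed.

Definition L20_of (f : T -> R) (f2 : f \in Lfun P 2%:E)
  (f0 : \int[P]_x f x = 0) : L20 P := MkL20 (L2_of_mean0 f2 f0).

Lemma L20_ofK (f : T -> R) (f2 : f \in Lfun P 2%:E) (f0 : \int[P]_x f x = 0) :
  {ae P, forall x, L20_fun (L20_of f2 f0) x = f x}.
Proof. exact: L2_ofK. Qed.

Lemma L20_funD (u v : L20 P) :
  {ae P, forall x, L20_fun (u + v) x = L20_fun u x + L20_fun v x}.
Proof. exact: L2_reprD. Qed.

Lemma L20_funZ a (v : L20 P) :
  {ae P, forall x, L20_fun (a *: v) x = a * L20_fun v x}.
Proof. exact: L2_reprZ. Qed.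

End L2_repr.

(** The chosen representative of [t *: v] is only almost everywhere [t] times that of [v], which
    does not affect the law. *)
Lemma displace_scaleE (R : realType) (v : L20 (circle_lebesgue R)) t (S : set (circle R)) :
  measurable S ->
  displace (L20_val (t *: v)) S =
  circle_lebesgue R (circle_shift (fun x => t * L20_fun v x) @^-1` S).
Proof.
move=> mS; have mv := Lfun2_measurable (L20_fun_Lfun v).
rewrite -[LHS]/(circle_lebesgue R (circle_shift (L2_repr (L20_val (t *: v))) @^-1` S)).
apply: ae_preimage_eq => //.
  by apply: measurable_circle_shift; exact: measurable_funM.
apply: filterS (L20_funZ t v) => x hx.
have {}hx : L2_repr (L20_val (t *: v)) x = t * L20_fun v x := hx.
by rewrite /circle_shift hx.
Qed.

Section transfer_L20.
Variables (R : realType) (d : nat).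
Hypothesis d_gt0 : (0 < d)%N.
Local Notation lam := (circle_lebesgue R).

(** By [ge0_integral_branch] the preimage of a null set under a branch is null; hence [transfer]
    respects almost everywhere equality. *)
Lemma ae_branch (Q : circle R -> Prop) j : (j < d)%N ->
  {ae lam, forall x, Q x} -> {ae lam, forall x, Q (circle_branch d j x)}.
Proof.
move=> jd [N [mN N0 QN]].
have mNj : measurable (@circle_branch R d j @^-1` N).
  by rewrite -[X in measurable X]setTI; exact: measurable_circle_branch.
exists (@circle_branch R d j @^-1` N); split => //; last by move=> x /= /QN.
have : (\int[lam]_x (\1_N x)%:E = 0)%E by rewrite integral_indic// setIT.
rewrite (ge0_integral_branch d_gt0)//; last first.
  by apply/measurable_EFinP; exact: measurable_indic.
move=> /eqP; rewrite mule_eq0 eqe invr_eq0 pnatr_eq0 -[X in X || _]negbK -lt0n d_gt0 /=.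
rewrite (bigD1 (Ordinal jd))//= padde_eq0 ?sume_ge0//; last 2 first.
  exact: integral_ge0.
  by move=> i _; exact: integral_ge0.
move=> /andP[/eqP h _].
have e : (\int[lam]_x (\1_(@circle_branch R d j @^-1` N) x)%:E =
    lam (@circle_branch R d j @^-1` N))%E by rewrite integral_indic// setIT.
exact: (etrans (esym e) h).
Qed.

Lemma ae_transfer (f g : circle R -> R) : {ae lam, forall x, f x = g x} ->
  {ae lam, forall x, transfer d f x = transfer d g x}.
Proof.
move=> fg; have : forall j : 'I_d, {ae lam, forall x,
    f (circle_branch d j x) = g (circle_branch d j x)}.
  by move=> j; exact: (ae_branch (ltn_ord j) fg).
move=> /filter_forall; apply: filterS => x hx.
by apply: eq_bigr => j _; exact: hx.
Qed.

Lemma transfer_mean0 (v : L20 lam) : \int[lam]_x transfer d (L20_fun v) x = 0.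
Proof. by rewrite Rintegral_transfer ?L20_fun_Lfun// L20_mean mulr0. Qed.

Definition transfer_L20 (v : L20 lam) : L20 lam :=
  L20_of (Lfun2_transfer d_gt0 (L20_fun_Lfun v)) (transfer_mean0 v).

Lemma transfer_L20_linear : linear transfer_L20.
Proof.
move=> a u v; apply: L20_fun_eq.
have h1 := L20_ofK (Lfun2_transfer d_gt0 (L20_fun_Lfun (a *: u + v))) (transfer_mean0 _).
have h2 := L20_ofK (Lfun2_transfer d_gt0 (L20_fun_Lfun u)) (transfer_mean0 _).
have h3 := L20_ofK (Lfun2_transfer d_gt0 (L20_fun_Lfun v)) (transfer_mean0 _).
have h4 := L20_funD (a *: transfer_L20 u) (transfer_L20 v).
have h5 := L20_funZ a (transfer_L20 u).
have h6 : {ae lam, forall x, L20_fun (a *: u + v) x = a * L20_fun u x + L20_fun v x}.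
  by apply: filterS2 (L20_funD (a *: u) v) (L20_funZ a u) => x -> ->.
have h7 := ae_transfer h6.
near=> x.
rewrite (near h1 x)// (near h7 x)// (near h4 x)// (near h5 x)// (near h2 x)// (near h3 x)//.
by rewrite /transfer big_split mulr_sumr.
Unshelve. all: by end_near. Qed.

Lemma transfer_L20_norm (v : L20 lam) : `|transfer_L20 v| <= d%:R * `|v|.
Proof.
rewrite -(@ler_pXn2r _ 2)// ?nnegrE ?mulr_ge0//.
rewrite exprMn -[`|v| ^+ 2]/(`|L20_val v| ^+ 2) L2_norm_repr.
rewrite -[`|transfer_L20 v|]/(`|L2_class _|) Lfun2_norm2.
exact: (le_sqr_transfer d_gt0 (L20_fun_Lfun v)).
Qed.

Lemma transfer_L20_continuous : continuous transfer_L20.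
Proof.
pose L : {linear L20 lam -> L20 lam} :=
  HB.pack transfer_L20 (GRing.isLinear.Build _ _ _ _ transfer_L20 transfer_L20_linear).
apply: (linear_bounded_continuous L).1; apply/linear_boundedP.
near=> r => v; apply: le_trans (transfer_L20_norm v) _.
by rewrite ler_wpM2r//; near: r; exact: nbhs_pinfty_ge.
Unshelve. all: by end_near. Qed.

Lemma wasserstein_transfer (v : L20 lam) (e : R) : 0 < e ->
  exists2 C : R, 0 <= C & forall t, `|t| * C < 1 ->
  wasserstein (Phi_push d (displace (L20_val (t *: v))))
    (displace (L20_val (t *: transfer_L20 v))) ^+ 2 <=
  12 * (t ^+ 2 * C) ^+ 2 + 6 * t ^+ 2 * e.
Proof.
move=> e0; have f2 := L20_fun_Lfun v; set f := L20_fun v in f2.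
have /choice[p pE] : forall j : nat, exists p : (R -> R) * R * R,
  [/\ forall x, `|p.1.1 x| <= p.1.2, forall x y, `|p.1.1 x - p.1.1 y| <= p.2 * `|x - y|,
   p.1.1 0 = 0, p.1.1 1 = 0 & (j < d)%N ->
   \int[lam]_x ((d%:R * f (circle_branch d j x) - p.1.1 (circle_sec x)) ^+ 2) < e].
  move=> j; have [jd|dj] := ltnP j d.
    have [g [M [l [h1 h2 h3 h4 h5]]]] :=
      lipschitz_dense (Lfun2Z d%:R (Lfun2_branch d_gt0 jd f2)) e0.
    by exists (g, M, l).
  exists (fun=> 0, 0, 0); split => //= [x|x y]; first by rewrite normr0.
  by rewrite subrr normr0 mul0r.
have M0 j : 0 <= (p j).1.2.
  by have [h _ _ _ _] := pE j; exact: le_trans (normr_ge0 _) (h 0).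
have l0 j : 0 <= (p j).2.
  have [_ h _ _ _] := pE j; have := le_trans (normr_ge0 _) (h 1 0).
  by rewrite subr0 normr1 mulr1.
pose M := \sum_(j < d) (p j).1.2; pose l := \sum_(j < d) (p j).2.
have M0' : 0 <= M by exact: sumr_ge0.
have l0' : 0 <= l by exact: sumr_ge0.
(* The estimate asks for bounds uniform in all natural [j], hence the sums [M] and [l] and the value
   0 from [d] on. *)
pose g j x := if (j < d)%N then (p j).1.1 x else 0.
have leM j : (j < d)%N -> (p j).1.2 <= M.
  by move=> jd; rewrite /M (bigD1 (Ordinal jd))//= lerDl sumr_ge0.
have lel j : (j < d)%N -> (p j).2 <= l.
  by move=> jd; rewrite /l (bigD1 (Ordinal jd))//= lerDl sumr_ge0.
(* One constant serves twice: it dominates [l], so that the perturbations are invertible, and [l M],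
   which governs the error. *)
exists (l + l * M); first by rewrite addr_ge0// mulr_ge0.
move=> t tC.
have tl : `|t| * l < 1.
  by apply: le_lt_trans tC; rewrite ler_wpM2l// lerDl mulr_ge0.
apply: (@le_trans _ _ (12 * (t ^+ 2 * (l * M)) ^+ 2 + 6 * t ^+ 2 * e)); last first.
  have tA : t ^+ 2 * (l * M) <= t ^+ 2 * (l + l * M).
    by rewrite ler_wpM2l ?sqr_ge0// lerDr.
  have tB : 0 <= t ^+ 2 * (l * M) by rewrite mulr_ge0 ?sqr_ge0 ?mulr_ge0.
  rewrite lerD2r ler_wpM2l//; apply: lerXn2r => //.
  by rewrite nnegrE (le_trans tB tA).
have mf := Lfun2_measurable f2.
have est := @gateaux_estimate R d f g l M t e d_gt0 f2.
apply: est.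
- move=> j x; rewrite /g; case: ifPn => jd; last by rewrite normr0.
  by have [h _ _ _ _] := pE j; exact: le_trans (h x) (leM _ jd).
- move=> j x y; rewrite /g; case: ifPn => jd; last by rewrite subrr normr0 mulr_ge0.
  have [_ h _ _ _] := pE j; apply: le_trans (h x y) _.
  by rewrite ler_wpM2r// lel.
- by move=> j; rewrite /g; case: ifPn => // jd; have [_ _ h _ _] := pE j.
- by move=> j; rewrite /g; case: ifPn => // jd; have [_ _ _ h _] := pE j.
- by move=> j jd; rewrite /g jd; have [_ _ _ _ h] := pE j; exact: h.
- exact: tl.
- move=> S mS; rewrite -[LHS]/(displace (L20_val (t *: v)) (circle_mul d @^-1` S)).
  rewrite displace_scaleE//.
  by rewrite -[X in measurable X]setTI; exact: measurable_circle_mul.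
- move=> S mS; have mLv := Lfun2_measurable (L20_fun_Lfun (transfer_L20 v)).
  rewrite displace_scaleE//; apply: ae_preimage_eq => //.
  + by apply: measurable_circle_shift; exact: measurable_funM.
  + by apply: measurable_circle_shift; apply: measurable_funM => //; exact: measurable_transfer.
  + apply: filterS (L20_ofK (Lfun2_transfer d_gt0 (L20_fun_Lfun v)) (transfer_mean0 v)) => x hx.
    by rewrite /circle_shift [L20_fun _ x]hx.
Qed.

Lemma transfer_L20_gateaux : is_gateaux_derivative (Phi_push d) transfer_L20.
Proof.
split; [exact: transfer_L20_linear|exact: transfer_L20_continuous|move=> v].
apply/cvgrPdist_lt => e e0.
(* This makes [6 t^2 (e^2 / 12)] half of [(t e)^2]; the other term will be below [12 t^2 (e / 5)^2],
   less than the other half. *)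
have e2 : 0 < e ^+ 2 / 12 by rewrite divr_gt0// exprn_gt0.
have [C C0 WC] := wasserstein_transfer v e2.
have d1 : 0 < (C + 1)^-1 by rewrite invr_gt0 ltr_wpDl.
have d2 : 0 < e / 5 / (C + 1) by rewrite !divr_gt0// ltr_wpDl.
near=> t.
have t0 : t != 0 by near: t; exact: nbhs_dnbhs_neq.
have t1 : `|t| < (C + 1)^-1 by near: t; exact: dnbhs0_lt.
have t2 : `|t| < e / 5 / (C + 1) by near: t; exact: dnbhs0_lt.
have C1 : 0 < C + 1 by rewrite ltr_wpDl.
have tC : `|t| * C < 1.
  move: t1; rewrite -div1r ltr_pdivlMr// mulrDr mulr1 => t1.
  by apply: le_lt_trans t1; rewrite lerDl.
have {}t2 : (`|t| * C) ^+ 2 < (e / 5) ^+ 2.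
  rewrite ltrXn2r ?nnegrE ?mulr_ge0 ?divr_ge0// ?(ltW e0)//.
  move: t2; rewrite ltr_pdivlMr// mulrDr mulr1 => t2.
  by apply: le_lt_trans t2; rewrite lerDl.
rewrite sub0r normrN normrM normfV ltr_pdivrMr ?normr_gt0//.
rewrite -(@ltr_pXn2r _ 2) ?nnegrE ?mulr_ge0// ?(ltW e0)//.
rewrite real_normK ?num_real//; apply: le_lt_trans (WC t tC) _.
have tt : t ^+ 2 = `|t| ^+ 2 by rewrite real_normK ?num_real.
have tt0 : 0 < `|t| ^+ 2 by rewrite exprn_gt0// normr_gt0.
rewrite tt !exprMn.
rewrite (_ : 12 * _ + _ = `|t| ^+ 2 * (12 * (`|t| * C) ^+ 2 + e ^+ 2 / 2)); last first.
  by field.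
rewrite mulrC ltr_pM2r//; move: t2; rewrite expr_div_n.
by have := exprn_gt0 2 e0; lra.
Unshelve. all: by end_near. Qed.

End transfer_L20.

(** * Fourier coefficients of a Gateaux derivative *)

Section trigonometry.
Variable R : realType.
Implicit Types a b h : R.

Lemma sin_sub_le a b : `|sin a - sin b| <= `|a - b|.
Proof.
wlog ab : a b / a <= b.
  by move=> wl; have [/wl//|/ltW/wl] := leP a b; rewrite distrC (distrC a).
have [c _ sE] := @MVT_segment R sin cos a b ab (fun x _ => is_derive_sin x)
  (continuous_subspaceT (@continuous_sin R)).
rewrite distrC sE normrM (distrC a) -[leRHS]mul1r ler_wpM2r//.
exact: cos_max.
Qed.

Lemma cos_sub_le a b : `|cos a - cos b| <= `|a - b|.
Proof.
rewrite -!sinDpihalf; apply: le_trans (sin_sub_le _ _) _.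
by rewrite opprD addrACA subrr addr0.
Qed.

(** The mean value theorem for the cosine, then the Lipschitz bound for the sine at the intermediate
    point. *)
Lemma cos_expand a h : `|cos (a + h) - cos a + h * sin a| <= h ^+ 2.
Proof.
have mvt x y (xy : x <= y) := @MVT_segment R cos (fun x => - sin x) x y xy
  (fun x _ => is_derive_cos x) (continuous_subspaceT (@continuous_cos R)).
suff [c ca ->] : exists2 c, `|a - c| <= `|h| & cos (a + h) - cos a = - sin c * h.
  rewrite (_ : _ + _ = h * (sin a - sin c)); last by ring.
  rewrite normrM -[h ^+ 2]real_normK ?num_real// expr2 ler_wpM2l//.
  exact: le_trans (sin_sub_le _ _) ca.
have [h0|h0] := leP 0 h.
  have [|c] := mvt a (a + h); first by rewrite lerDl.
  rewrite in_itv/= => /andP[ac ca] E; exists c.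
    by rewrite distrC !ger0_norm ?subr_ge0// lerBlDl.
  by rewrite E addrAC subrr add0r.
have [|c] := mvt (a + h) a; first by rewrite gerDl ltW.
rewrite in_itv/= => /andP[ac ca] E; exists c.
  by rewrite ger0_norm ?subr_ge0// ltr0_norm//; lra.
by rewrite -opprB E; ring.
Qed.

Lemma cosD2piz (a : R) (n : int) : cos (a + 2 * pi * n%:~R) = cos a.
Proof.
have cn (m : nat) b : cos (b + 2 * pi * m%:R) = cos b.
  rewrite -(periodicn (@cosD2pi R) m b); congr (cos (b + _)).
  by rewrite -[in RHS](mulr_natl pi 2) -[RHS]mulr_natr.
case: n => m; first exact: cn.
by rewrite -(cn m.+1) NegzE mulrNz mulrN subrK.
Qed.

End trigonometry.

Section wave.
Variable R : realType.
Local Notation lam := (circle_lebesgue R).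

(* [th = 0] and [th = pi / 2] give [cos (2 pi k x)] and [- sin (2 pi k x)]. *)
Definition wave (k : nat) (th : R) (x : circle R) : R :=
  cos (2 * pi * k%:R * circle_sec x + th).

Lemma wave_proj k th (r : R) : wave k th (circle_proj r) = cos (2 * pi * k%:R * r + th).
Proof.
rewrite /wave circle_projKE.
rewrite -[RHS](cosD2piz _ (- (k%:Z * Num.floor r))); congr cos.
by rewrite intrN intrM; ring.
Qed.

Lemma wave_shift k th (v : circle R -> R) x :
  wave k th (circle_shift v x) = cos (2 * pi * k%:R * circle_sec x + th + 2 * pi * k%:R * v x).
Proof.
rewrite /circle_shift -{1}(circle_secK x) -circle_projD wave_proj; congr cos; ring.
Qed.

Lemma wave_mul d k th x : wave k th (circle_mul d x) = wave (k * d) th x.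
Proof.
rewrite -{1}(circle_secK x) /circle_mul -circle_projMn wave_proj /wave.
by congr cos; rewrite natrM -[circle_sec x *+ d]mulr_natl; ring.
Qed.

Lemma measurable_wave k th : measurable_fun [set: circle R] (wave k th).
Proof.
apply: (@measurableT_comp _ _ _ _ _ _ (fun r : R => cos (2 * pi * k%:R * r + th))); last first.
  exact: measurable_circle_sec.
apply: (lipschitz_measurable (l := 2 * pi * k%:R)) => x y.
apply: le_trans (cos_sub_le _ _) _.
rewrite opprD addrACA subrr addr0 -mulrBr normrM ger0_norm//.
by rewrite !mulr_ge0// pi_ge0.
Qed.

Lemma wave_le1 k th x : `|wave k th x| <= 1.
Proof. exact: cos_max. Qed.

Lemma wave_Lfun k th : wave k th \in Lfun lam 2%:E.
Proof.
by apply: (@Lfun2_bounded _ _ _ _ _ 1); [exact: measurable_wave|exact: wave_le1].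
Qed.

Lemma wave_lipschitz k th x y :
  `|wave k th x - wave k th y| <= (2 * pi * k%:R + 1) * circle_dist x y.
Proof.
(* The summand 1 keeps the constant positive for [k = 0], so that one can divide by it. *)
have k0 : 0 < 2 * pi * k%:R + 1 :> R by rewrite ltr_wpDl// !mulr_ge0// pi_ge0.
rewrite mulrC -ler_pdivrMr//; apply: circle_dist_ge => r rE.
rewrite ler_pdivrMr// mulrC.
have -> : x = circle_proj (circle_sec y + r).
  by rewrite circle_projD rE circle_secK addrC subrK.
rewrite wave_proj /wave; apply: le_trans (cos_sub_le _ _) _.
rewrite (_ : _ - _ = 2 * pi * k%:R * r); last by ring.
rewrite normrM ger0_norm ?mulr_ge0 ?pi_ge0// ler_wpM2r// lerDl//.
Qed.

End wave.

Section gateaux_wave.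
Variable R : realType.
Local Notation lam := (circle_lebesgue R).

Lemma wave_DpihalfE k th (x : circle R) :
  wave k (th + pi / 2) x = - sin (2 * pi * k%:R * circle_sec x + th).
Proof. by rewrite /wave addrA cosDpihalf. Qed.

(** First-order expansion of a test integral at Lebesgue measure in the direction [v]:
    differentiating a wave multiplies it by [2 pi k] and advances the phase by [pi / 2]. *)
Lemma Rintegral_wave_shift k th (v : circle R -> R) t : v \in Lfun lam 2%:E ->
  `|\int[lam]_x wave k th (circle_shift (fun x => t * v x) x) -
    \int[lam]_x wave k th x -
    t * (2 * pi * k%:R) * \int[lam]_x (wave k (th + pi / 2) x * v x)| <=
  (2 * pi * k%:R) ^+ 2 * t ^+ 2 * \int[lam]_x (v x ^+ 2).
Proof.
move=> v2; set c := 2 * pi * k%:R; have mv := Lfun2_measurable v2.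
have ms : measurable_fun [set: circle R] (circle_shift (fun x => t * v x)).
  by apply: measurable_circle_shift; exact: measurable_funM.
have i1 : lam.-integrable setT
    (EFin \o (fun x => wave k th (circle_shift (fun x => t * v x) x))).
  apply: Lfun2_integrable; apply: (@Lfun2_bounded _ _ _ _ _ 1) => [|x].
    exact: (measurableT_comp (measurable_wave k th) ms).
  exact: wave_le1.
have i2 : lam.-integrable setT (EFin \o wave k th).
  by apply: Lfun2_integrable; exact: wave_Lfun.
have i3 : lam.-integrable setT (EFin \o (fun x => wave k (th + pi / 2) x * v x)).
  by apply: Lfun2_mul => //; exact: wave_Lfun.
have i3' : lam.-integrable setT
    (EFin \o (fun x => t * c * (wave k (th + pi / 2) x * v x))).
  exact: (integrableZl measurableT (t * c) i3).
have i12 := integrableB measurableT i1 i2.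
have i4 := integrableZl measurableT (c ^+ 2 * t ^+ 2) (Lfun2_integrable_sqr v2).
rewrite -RintegralB// -RintegralZl// -RintegralB//.
apply: le_trans (le_normr_Rintegral _ _) _ => //.
  exact: (integrableB measurableT i12 i3').
rewrite -RintegralZl//; last exact: Lfun2_integrable_sqr.
apply: le_Rintegral => //.
  rewrite (_ : _ \o _ = abse \o (EFin \o (fun x =>
    wave k th (circle_shift (fun x => t * v x) x) - wave k th x -
    t * c * (wave k (th + pi / 2) x * v x))))//.
  by apply: integrable_abse; exact: (integrableB measurableT i12 i3').
move=> x _; rewrite wave_DpihalfE wave_shift -/c /wave -/c.
have := cos_expand (c * circle_sec x + th) (c * (t * v x)).
set C := cos (_ + _ + _); set C' := cos _; set S := sin _.
rewrite (_ : c * (t * v x) * S = - (t * c * (- S * v x))); last by ring.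
by rewrite (_ : (c * (t * v x)) ^+ 2 = c ^+ 2 * t ^+ 2 * v x ^+ 2)//; ring.
Qed.

(** The adjoint formula applied to the constant 1, whose transfer is [d]. *)
Lemma Rintegral_circle_mul d (g : circle R -> R) : (0 < d)%N -> g \in Lfun lam 2%:E ->
  \int[lam]_x g (circle_mul d x) = \int[lam]_x g x.
Proof.
move=> d0 g2; have d0' : d%:R != 0 :> R by rewrite pnatr_eq0 -lt0n.
have := Rintegral_transfer_mul d0 (Lfun_cst lam 1 2) g2.
rewrite (@eq_Rintegral _ _ _ _ _ (fun x => d%:R * g x)); last first.
  by move=> x _; rewrite /transfer sumr_const card_ord.
rewrite RintegralZl//; last exact: Lfun2_integrable.
move=> /(mulfI d0') ->.
by apply: eq_Rintegral => x _; rewrite mul1r.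
Qed.

(* Testing [Phi_d(lam + t v)] and [lam + t L v] against a wave and comparing the terms of
   order [t]; this determines the Gateaux derivative without the triangle inequality
   for the Wasserstein distance. *)
Lemma gateaux_wave d (L : L20 lam -> L20 lam) (v : L20 lam) k th :
  (0 < d)%N -> (0 < k)%N -> is_gateaux_derivative (@Phi_push R d) L ->
  \int[lam]_x (wave k th x * L20_fun (L v) x) =
  d%:R * \int[lam]_x (wave (k * d) th x * L20_fun v x).
Proof.
move=> d0 k0 [_ _ /(_ v) Lv]; set f := L20_fun v.
set g := L20_fun (L v); set I2 := \int[lam]_x (wave k th x * g x).
set I1 := \int[lam]_x (wave (k * d) th x * f x).
apply/eqP; rewrite eq_sym -subr_eq0; apply/negPn/negP => s0.
pose c : R := 2 * pi * k%:R; pose K := c + 1.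
have c0 : 0 < c by rewrite !mulr_gt0 ?pi_gt0 ?ltr0n.
have K0 : 0 < K by rewrite ltr_wpDl ?ltW.
pose C1 := (c * d%:R) ^+ 2 * \int[lam]_x (f x ^+ 2).
pose C2 := c ^+ 2 * \int[lam]_x (g x ^+ 2).
have C10 : 0 <= C1 by rewrite mulr_ge0 ?sqr_ge0// Rintegral_ge0// => x _; exact: sqr_ge0.
have C20 : 0 <= C2 by rewrite mulr_ge0 ?sqr_ge0// Rintegral_ge0// => x _; exact: sqr_ge0.
pose W t := wasserstein (Phi_push d (displace (L20_val (t *: v))))
    (displace (L20_val (t *: L v))).
have key t : `|t * c * (d%:R * I1 - I2)| <= K * W t + t ^+ 2 * (C1 + C2).
  have f2 : f \in Lfun lam 2%:E := L20_fun_Lfun v.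
  have g2 : g \in Lfun lam 2%:E := L20_fun_Lfun (L v).
  have msf : measurable_fun [set: circle R] (circle_shift (fun x => t * f x)).
    by apply: measurable_circle_shift; apply: measurable_funM => //; exact: Lfun2_measurable f2.
  have mA : measurable_fun [set: circle R]
      (fun x => circle_mul d (circle_shift (fun x => t * f x) x)).
    by apply: measurableT_comp msf; exact: measurable_circle_mul.
  have mB : measurable_fun [set: circle R] (circle_shift (fun x => t * g x)).
    by apply: measurable_circle_shift; apply: measurable_funM => //; exact: Lfun2_measurable g2.
  have WE : W t = wasserstein (distribution lam (mfun_pack mA)) (distribution lam (mfun_pack mB)).
    apply: wasserstein_ext => S mS; last exact: displace_scaleE.
    rewrite -[LHS]/(displace (L20_val (t *: v)) (circle_mul d @^-1` S)).
    rewrite displace_scaleE//.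
    by rewrite -[X in measurable X]setTI; exact: measurable_circle_mul.
  (* The test wave has phase [th'] so that its derivative has the phase [th] of the claim. *)
  pose th' := th - pi / 2; have thE : th' + pi / 2 = th by rewrite subrK.
  have := @wasserstein_dual R _ _ lam (mfun_pack mA) (mfun_pack mB)
    (wave k th') K K0 (measurable_wave k th') (wave_le1 k th') (wave_lipschitz k th').
  rewrite -WE /=; set a := \int[lam]_x _; set b := \int[lam]_x _ => abW.
  have := Rintegral_wave_shift (k * d) th' t f2.
  have := Rintegral_wave_shift k th' t g2.
  rewrite thE -/I1 -/I2 -/b.
  have -> : \int[lam]_x wave (k * d) th' (circle_shift (fun x => t * f x) x) = a.
    by apply: eq_Rintegral => x _; rewrite wave_mul.
  (* The terms of order 0 agree because multiplication by [d] preserves Lebesgue measure. *)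
  have -> : \int[lam]_x wave (k * d) th' x = \int[lam]_x wave k th' x.
    rewrite -(Rintegral_circle_mul d0 (wave_Lfun k th')).
    by apply: eq_Rintegral => x _; rewrite wave_mul.
  set m := \int[lam]_x wave k th' x.
  rewrite -/c (_ : 2 * pi * (k * d)%:R = c * d%:R); last by rewrite natrM mulrA.
  rewrite [c ^+ 2 * _ * _]mulrAC -/C2 [(c * _) ^+ 2 * _ * _]mulrAC -/C1 => h2 h1.
  rewrite (_ : t * c * (d%:R * I1 - I2) = (a - b) -
    (a - m - t * (c * d%:R) * I1) + (b - m - t * c * I2)); last by ring.
  apply: le_trans (ler_normD _ _) _; apply: le_trans (lerD (ler_normB _ _) (lexx _)) _.
  by rewrite mulrDr; lra.
have s0' : 0 < `|d%:R * I1 - I2| by rewrite normr_gt0.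
set s := `|_| in s0'.
(* Near 0 both terms that bound [|t| c s] in [key] fall below half of it: the first because the
   distance is [o(t)], the second because it is quadratic in [t]. *)
have e1 : 0 < c * s / 2 / K by rewrite !divr_gt0// mulr_gt0.
have C12 : 0 < C1 + C2 + 1 by rewrite ltr_wpDl// addr_ge0.
have e2 : 0 < c * s / 2 / (C1 + C2 + 1) by rewrite !divr_gt0// mulr_gt0.
have Wn : \forall t \near (0 : R)^', `|W t / t| < c * s / 2 / K.
  by apply: filterS (cvgr_dist_lt _ _ Lv _ e1) => t; rewrite sub0r normrN.
near (0 : R)^' => t.
have t0 : t != 0 by near: t; exact: nbhs_dnbhs_neq.
have t2 : `|t| < c * s / 2 / (C1 + C2 + 1) by near: t; exact: dnbhs0_lt.
have Wt : `|W t / t| < c * s / 2 / K by near: t.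
have t0' : 0 < `|t| by rewrite normr_gt0.
have := key t; rewrite normrM (normrM t c) (gtr0_norm c0) -/s leNgt => /negP; apply.
move: Wt; rewrite normrM normfV ltr_pdivlMr// mulrAC ltr_pdivrMr// => Wt.
have {}t2 : `|t| * (C1 + C2) < c * s / 2.
  move: t2; rewrite ltr_pdivlMr// mulrDr mulr1.
  by apply: le_lt_trans; rewrite lerDl.
rewrite -[t ^+ 2]real_normK ?num_real// expr2.
have t3 : `|t| * (`|t| * (C1 + C2)) < `|t| * (c * s / 2) by rewrite ltr_pM2l.
have W1 : K * W t <= `|W t| * K.
  by rewrite mulrC; apply: ler_wpM2r (ler_norm _); exact: ltW.
by lra.
Unshelve. all: by end_near. Qed.


End gateaux_wave.

(** * Completeness of the trigonometric system *)

Lemma bernoulli_ge (R : realFieldType) (a : R) m : 0 <= a <= 1 ->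
  1 - m%:R * a <= (1 - a) ^+ m.
Proof.
move=> /andP[a0 a1]; elim: m => [|m IH]; first by rewrite mul0r subr0 expr0.
have := ler_wpM2l (_ : 0 <= 1 - a) IH; rewrite subr_ge0 -exprS => /(_ a1).
apply: le_trans; rewrite -natr1.
by have := mulr_ge0 (ler0n R m) (sqr_ge0 a); lra.
Qed.

(** Since [m a <= (1 + a)^m], the product is at most [(1 - a^2)^m]. *)
Lemma bernoulli_le (R : realFieldType) (a : R) m : 0 <= a <= 1 ->
  (1 - a) ^+ m * (m%:R * a) <= 1.
Proof.
move=> /andP[a0 a1].
have le1 : m%:R * a <= (1 + a) ^+ m.
  elim: m => [|m IH]; first by rewrite mul0r expr0.
  have h1 : 1 <= (1 + a) ^+ m by apply: exprn_ege1; rewrite lerDl.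
  rewrite exprS -natr1 mulrDl mul1r mulrDl mul1r lerD// -[leLHS]mulr1.
  by rewrite ler_wpM2l.
apply: le_trans (ler_wpM2l _ le1) _; first by rewrite exprn_ge0// subr_ge0.
rewrite -exprMn exprn_ile1//; first by rewrite mulr_ge0 ?subr_ge0// addr_ge0.
by have := sqr_ge0 a; lra.
Qed.

(** The polynomials of the Brosowski-Deutsch proof of the Stone-Weierstrass theorem. Their limit on
    [[0, 1]] is 1 below [1/2] and 0 above, according to whether [(2 s)^n] tends to 0 or to
    infinity. *)
Definition sharp (R : realType) (n : nat) (s : R) : R := (1 - s ^+ n) ^+ (2 ^ n).

Lemma sharp_itv (R : realType) n (s : R) : 0 <= s <= 1 -> 0 <= sharp n s <= 1.
Proof.
move=> /andP[s0 s1]; have sn0 : 0 <= s ^+ n by rewrite exprn_ge0.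
have sn1 : s ^+ n <= 1 by rewrite exprn_ile1.
by rewrite exprn_ge0 ?subr_ge0//= exprn_ile1 ?subr_ge0// gerBl.
Qed.

Lemma sharp_cvg1 (R : realType) (s : R) : 0 <= s < 1 / 2 ->
  sharp n s @[n --> \oo] --> (1 : R).
Proof.
move=> /andP[s0 s1]; have s01 : 0 <= s <= 1 by rewrite s0/=; lra.
have lim : 1 - (2 * s) ^+ n @[n --> \oo] --> (1 : R).
  rewrite -[X in _ --> X]subr0; apply: cvgB; first exact: cvg_cst.
  by apply: cvg_expr; rewrite ger0_norm; lra.
apply: squeeze_cvgr lim (cvg_cst (1 : R)).
apply: nearW => n; have /andP[_ ->] := sharp_itv n s01; rewrite andbT.
have := @bernoulli_ge _ (s ^+ n) (2 ^ n); rewrite natrX -exprMn; apply.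
by rewrite exprn_ge0// exprn_ile1//; lra.
Qed.

Lemma sharp_cvg0 (R : realType) (s : R) : 1 / 2 < s <= 1 ->
  sharp n s @[n --> \oo] --> (0 : R).
Proof.
move=> /andP[s0 s1]; have s01 : 0 <= s <= 1 by rewrite s1 andbT; lra.
have lim : ((2 * s)^-1) ^+ n @[n --> \oo] --> (0 : R).
  apply: cvg_expr; rewrite ger0_norm ?invr_ge0; last lra.
  by rewrite invf_lt1; lra.
apply: squeeze_cvgr (cvg_cst (0 : R)) lim.
apply: nearW => n; have /andP[-> _] := sharp_itv n s01; rewrite andTb.
have := @bernoulli_le _ (s ^+ n) (2 ^ n); rewrite natrX -exprMn.
have sn : 0 <= s ^+ n <= 1 by rewrite exprn_ge0 ?exprn_ile1//; lra.
move=> /(_ sn); rewrite -/(sharp n s) exprVn -ler_pdivlMr ?div1r//.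
by rewrite exprn_gt0//; lra.
Qed.

Lemma circle_lebesgue_Rintegral (R : realType) (F : circle R -> R) :
  (circle_lebesgue R).-integrable setT (EFin \o F) ->
  \int[circle_lebesgue R]_x F x =
  \int[lebesgue_measure]_(r in `[0%R, 1%R[) F (circle_proj r).
Proof.
move=> Fi; set lam := circle_lebesgue R.
have Fpi := integrable_funrpos measurableT Fi.
have Fni := integrable_funrneg measurableT Fi.
have int01 (g : circle R -> R) : (forall x, 0 <= g x) ->
    lam.-integrable setT (EFin \o g) ->
    (@lebesgue_measure R).-integrable `[0, 1[ (EFin \o (g \o @circle_proj R)) /\
    \int[lam]_x g x = \int[lebesgue_measure]_(r in `[0%R, 1%R[) g (circle_proj r).
  move=> g0 gi; have mg : measurable_fun setT g.
    by apply/measurable_EFinP; exact: (measurable_int lam).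
  have gE : (\int[lam]_x (g x)%:E =
      \int[lebesgue_measure]_(r in `[0%R, 1%R[) (g (circle_proj r))%:E)%E.
    apply: circle_lebesgue_integral; first exact/measurable_EFinP.
    by move=> x; rewrite lee_fin.
  split; last by rewrite /Rintegral gE.
  apply/integrableP; split.
    apply/measurable_EFinP; apply: measurable_funTS; apply: measurableT_comp => //.
    exact: measurable_circle_proj.
  under eq_integral do rewrite /= ger0_norm//.
  rewrite -gE; have := integrable_fin_num measurableT gi.
  by rewrite fin_numElt => /andP[].
have [p1 p2] := int01 _ (funrpos_ge0 F) Fpi.
have [n1 n2] := int01 _ (funrneg_ge0 F) Fni.
have FE x : F x = F^\+ x - F^\- x by rewrite -[in LHS](funrposBneg F).
under eq_Rintegral do rewrite FE.
rewrite RintegralB// p2 n2 -RintegralB//.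
by apply: eq_Rintegral => r _; rewrite FE.
Qed.

Section completeness.
Variable R : realType.
Local Notation lam := (circle_lebesgue R).

(** An inductive closure in place of coefficient lists: orthogonality to [w] and stability under
    products become inductions. *)
Inductive trig_poly : (circle R -> R) -> Prop :=
| trig_wave k th : trig_poly (wave k th)
| trig_add f g : trig_poly f -> trig_poly g -> trig_poly (fun x => f x + g x)
| trig_scale a f : trig_poly f -> trig_poly (fun x => a * f x).

Lemma trig_ext f g : trig_poly f -> f =1 g -> trig_poly g.
Proof. by move=> ft /funext <-. Qed.

Lemma trig_mul f g : trig_poly f -> trig_poly g -> trig_poly (fun x => f x * g x).
Proof.
move=> ft; elim: ft g => {f} [k th|f1 f2 _ IH1 _ IH2|a f _ IH] g gt; last 2 first.
- by apply: trig_ext (trig_add (IH1 g gt) (IH2 g gt)) _ => x; rewrite mulrDl.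
- by apply: trig_ext (trig_scale a (IH g gt)) _ => x; rewrite mulrA.
elim: gt => {g} [m th'|f1 f2 _ IH1 _ IH2|a f _ IH]; last 2 first.
- by apply: trig_ext (trig_add IH1 IH2) _ => x; rewrite mulrDr.
- by apply: trig_ext (trig_scale a IH) _ => x; rewrite mulrCA.
have prod (u v : R) : cos u * cos v = 2^-1 * (cos (u + v) + cos (u - v)).
  by rewrite cosD cosB; field.
(* Frequencies are natural numbers, so the difference frequency [k - m] must not be truncated. *)
wlog km : k m th th' / (m <= k)%N.
  move=> wl; have [/wl//|/ltnW/wl h] := leqP m k.
  by apply: trig_ext (h th' th) _ => x; rewrite mulrC.
apply: (trig_ext (trig_scale 2^-1 (trig_add (trig_wave (k + m) (th + th'))
  (trig_wave (k - m) (th - th'))))) => x.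
by rewrite /wave prod natrD natrB//; congr (_ * (cos _ + cos _)); ring.
Qed.

Lemma trig_one : trig_poly (fun=> 1).
Proof. by apply: trig_ext (trig_wave 0 0) _ => x; rewrite /wave mulr0 mul0r addr0 cos0. Qed.

Lemma trig_exp f n : trig_poly f -> trig_poly (fun x => f x ^+ n).
Proof.
move=> ft; elim: n => [|n IH]; first by apply: trig_ext trig_one _ => x; rewrite expr0.
by apply: trig_ext (trig_mul ft IH) _ => x; rewrite exprS.
Qed.

Lemma trig_Lfun f : trig_poly f -> f \in Lfun lam 2%:E.
Proof.
elim=> {f} [k th|f g _ f2 _ g2|a f _ f2]; first exact: wave_Lfun.
  exact: Lfun2D.
exact: Lfun2Z.
Qed.

Variable w : circle R -> R.
Hypotheses (w2 : w \in Lfun lam 2%:E)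
  (w_wave : forall k th, \int[lam]_x (wave k th x * w x) = 0).

Lemma trig_Rintegral f : trig_poly f -> \int[lam]_x (f x * w x) = 0.
Proof.
elim=> {f} [//|f g /trig_Lfun f2 f0 /trig_Lfun g2 g0|a f /trig_Lfun f2 f0].
  under eq_Rintegral do rewrite mulrDl.
  by rewrite RintegralD ?f0 ?g0 ?addr0//; exact: Lfun2_mul.
under eq_Rintegral do rewrite -mulrA.
by rewrite RintegralZl ?f0 ?mulr0//; exact: Lfun2_mul.
Qed.

(* By the product formula this is a trigonometric polynomial; it is below [1/2] exactly
   on the arc [0 < x < c]. *)
Let level (c : R) (x : circle R) : R :=
  1 / 2 - sin (pi * circle_sec x) * sin (pi * (c - circle_sec x)) / 2.

Let level_trig c : trig_poly (level c).
Proof.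
apply: (trig_ext (trig_add (trig_scale (1 / 2 + cos (pi * c) / 4) trig_one)
  (trig_scale (- (1 / 4)) (trig_wave 1 (- (pi * c)))))) => x.
rewrite /level /wave !mulr1.
have -> : 2 * pi * circle_sec x - pi * c = pi * circle_sec x - pi * (c - circle_sec x) by ring.
rewrite (_ : pi * c = pi * circle_sec x + pi * (c - circle_sec x)); last by ring.
by rewrite cosD cosB; field.
Qed.

Let level_itv c x : 0 <= level c x <= 1.
Proof.
have := sin_max (pi * circle_sec x); have := sin_max (pi * (c - circle_sec x)).
rewrite /level; set a := sin _; set b := sin _ => a1 b1.
have : `|b * a| <= 1 by rewrite normrM mulr_ile1.
by rewrite ler_norml => /andP[h1 h2]; apply/andP; split; lra.
Qed.

Lemma ae_circle_sec_neq (c : R) : {ae lam, forall x, circle_sec x != c}.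
Proof.
apply: (@ae_circle_sec R (fun r => r != c)); exists [set c]; split => //.
  exact: lebesgue_measure_set1.
by move=> r /= /negP; rewrite negbK => /eqP.
Qed.

(** The functions [sharp n (level c x)] are trigonometric polynomials with values in [[0, 1]] that
    tend to the indicator of the arc except at its ends, where the level is [1/2]. *)
Lemma trig_arc c : 0 < c < 1 ->
  \int[lam]_x (\1_[set x : circle R | circle_sec x <= c] x * w x) = 0.
Proof.
move=> /andP[c0 c1].
pose q n x := sharp n (level c x).
have q_trig n : trig_poly (q n).
  have := trig_exp (2 ^ n) (trig_add trig_one (trig_scale (-1) (trig_exp n (level_trig c)))).
  by move=> /trig_ext; apply => x; rewrite mulN1r.
have mS := measurable_circle_sec_le c.
have wi := Lfun2_integrable w2; have mw := Lfun2_measurable w2.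
have [] := @dominated_convergence _ _ _ lam setT measurableT
  (fun n x => (q n x * w x)%:E)
  (fun x => (\1_[set x : circle R | circle_sec x <= c] x * w x)%:E) (fun x => `|(w x)%:E|%E).
- move=> n; apply/measurable_EFinP; apply: measurable_funM => //.
  exact: Lfun2_measurable (trig_Lfun (q_trig n)).
- by apply/measurable_EFinP; apply: measurable_funM.
- apply: filterS2 (ae_circle_sec_neq 0) (ae_circle_sec_neq c) => x x0 xc _.
  apply: cvg_EFin; first exact: nearW.
  have /andP[s0 s1] := circle_sec_itv x.
  have {}s0 : 0 < circle_sec x by rewrite lt_def x0.
  have sin0 : 0 < sin (pi * circle_sec x).
    by apply: sin_gt0_pi; rewrite mulr_gt0 ?pi_gt0//= gtr_pMr ?pi_gt0.
  have l01 := level_itv c x.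
  have lE : level c x - 1 / 2 = - (sin (pi * circle_sec x) * sin (pi * (c - circle_sec x)) / 2).
    by rewrite /level addrAC subrr add0r.
  suff qlim : q n x @[n --> \oo] --> (\1_[set x : circle R | circle_sec x <= c] x : R).
    have wl : w x @[_ --> \oo] --> w x by exact: cvg_cst.
    exact: (cvgM qlim wl).
  rewrite indicE; case: (ltgtP (circle_sec x) c) xc => // [xc|cx] _.
    rewrite mem_set/=; last exact: ltW.
    apply: sharp_cvg1; case/andP: l01 => -> _ /=.
    rewrite -subr_lt0 lE oppr_lt0 divr_gt0// mulr_gt0//.
    apply: sin_gt0_pi; rewrite mulr_gt0 ?pi_gt0 ?subr_gt0//=.
    by rewrite gtr_pMr ?pi_gt0//; lra.
  rewrite memNset/=; last by apply/negP; rewrite -ltNge.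
  apply: sharp_cvg0; case/andP: l01 => _ ->; rewrite andbT.
  rewrite -subr_gt0 lE oppr_gt0 pmulr_llt0 ?invr_gt0// pmulr_rlt0//.
  rewrite -[c - _]opprB mulrN sinN oppr_lt0.
  apply: sin_gt0_pi; rewrite mulr_gt0 ?pi_gt0 ?subr_gt0//=.
  by rewrite gtr_pMr ?pi_gt0//; lra.
- exact: integrable_abse.
- apply: aeW => x n _; rewrite lee_fin normrM ler_piMl//.
  have /andP[q0 q1] := sharp_itv n (level_itv c x).
  by rewrite ger0_norm.
move=> _ _.
have E n : (\int[lam]_x (q n x * w x)%:E = 0)%E.
  have fi : (\int[lam]_x (q n x * w x)%:E)%E \is a fin_num.
    exact: (integrable_fin_num measurableT (Lfun2_mul (trig_Lfun (q_trig n)) w2)).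
  rewrite -(fineK fi) -[fine _]/(\int[lam]_x (q n x * w x)).
  by rewrite trig_Rintegral.
under eq_fun do rewrite E.
by move=> /cvg_lim => /(_ (@ereal_hausdorff R)); rewrite lim_cst// /Rintegral => <-.
Qed.

(** By [trig_arc] the primitive of [w] vanishes on []0, 1[], and at almost every point its
    derivative is [w]. *)
Lemma wave_complete : {ae lam, forall x, w x = 0}.
Proof.
have wi := Lfun2_integrable w2; have mw := Lfun2_measurable w2.
pose h (r : R) : R := if 0 <= r < 1 then w (circle_proj r) else 0.
have mh : measurable_fun [set: R] h.
  apply: measurable_fun_if => //; first apply: measurable_and => //.
  - exact: measurable_fun_ler.
  - exact: measurable_fun_ltr.
  apply: measurable_funTS; apply: measurableT_comp => //.
  exact: measurable_circle_proj.
have hi : (@lebesgue_measure R).-integrable setT (EFin \o h).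
  apply/integrableP; split; first exact/measurable_EFinP.
  have /integrableP[_] := wi.
  rewrite circle_lebesgue_integral//; last exact/measurableT_comp/measurable_EFinP.
  rewrite integral_mkcond; congr (_ < +oo)%E; apply: eq_integral => r _.
  rewrite patchE /h /= mem_setE in_itv/=.
  by case: ifP => //=; rewrite normr0.
have harc c : 0 < c < 1 -> \int[lebesgue_measure]_(r in `]-oo, c]) h r = 0.
  move=> c01; rewrite -(trig_arc c01) circle_lebesgue_Rintegral; last first.
    apply: Lfun2_mul => //; apply: (@Lfun2_bounded _ _ _ _ _ 1).
      exact: (measurable_indic (measurable_circle_sec_le c)).
    by move=> x; rewrite indicE normr_nat lern1; case: (_ \in _).
  rewrite Rintegral_mkcond [RHS]Rintegral_mkcond; apply: eq_Rintegral => r _.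
  rewrite !patchE /h !mem_setE !in_itv/= indicE.
  case: ifPn => [rc|]; case: ifPn => [r01|] //.
    by rewrite mem_set ?mul1r//= circle_sec_proj.
  by move=> rc; rewrite memNset ?mul0r//= circle_sec_proj//; exact/negP.
suff : {ae (@lebesgue_measure R), forall r, 0 < r < 1 -> h r = 0}.
  move=> /ae_circle_sec; apply: filterS2 (ae_circle_sec_neq 0) => x x0 hx.
  have /andP[s0 s1] := circle_sec_itv x.
  by have := hx _; rewrite /h s0 s1 lt_def x0 s0 circle_secK; apply.
have := lebesgue_differentiation (open_integrable_locally openT hi).
apply: filterS; first exact: (ae_filter_ringOfSetsType (@lebesgue_measure R)).
move=> x hx /andP[x0 x1].
have hiu : (@lebesgue_measure R).-integrable `]-oo, 1] (EFin \o h) by exact: integrableS hi.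
have [dG GE] := FTC1_lebesgue_pt x1 hiu (ltNyr x) hx.
rewrite -GE derive1E (@near_eq_derive _ _ _ _ (cst 0)) ?derive_cst//.
near=> y; apply: harc; apply/andP; split; near: y.
- exact: lt_nbhsr.
- exact: lt_nbhsl.
Unshelve. all: by end_near. Qed.

End completeness.

(** * The logarithm of the sine *)

Section roots_of_unity.
Variable R : realType.

Let unit_circle (a : R) : R[i] := Complex (cos a) (sin a).

Let sqnorm (z : R[i]) : R := complex.Re z ^+ 2 + complex.Im z ^+ 2.

Let sqnormM z w : sqnorm (z * w) = sqnorm z * sqnorm w.
Proof. by case: z w => [a b] [c d]; rewrite /sqnorm /=; ring. Qed.

Let sqnorm_prod n (F : nat -> R[i]) :
  sqnorm (\prod_(0 <= i < n) F i) = \prod_(0 <= i < n) sqnorm (F i).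
Proof.
apply: (big_morph sqnorm sqnormM).
by rewrite /sqnorm /= expr1n expr0n addr0.
Qed.

Let unit_circleD a b : unit_circle (a + b) = unit_circle a * unit_circle b.
Proof. by rewrite /unit_circle cosD sinD; congr Complex; rewrite addrC. Qed.

Let unit_circleX a n : unit_circle a ^+ n = unit_circle (n%:R * a).
Proof.
elim: n => [|n IH]; first by rewrite expr0 mul0r /unit_circle cos0 sin0.
by rewrite exprS IH -unit_circleD -natr1 mulrDl mul1r addrC.
Qed.

Let sqnormB a b : sqnorm (unit_circle a - unit_circle b) = 2 - 2 * cos (a - b).
Proof.
have := cos2Dsin2 a; have := cos2Dsin2 b.
rewrite /sqnorm /= cosB; set x := cos a; set y := sin a; set u := cos b; set v := sin b.
by move=> h1 h2; rewrite !sqrrB; lra.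
Qed.

Lemma two_sub_cos (a : R) : 2 - 2 * cos (2 * a) = 4 * sin a ^+ 2.
Proof.
have := cos2Dsin2 a; rewrite (_ : 2 * a = a + a); last by ring.
by rewrite cosD -!expr2; lra.
Qed.

Lemma two_sub_cos_gt0 (s : R) : 0 < s < 1 -> 0 < 2 - 2 * cos (2 * pi * s).
Proof.
move=> /andP[s0 s1]; rewrite -mulrA two_sub_cos mulr_gt0// exprn_gt0//.
by apply: sin_gt0_pi; rewrite mulr_gt0 ?pi_gt0//= gtr_pMr ?pi_gt0.
Qed.

Let root_prim d : (0 < d)%N -> d.-primitive_root (unit_circle (2 * pi / d%:R)).
Proof.
move=> d0; have dn0 : d%:R != 0 :> R by rewrite pnatr_eq0 -lt0n.
apply/andP; split => //; apply/forallP => i; apply/eqP.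
rewrite unity_rootE unit_circleX; have [->|id] := eqVneq i.+1 d.
  rewrite (_ : d%:R * _ = 0 + 2 * pi * 1%:~R); last by field.
  rewrite /unit_circle cosD2piz -cosBpihalf addrAC cosD2piz cosBpihalf.
  by rewrite cos0 sin0; apply/eqP.
apply/negbTE/eqP => h.
have sp : 0 < i.+1%:R / d%:R :> R by rewrite divr_gt0 ?ltr0n.
have sp1 : i.+1%:R / d%:R < 1 :> R.
  by rewrite ltr_pdivrMr ?ltr0n// mul1r ltr_nat ltn_neqAle id; exact: ltn_ord.
have := @two_sub_cos_gt0 (i.+1%:R / d%:R); rewrite sp sp1 => /(_ isT).
move: h => /(congr1 (@complex.Re R)) /=.
rewrite (_ : i.+1%:R * (2 * pi / d%:R) = 2 * pi * (i.+1%:R / d%:R)); last by ring.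
by move=> ->; rewrite mulr1 subrr ltxx.
Qed.

(** The squared modulus of the factorisation of [X^d - 1] over the [d]-th roots of unity, evaluated
    at [exp (- i a / d)]; the squared distance of two points of the unit circle is [2 - 2 cos] of
    their angle. *)
Lemma prod_two_sub_cos d (a : R) : (0 < d)%N ->
  \prod_(j < d) (2 - 2 * cos ((a + 2 * pi * j%:R) / d%:R)) = 2 - 2 * cos a.
Proof.
move=> d0; have dn0 : d%:R != 0 :> R by rewrite pnatr_eq0 -lt0n.
pose z := unit_circle (- (a / d%:R)).
have zE (b : R[i]) : ('X - b%:P).[z] = z - b by rewrite !hornerE.
have zdE : ('X^d - 1).[z] = z ^+ d - 1 by rewrite !hornerE.
have rhsE : sqnorm (z ^+ d - 1) = 2 - 2 * cos a.
  rewrite unit_circleX (_ : 1 = unit_circle 0); last first.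
    by rewrite /unit_circle cos0 sin0.
  by rewrite sqnormB subr0 mulrN mulrCA divff// mulr1 cosN.
have := congr1 (fun p => sqnorm p.[z]) (factor_Xn_sub_1 (root_prim d0)).
rewrite /= zdE rhsE horner_prod sqnorm_prod => <-.
rewrite big_mkord; apply: eq_bigr => j _.
rewrite zE unit_circleX sqnormB -cosN; congr (2 - 2 * cos _).
by rewrite mulrDl; field.
Qed.

End roots_of_unity.

Lemma ln_prod (R : realType) n (u : 'I_n -> R) : (forall j, 0 < u j) ->
  ln (\prod_(j < n) u j) = \sum_(j < n) ln (u j).
Proof.
move=> u0; have [] : 0 < \prod_(j < n) u j /\
    ln (\prod_(j < n) u j) = \sum_(j < n) ln (u j); last by [].
apply: (big_ind2 (fun p s => 0 < p /\ ln p = s)); first by rewrite ln1.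
  by move=> p s q t [p0 <-] [q0 <-]; rewrite mulr_gt0 ?lnM.
by move=> j _; split.
Qed.

Section log_sine.
Variable R : realType.
Local Notation lam := (circle_lebesgue R).

(** Equal to [2 log |2 sin (pi x)|] for [x] other than 0, and to [ln 0 = 0] at 0. *)
Definition log_sine (x : circle R) : R := ln (2 - 2 * wave 1 0 x).

Lemma log_sine_arg (x : circle R) : 2 - 2 * wave 1 0 x = 2 - 2 * cos (2 * pi * circle_sec x).
Proof. by rewrite /wave mulr1 addr0. Qed.

Lemma log_sine_arg_gt0 (x : circle R) : circle_sec x != 0 -> 0 < 2 - 2 * wave 1 0 x.
Proof.
move=> x0; rewrite log_sine_arg; apply: two_sub_cos_gt0.
by have /andP[s0 ->] := circle_sec_itv x; rewrite lt_def x0 s0.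
Qed.

Lemma measurable_log_sine : measurable_fun [set: circle R] log_sine.
Proof.
apply: measurableT_comp; first exact: measurable_ln.
by apply: measurable_funB => //; apply: measurable_funM => //; exact: measurable_wave.
Qed.

(** The logarithm of [prod_two_sub_cos], all of whose factors are positive away from 0. *)
Lemma transfer_log_sine d (x : circle R) : (0 < d)%N -> circle_sec x != 0 ->
  transfer d log_sine x = log_sine x.
Proof.
move=> d0 x0; have dn0 : d%:R != 0 :> R by rewrite pnatr_eq0 -lt0n.
have argE (j : 'I_d) : 2 - 2 * wave 1 0 (circle_branch d j x) =
    2 - 2 * cos ((2 * pi * circle_sec x + 2 * pi * j%:R) / d%:R).
  rewrite log_sine_arg circle_branch_sec//; congr (2 - 2 * cos _).
  by rewrite mulrA mulrDr.
have bx0 (j : 'I_d) : circle_sec (circle_branch d j x) != 0.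
  rewrite circle_branch_sec// mulf_neq0 ?invr_eq0//.
  have /andP[s0 _] := circle_sec_itv x.
  by rewrite gt_eqF// ltr_wpDr// lt_def x0.
rewrite /transfer /log_sine log_sine_arg -(prod_two_sub_cos _ d0).
rewrite ln_prod => [|j]; first by apply: eq_bigr => j _; rewrite argE.
by rewrite -argE; exact: log_sine_arg_gt0.
Qed.

(** Truncated squares have a finite integral, which can be moved across an inequality before [n]
    tends to infinity. *)
Let clip (n : nat) (u : R) : R := Num.min u n%:R.

(** An affine bound with slope at least 1 and nonnegative constant survives truncation. *)
Let clip_le n u v c : 0 <= u -> 0 <= c -> v <= 3 / 2 * u + c -> clip n v <= 3 / 2 * clip n u + c.
Proof.
rewrite /clip => u0 c0 vu; have n0 : 0 <= n%:R :> R by [].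
by have [h1|h1] := leP u n%:R; have [h2|h2] := leP v n%:R; lra.
Qed.

(* Halving: [log_sine (s / 2) + log_sine ((s + 1) / 2) = log_sine s] where one of the
   two summands is at most [ln 4] in absolute value. *)
Let log_sine_half n (x : circle R) :
  clip n (log_sine (circle_branch 2 0 x) ^+ 2) +
  clip n (log_sine (circle_branch 2 1 x) ^+ 2) <=
  3 / 2 * clip n (log_sine x ^+ 2) + 4 * ln 4 ^+ 2.
Proof.
have c0 : 0 <= ln 4 :> R by apply: ln_ge0; lra.
have ln_itv (u : R) : 2 <= u <= 4 -> 0 <= ln u <= ln 4.
  move=> /andP[u2 u4]; rewrite ln_ge0 ?ler_ln ?posrE//=; lra.
set A := log_sine (circle_branch 2 0 x); set B := log_sine (circle_branch 2 1 x).
have clip_sqr u : 0 <= u <= ln 4 -> clip n (u ^+ 2) <= ln 4 ^+ 2.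
  by move=> /andP[u0 u4]; rewrite /clip ge_min lerXn2r.
have clip0 u : 0 <= clip n (u ^+ 2) by rewrite /clip le_min sqr_ge0/=.
have c20 := sqr_ge0 (ln 4 : R).
(* At 0 the functional equation fails, since [ln 0 = 0] while the other branch gives [ln 4]; the
   bound still holds. *)
have [x0|x0] := eqVneq (circle_sec x) 0.
  have A0 : A = 0.
    rewrite /A /log_sine log_sine_arg circle_branch_sec// x0 addr0 mul0r mulr0 cos0.
    by rewrite mulr1 subrr ln0.
  have : 0 <= B <= ln 4.
    rewrite /B /log_sine log_sine_arg circle_branch_sec// x0 add0r.
    rewrite (_ : 2 * pi * (1 / 2) = pi); last by field.
    by apply: ln_itv; rewrite cospi; lra.
  move=> /clip_sqr hB; rewrite A0; have := clip0 (log_sine x).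
  have : clip n (0 ^+ 2) <= 0 by rewrite /clip expr0n ge_min lexx.
  by lra.
have AB : A + B = log_sine x.
  by rewrite -(transfer_log_sine (isT : (0 < 2)%N) x0) /transfer !big_ord_recl big_ord0 addr0.
have /andP[s0 s1] := circle_sec_itv x.
have key (u v : R) : u + v = log_sine x -> 0 <= v <= ln 4 ->
    clip n (u ^+ 2) + clip n (v ^+ 2) <= 3 / 2 * clip n (log_sine x ^+ 2) + 4 * ln 4 ^+ 2.
  move=> uv v4; have hv := clip_sqr v v4; case/andP: v4 => v0 v4.
  have v2 : v ^+ 2 <= ln 4 ^+ 2 by rewrite lerXn2r.
  (* With [L = u + v], the difference [3/2 L^2 + 3 v^2 - (L - v)^2] is [(L + 2 v)^2 / 2]. The factor
     must be less than 2 for the absorption in [clip_int]. *)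
  have : u ^+ 2 <= 3 / 2 * log_sine x ^+ 2 + 3 * ln 4 ^+ 2.
    have := sqr_ge0 (log_sine x + 2 * v); rewrite -uv !sqrrD; lra.
  move=> /(clip_le n (sqr_ge0 _)); move=> /(_ (mulr_ge0 (ler0n R 3) c20)); lra.
have pis0 : 0 <= pi * circle_sec x by rewrite mulr_ge0 ?pi_ge0.
(* One branch lands in [[1/4, 3/4]], where [2 - 2 cos] lies between 2 and 4: the second for
   [s <= 1/2], the first otherwise. *)
have [s2|s2] := leP (circle_sec x) (1 / 2).
  apply: key => //; apply: ln_itv; rewrite log_sine_arg circle_branch_sec//.
  rewrite (_ : 2 * pi * _ = pi * circle_sec x + pi); last by field.
  rewrite cosDpi; have := cos_le1 (pi * circle_sec x).
  have : 0 <= cos (pi * circle_sec x).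
    apply: cos_ge0_pihalf; apply/andP; split.
      by rewrite (le_trans _ pis0)// oppr_le0 divr_ge0 ?pi_ge0.
    by rewrite ler_pM2l ?pi_gt0// -div1r.
  by lra.
rewrite addrC; apply: key; first by rewrite addrC.
apply: ln_itv; rewrite log_sine_arg circle_branch_sec//.
rewrite (_ : 2 * pi * _ = pi * circle_sec x - pi + pi); last by field.
rewrite cosDpi; have := cos_le1 (pi * circle_sec x - pi).
have : 0 <= cos (pi * circle_sec x - pi).
  have p0 := pi_gt0 R.
  have : pi * (1 / 2) <= pi * circle_sec x by rewrite ler_pM2l// ltW.
  have : pi * circle_sec x <= pi * 1 by rewrite ler_pM2l// ltW.
  by move=> h1 h2; apply: cos_ge0_pihalf; apply/andP; split; lra.
by lra.
Qed.

Let clip_integrable n :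
  lam.-integrable setT (EFin \o (fun x => clip n (log_sine x ^+ 2))).
Proof.
have ml := measurable_log_sine; apply: Lfun2_integrable.
apply: (@Lfun2_bounded _ _ _ _ _ n%:R).
  by apply: measurable_minr => //; exact: measurable_funX.
move=> x; rewrite ger0_norm; first by rewrite /clip ge_min lexx orbT.
by rewrite /clip le_min sqr_ge0 ler0n.
Qed.

(** Integrating [log_sine_half] puts twice this integral on the left and [3/2] of it on the right;
    half of it is thus at most [4 ln(4)^2], uniformly in [n]. *)
Let clip_int n : \int[lam]_x clip n (log_sine x ^+ 2) <= 8 * ln 4 ^+ 2.
Proof.
have ci := clip_integrable n.
have b0 := integrable_branch (isT : (0 < 2)%N) (isT : (0 < 2)%N) ci.
have b1 := integrable_branch (isT : (0 < 2)%N) (isT : (1 < 2)%N) ci.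
have cc : lam.-integrable [set: circle R] (EFin \o (fun=> 4 * ln 4 ^+ 2 : R)).
  exact: (Lfun2_integrable (Lfun_cst lam _ _)).
have lam1 : fine (lam [set: circle R]) = 1 by rewrite probability_setT.
have : \int[lam]_x (clip n (log_sine (circle_branch 2 0 x) ^+ 2) +
   clip n (log_sine (circle_branch 2 1 x) ^+ 2)) <=
   \int[lam]_x (3 / 2 * clip n (log_sine x ^+ 2) + 4 * ln 4 ^+ 2).
  apply: le_Rintegral => //.
  - exact: (integrableD measurableT b0 b1).
  - exact: (integrableD measurableT (integrableZl measurableT (3 / 2) ci) cc).
have -> : \int[lam]_x (3 / 2 * clip n (log_sine x ^+ 2) + 4 * ln 4 ^+ 2) =
    3 / 2 * \int[lam]_x clip n (log_sine x ^+ 2) + 4 * ln 4 ^+ 2.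
  rewrite RintegralD//; last exact: (integrableZl measurableT (3 / 2) ci).
  by rewrite Rintegral_cst// lam1 mulr1 RintegralZl.
have -> : \int[lam]_x (clip n (log_sine (circle_branch 2 0 x) ^+ 2) +
   clip n (log_sine (circle_branch 2 1 x) ^+ 2)) = 2 * \int[lam]_x clip n (log_sine x ^+ 2).
  rewrite (RintegralD measurableT b0 b1) (Rintegral_branch (isT : (0 < 2)%N) ci).
  by rewrite mulVKf// !big_ord_recl big_ord0 addr0.
lra.
Qed.

Lemma log_sine_Lfun : log_sine \in Lfun lam 2%:E.
Proof.
have ml := measurable_log_sine.
apply: Lfun2I => //.
apply: (@le_lt_trans _ _ (8 * ln 4 ^+ 2)%:E); last exact: ltry.
have clip_ge0 n (x : circle R) : 0 <= clip n (log_sine x ^+ 2).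
  by rewrite /clip le_min sqr_ge0 ler0n.
have mc n : measurable_fun setT (fun x : circle R => clip n (log_sine x ^+ 2)).
  by apply: measurable_minr => //; exact: measurable_funX.
have limE (x : circle R) : limn (fun n => (clip n (log_sine x ^+ 2))%:E) = (log_sine x ^+ 2)%:E.
  apply/cvg_lim => //; apply: cvg_near_cst; near=> n; congr EFin.
  by apply/min_idPl; near: n; exact: nbhs_infty_ger.
have := @cvg_monotone_convergence _ _ _ lam setT measurableT
  (fun n x => (clip n (log_sine x ^+ 2))%:E).
under [X in _ --> X]eq_integral do rewrite limE.
have c_nd (x : circle R) : [set: circle R] x ->
    {homo (fun n => (clip n (log_sine x ^+ 2))%:E) : m n / (m <= n)%N >-> (m <= n)%E}.
  move=> _ m n mn; rewrite lee_fin /clip le_min ge_min lexx/= ge_min.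
  by apply/orP; right; rewrite ler_nat.
move=> /(_ (fun n => (measurable_EFinP _ _).2 (mc n))).
move=> /(_ (fun n x _ => clip_ge0 n x)) /(_ c_nd) h.
rewrite -(cvg_lim (@ereal_hausdorff R) h); apply: lime_le; first exact: cvgP h.
apply: nearW => n; have := clip_int n.
rewrite -lee_fin /Rintegral fineK//.
exact: (integrable_fin_num measurableT (clip_integrable n)).
Unshelve. all: by end_near. Qed.

End log_sine.

(** * Invariant vectors *)

Lemma ae_eq_Rintegral d (T : measurableType d) (R : realType)
    (mu : {measure set T -> \bar R}) (f g : T -> R) :
  measurable_fun setT f -> measurable_fun setT g ->
  {ae mu, forall x, f x = g x} -> \int[mu]_x f x = \int[mu]_x g x.
Proof.
move=> mf mg fg; congr fine; apply: ae_eq_integral => //.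
- exact/measurable_EFinP.
- exact/measurable_EFinP.
- by apply: filterS fg => x /= -> _.
Qed.

Section coefficients.
Variable R : realType.
Local Notation lam := (circle_lebesgue R).
Implicit Types u v : L20 lam.

Definition wave_coef k th v : R := \int[lam]_x (wave k th x * L20_fun v x).

Lemma wave_coef_linear k th a u v :
  wave_coef k th (a *: u + v) = a * wave_coef k th u + wave_coef k th v.
Proof.
have u2 := L20_fun_Lfun u; have v2 := L20_fun_Lfun v.
have w2 := @wave_Lfun R k th.
have mw := @measurable_wave R k th.
rewrite /wave_coef -RintegralZl//; last exact: Lfun2_mul.
rewrite -RintegralD//; last 2 first.
- exact: (integrableZl measurableT a (Lfun2_mul w2 u2)).
- exact: Lfun2_mul.
apply: ae_eq_Rintegral.
- by apply: measurable_funM => //; exact: (Lfun2_measurable (L20_fun_Lfun _)).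
- have mu := Lfun2_measurable u2; have mv := Lfun2_measurable v2.
  by apply: measurable_funD; do ?apply: measurable_funM.
- apply: filterS2 (L20_funD (a *: u) v) (L20_funZ a u) => x -> ->.
  by rewrite mulrDr mulrCA.
Qed.

Lemma wave_coef0 k th : wave_coef k th 0 = 0.
Proof. by have := wave_coef_linear k th 1 0 0; rewrite scaler0 addr0; lra. Qed.

Lemma wave_coefZ k th a v : wave_coef k th (a *: v) = a * wave_coef k th v.
Proof. by have := wave_coef_linear k th a v 0; rewrite wave_coef0 !addr0. Qed.

Lemma wave_coefD k th u v : wave_coef k th (u + v) = wave_coef k th u + wave_coef k th v.
Proof. by have := wave_coef_linear k th 1 u v; rewrite scale1r mul1r. Qed.

Lemma wave_coef_sum k th n (c : 'I_n -> R) (v : 'I_n -> L20 lam) :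
  wave_coef k th (\sum_(i < n) c i *: v i) = \sum_(i < n) c i * wave_coef k th (v i).
Proof.
elim/big_ind2: _ => //; first exact: wave_coef0.
  by move=> u a v' b <- <-; rewrite wave_coefD.
by move=> i _; rewrite wave_coefZ.
Qed.

Lemma wave_coef_of k th (f : circle R -> R) (f2 : f \in Lfun lam 2%:E)
    (f0 : \int[lam]_x f x = 0) :
  wave_coef k th (L20_of f2 f0) = \int[lam]_x (wave k th x * f x).
Proof.
have mw := @measurable_wave R k th.
apply: ae_eq_Rintegral.
- by apply: measurable_funM => //; exact: (Lfun2_measurable (L20_fun_Lfun _)).
- by apply: measurable_funM => //; exact: Lfun2_measurable f2.
- by apply: filterS (L20_ofK f2 f0) => x ->.
Qed.

(** Completeness also asks for frequency 0, which the zero mean supplies. *)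
Lemma wave_coef_eq0 v : (forall k th, (0 < k)%N -> wave_coef k th v = 0) -> v = 0.
Proof.
move=> v0; apply: L20_fun_eq; have v2 := L20_fun_Lfun v.
have /wave_complete : forall k th, \int[lam]_x (wave k th x * L20_fun v x) = 0.
  case=> [th|k th]; last exact: v0.
  rewrite (@eq_Rintegral _ _ _ _ _ (fun x => cos th * L20_fun v x)).
    by rewrite RintegralZl ?L20_mean ?mulr0//; exact: Lfun2_integrable.
  by move=> x _; rewrite /wave mulr0 mul0r add0r.
move=> /(_ v2) vx; have z0 := L20_funZ 0 v; rewrite scale0r in z0.
by apply: filterS2 vx z0 => x -> ->; rewrite mul0r.
Qed.

Lemma wave_coef_inj u v : (forall k th, (0 < k)%N -> wave_coef k th u = wave_coef k th v) -> u = v.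
Proof.
move=> uv; apply/eqP; rewrite -subr_eq0; apply/eqP; apply: wave_coef_eq0 => k th k0.
by rewrite wave_coefD -scaleN1r wave_coefZ uv// mulN1r subrr.
Qed.

Lemma D_Phi_gateaux d : (0 < d)%N -> is_gateaux_derivative (@Phi_push R d) (@D_Phi R d).
Proof.
move=> d0; apply: getPex.
by exists (transfer_L20 d0); exact: transfer_L20_gateaux.
Qed.

(** By [gateaux_wave] any two Gateaux derivatives have the same coefficients, so [get] can only
    return the transfer operator. *)
Lemma D_PhiE d (d0 : (0 < d)%N) v : D_Phi d v = transfer_L20 d0 v.
Proof.
apply: wave_coef_inj => k th k0.
rewrite /wave_coef (gateaux_wave v th d0 k0 (D_Phi_gateaux d0)).
by rewrite (gateaux_wave v th d0 k0 (@transfer_L20_gateaux R d d0)).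
Qed.

Lemma E_coef d v k th : (0 < d)%N -> (0 < k)%N -> E R d v ->
  wave_coef k th v = d%:R * wave_coef (k * d) th v.
Proof.
move=> d0 k0 vE; rewrite -(gateaux_wave v th d0 k0 (D_Phi_gateaux d0)).
by rewrite [in RHS]vE.
Qed.

Lemma E_linear d a u v : (0 < d)%N -> E R d u -> E R d v -> E R d (a *: u + v).
Proof.
move=> d0 uE vE; have [lin _ _] := D_Phi_gateaux d0.
by rewrite /E /= lin uE vE.
Qed.

Lemma E_of d (f : circle R -> R) (f2 : f \in Lfun lam 2%:E)
    (f0 : \int[lam]_x f x = 0) : (0 < d)%N ->
  {ae lam, forall x, transfer d f x = f x} -> E R d (L20_of f2 f0).
Proof.
move=> d0 fd; rewrite /E /= (D_PhiE d0); apply: L20_fun_eq.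
have h1 := L20_ofK f2 f0.
have h2 := L20_ofK (Lfun2_transfer d0 (L20_fun_Lfun (L20_of f2 f0))) (transfer_mean0 d0 _).
have h3 := ae_transfer d0 h1.
near=> x; rewrite (near h1 x)// -(near fd x)// -(near h3 x)//.
exact: (near h2 x).
Unshelve. all: by end_near. Qed.

(** The transfer multiplies the mean by [d], and [d] is not 1. *)
Lemma transfer_fixed_mean0 d (f : circle R -> R) : (1 < d)%N -> f \in Lfun lam 2%:E ->
  {ae lam, forall x, transfer d f x = f x} -> \int[lam]_x f x = 0.
Proof.
move=> d1 f2 fd; have d0 := ltnW d1.
have := Rintegral_transfer d0 f2; rewrite (ae_eq_Rintegral _ _ fd); last 2 first.
- exact: (Lfun2_measurable (Lfun2_transfer d0 f2)).
- exact: Lfun2_measurable f2.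
move=> /eqP; rewrite -subr_eq0 -{1}[\int[_]_x _]mul1r -mulrBl mulf_eq0 subr_eq0.
rewrite -[1]/(1%:R) eqr_nat => /orP[/eqP d1'|/eqP//].
by rewrite -d1' ltnn in d1.
Qed.

Lemma E_all_eq0 v : (forall d, (2 <= d)%N -> E R d v) ->
  wave_coef 1 0 v = 0 -> wave_coef 1 (pi / 2) v = 0 -> v = 0.
Proof.
move=> vE c0 s0; apply: wave_coef_eq0 => k th k0.
(* A wave of any phase is a combination of those of phase 0 and [pi / 2]. *)
have coef1 : wave_coef 1 th v = 0.
  have v2 := L20_fun_Lfun v.
  have i1 := Lfun2_mul (@wave_Lfun R 1 0) v2.
  have i2 := Lfun2_mul (@wave_Lfun R 1 (pi / 2)) v2.
  rewrite /wave_coef (@eq_Rintegral _ _ _ _ _ (fun x =>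
    cos th * (wave 1 0 x * L20_fun v x) + sin th * (wave 1 (pi / 2) x * L20_fun v x))).
    rewrite RintegralD//; last 2 first.
    - exact: (integrableZl measurableT (cos th) i1).
    - exact: (integrableZl measurableT (sin th) i2).
    by rewrite !RintegralZl// -/(wave_coef 1 0 v) -/(wave_coef 1 (pi / 2) v) c0 s0 !mulr0 addr0.
  move=> x _; rewrite /wave addr0 cosDpihalf cosD; ring.
have [->//|k1] := eqVneq k 1%N.
have k2 : (2 <= k)%N by rewrite ltn_neqAle eq_sym k1.
have := E_coef th k0 (isT : (0 < 1)%N) (vE k k2); rewrite coef1 mul1n => /esym/eqP.
by rewrite mulf_eq0 pnatr_eq0 -[X in X || _]negbK -lt0n k0 => /eqP.
Qed.

End coefficients.

(** * The sawtooth *)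

Section sawtooth.
Variable R : realType.
Local Notation lam := (circle_lebesgue R).

Definition sawtooth (x : circle R) : R := 1 / 2 - circle_sec x.

Lemma measurable_sawtooth : measurable_fun [set: circle R] sawtooth.
Proof. by apply: measurable_funB => //; exact: measurable_circle_sec. Qed.

Lemma sawtooth_le1 x : `|sawtooth x| <= 1.
Proof.
have /andP[s0 s1] := circle_sec_itv x.
by rewrite ler_norml /sawtooth; apply/andP; split; lra.
Qed.

Lemma transfer_sawtooth d x : (0 < d)%N -> transfer d sawtooth x = sawtooth x.
Proof.
move=> d0; have dn0 : d%:R != 0 :> R by rewrite pnatr_eq0 -lt0n.
have sumj : \sum_(j < d) j%:R = d%:R * (d%:R - 1) / 2 :> R.
  elim: (d) => [|n IH]; first by rewrite big_ord0 !mul0r.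
  by rewrite big_ord_recr /= IH -natr1; field.
rewrite /transfer /sawtooth.
under eq_bigr => j _ do rewrite circle_branch_sec// mulrDl opprD addrA.
rewrite sumrB sumr_const card_ord -mulr_suml sumj -[_ *+ d]mulr_natl.
by field.
Qed.

(* Multiplication by [m = d q + 1] permutes the branches: [m psi_j(x) = psi_j(x) + q x]. *)
Lemma transfer_comp_mul d q (f : circle R -> R) : (0 < d)%N ->
  (forall x, transfer d f x = f x) -> forall x,
  transfer d (f \o circle_mul (d * q).+1) x = f (circle_mul (d * q).+1 x).
Proof.
move=> d0 fd x; set m := (d * q).+1.
have mE (j : 'I_d) : circle_mul m (circle_branch d j x) =
    circle_branch d j x + circle_mul q x.
  have bx : circle_branch d j x *+ d = x := circle_mul_branch d0 j x.
  by rewrite /m /circle_mul mulrS mulrnA bx.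
have /choice[s sE] : forall j : 'I_d, exists i : 'I_d,
    circle_mul m (circle_branch d j x) = circle_branch d i (circle_mul m x).
  move=> j; have [i id iE] := circle_branch_surj (circle_mul m (circle_branch d j x)) d0.
  exists (Ordinal id); rewrite [LHS]iE; congr circle_branch.
  rewrite -[in RHS](circle_mul_branch d0 j x).
  by rewrite /circle_mul -!mulrnA mulnC.
have s_inj : injective s.
  move=> i j ij; have := sE i; rewrite ij -sE !mE => /addIr /(congr1 (@circle_sec R)).
  rewrite !circle_branch_sec// => /(mulIf _) /addrI h.
  by apply/val_inj/eqP; rewrite -(eqr_nat R) h// invr_eq0 pnatr_eq0 -lt0n.
rewrite -[RHS]fd /transfer [RHS](reindex_inj s_inj).
by apply: eq_bigr => j _; rewrite /= sE.
Qed.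

(** Multiplied by [sin (b / 2)] the sum telescopes, and the second hypothesis equates its two
    ends. *)
Lemma sum_cos_eq0 (a b : R) (n : nat) : sin (b / 2) != 0 ->
  sin (a + (n%:R - 1 / 2) * b) = sin (a - b / 2) -> \sum_(j < n) cos (a + j%:R * b) = 0.
Proof.
move=> b0 ab; apply: (mulfI b0); rewrite mulr0 mulr_sumr.
pose F (j : nat) := sin (a + (j%:R - 1 / 2) * b) / 2.
rewrite (eq_bigr (fun j : 'I_n => F j.+1 - F j)) => [|j _].
  rewrite -(big_mkord xpredT (fun j => F j.+1 - F j)) telescope_sumr// /F ab.
  by rewrite (_ : (0%:R - 1 / 2) * b = - (b / 2)) ?subrr//; field.
have jS : a + (j.+1%:R - 1 / 2) * b = (a + j%:R * b) + b / 2.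
  by rewrite -[j.+1%:R]natr1; field.
have jB : a + (j%:R - 1 / 2) * b = (a + j%:R * b) - b / 2 by field.
rewrite /F jS jB.
by rewrite sinD sinB; field.
Qed.

(** Along the [m] preimages the phase advances by steps of [2 pi k / m], which are not multiples of
    [2 pi] but add up to one. *)
Lemma transfer_wave m k th (x : circle R) : (0 < k < m)%N -> transfer m (wave k th) x = 0.
Proof.
move=> /andP[k0 km]; have m0 : (0 < m)%N by apply: leq_trans km.
have mn0 : m%:R != 0 :> R by rewrite pnatr_eq0 -lt0n.
have k0' : 0 < k%:R / m%:R :> R by rewrite divr_gt0 ?ltr0n.
have k1' : k%:R / m%:R < 1 :> R by rewrite ltr_pdivrMr ?ltr0n// mul1r ltr_nat.
pose b : R := 2 * pi * k%:R / m%:R.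
pose a : R := 2 * pi * k%:R * circle_sec x / m%:R + th.
rewrite /transfer (eq_bigr (fun j : 'I_m => cos (a + j%:R * b))); last first.
  by move=> j _; rewrite /wave circle_branch_sec//; congr cos; rewrite /a /b; field.
apply: sum_cos_eq0.
  rewrite gt_eqF// sin_gt0_pi//.
  rewrite (_ : b / 2 = pi * (k%:R / m%:R)); last by rewrite /b; field.
  by rewrite mulr_gt0 ?pi_gt0//= gtr_pMr ?pi_gt0.
rewrite -!cosBpihalf -(cosD2piz (a - b / 2 - pi / 2) k); congr cos.
by rewrite /b; field.
Qed.

Definition dilated_sawtooth (m : nat) : circle R -> R := sawtooth \o circle_mul m.

Lemma dilated_sawtooth_Lfun m : dilated_sawtooth m \in Lfun lam 2%:E.
Proof.
apply: (@Lfun2_bounded _ _ _ _ _ 1) => [|x]; last exact: sawtooth_le1.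
by apply: measurableT_comp; [exact: measurable_sawtooth|exact: measurable_circle_mul].
Qed.

Lemma transfer_dilated_sawtooth d q x : (0 < d)%N ->
  transfer d (dilated_sawtooth (d * q).+1) x = dilated_sawtooth (d * q).+1 x.
Proof.
by move=> d0; apply: transfer_comp_mul => // y; exact: transfer_sawtooth.
Qed.

Lemma dilated_sawtooth_mean0 i : \int[lam]_x dilated_sawtooth (6 * i).+1 x = 0.
Proof.
apply: (@transfer_fixed_mean0 R 6) => //; first exact: dilated_sawtooth_Lfun.
by apply: aeW => x; exact: transfer_dilated_sawtooth.
Qed.

(** The index 0 gives the sawtooth itself. *)
Definition saw_vec (i : nat) : L20 lam :=
  L20_of (dilated_sawtooth_Lfun (6 * i).+1) (dilated_sawtooth_mean0 i).

Lemma saw_vec_E d i : (0 < d)%N -> (d %| 6)%N -> E R d (saw_vec i).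
Proof.
move=> d0 /dvdnP[q qE]; apply: E_of => //; apply: aeW => x.
have -> : (6 * i = d * (q * i))%N by rewrite qE mulnA [(d * q)%N]mulnC.
exact: transfer_dilated_sawtooth.
Qed.

(** A function dilated by [m] has only frequencies divisible by [m]: by adjointness the dilation
    becomes a transfer of the wave, which vanishes for [0 < k < m]. The coefficients of the dilated
    sawtooths are thus triangular. *)
Lemma coef_saw_vec_gt i j th : (j < i)%N -> wave_coef (6 * j).+1 th (saw_vec i) = 0.
Proof.
move=> ji; rewrite wave_coef_of; set m := (6 * i).+1; set k := (6 * j).+1.
have m0 : (0 < m)%N by [].
have km : (0 < k < m)%N.
  by apply/andP; split => //; rewrite ltnS ltn_mul2l ji.
have s2 : sawtooth \in Lfun lam 2%:E.
  by apply: (@Lfun2_bounded _ _ _ _ _ 1); [exact: measurable_sawtooth|exact: sawtooth_le1].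
have := Rintegral_transfer_mul m0 (@wave_Lfun R k th) s2.
rewrite (@eq_Rintegral _ _ _ _ _ (fun=> 0)); last first.
  by move=> x _; rewrite transfer_wave// mul0r.
rewrite Rintegral_cst// mul0r => /esym/eqP.
by rewrite mulf_eq0 pnatr_eq0 => /eqP.
Qed.

(** Wave and sawtooth are dilated by the same factor, and the dilation preserves Lebesgue
    measure. *)
Lemma coef_saw_vec_eq i th : wave_coef (6 * i).+1 th (saw_vec i) = wave_coef 1 th (saw_vec 0).
Proof.
rewrite !wave_coef_of.
have g2 : (fun x => wave 1 th x * dilated_sawtooth (6 * 0).+1 x) \in Lfun lam 2%:E.
  apply: (@Lfun2_bounded _ _ _ _ _ 1) => [|x].
    apply: measurable_funM; first exact: measurable_wave.
    exact: (Lfun2_measurable (dilated_sawtooth_Lfun _)).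
  by rewrite normrM mulr_ile1// ?wave_le1 ?sawtooth_le1.
rewrite -(Rintegral_circle_mul (isT : (0 < (6 * i).+1)%N) g2).
apply: eq_Rintegral => x _; rewrite wave_mul mul1n; congr (_ * sawtooth _).
Qed.

End sawtooth.

(** * Independence of the invariant vectors and the two dimension counts *)

Section basis.
Variable R : realType.
Local Notation lam := (circle_lebesgue R).

(** The middle third of the interval has positive measure, so it is not contained in a null set; its
    ends keep the inequalities strict. *)
Lemma ae_circle_itv (Q : circle R -> Prop) (a b : R) : 0 <= a -> a < b -> b <= 1 ->
  {ae lam, forall x, Q x} -> exists2 x, a < circle_sec x < b & Q x.
Proof.
move=> a0 ab b1 [N [mN N0 QN]]; apply: contrapT => nex.
pose m1 := (2 * a + b) / 3; pose m2 := (a + 2 * b) / 3.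
have m1E : lam [set x | circle_sec x <= m1] = m1%:E.
  by apply: circle_lebesgue_le; apply/andP; split; rewrite /m1; lra.
have m2E : lam [set x | circle_sec x <= m2] = m2%:E.
  by apply: circle_lebesgue_le; apply/andP; split; rewrite /m2; lra.
have mm1 := measurable_circle_sec_le m1; have mm2 := measurable_circle_sec_le m2.
have sub : [set x : circle R | circle_sec x <= m2] `<=`
    [set x | circle_sec x <= m1] `|` N.
  move=> x /= xm2; have [xm1|m1x] := leP (circle_sec x) m1; [by left|right].
  apply: QN => /= Qx; apply: nex; exists x => //.
  by move: m1x xm2; rewrite /m1 /m2 => h1 h2; apply/andP; split; lra.
pose S c := [set x : circle R | circle_sec x <= c].
have : (lam (S m2) <= lam (S m1) + lam N)%E.
  apply: (@le_trans _ _ (lam (S m1 `|` N))); last exact: measureU2.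
  by apply: le_measure; rewrite ?inE//; exact: measurableU.
by rewrite /S m1E m2E N0 adde0 lee_fin /m1 /m2; lra.
Qed.

Lemma E0 d : (0 < d)%N -> E R d 0.
Proof.
move=> d0; have [lin _ _] := D_Phi_gateaux R d0.
by have := lin (-1) 0 0; rewrite /E /= scaleN1r addNr => ->; rewrite scaleN1r addNr.
Qed.

Lemma log_sine_mean0 : \int[lam]_x log_sine x = 0.
Proof.
apply: (@transfer_fixed_mean0 R 2) => //; first exact: log_sine_Lfun.
apply: filterS (ae_circle_sec_neq 0) => x x0.
exact: transfer_log_sine.
Qed.

Definition log_vec : L20 lam := L20_of (@log_sine_Lfun R) log_sine_mean0.

Lemma log_vec_E d : (0 < d)%N -> E R d log_vec.
Proof.
move=> d0; apply: E_of => //; apply: filterS (ae_circle_sec_neq 0) => x x0.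
exact: transfer_log_sine.
Qed.

Lemma saw_vec0_E d : (0 < d)%N -> E R d (saw_vec R 0).
Proof.
move=> d0; apply: E_of => //; apply: aeW => x.
by have := @transfer_dilated_sawtooth R d 0 x d0; rewrite !muln0.
Qed.

(** Near 0 the sawtooth is positive and [log_sine] negative, while between [1/4] and [1/2] both are
    positive. A vanishing combination therefore has both [a b >= 0] and [a b <= 0]. *)
Lemma saw_log_independent (a b : R) :
  a *: saw_vec R 0 + b *: log_vec = 0 -> a = 0 /\ b = 0.
Proof.
move=> ab0.
have ae0 : {ae lam, forall x, a * sawtooth x + b * log_sine x = 0}.
  have h1 := L20_funD (a *: saw_vec R 0) (b *: log_vec); rewrite ab0 in h1.
  have h2 := L20_funZ a (saw_vec R 0); have h3 := L20_funZ b log_vec.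
  have h4 := L20_ofK (dilated_sawtooth_Lfun R (6 * 0).+1) (dilated_sawtooth_mean0 R 0).
  have h5 := L20_ofK (@log_sine_Lfun R) log_sine_mean0.
  have h6 := L20_funZ 0 (0 : L20 lam); rewrite scaler0 in h6.
  near=> x; have <- : L20_fun (saw_vec R 0) x = sawtooth x.
    rewrite [LHS](near h4 x)// /dilated_sawtooth muln0 /= /circle_mul mulr1n//.
  have <- : L20_fun log_vec x = log_sine x by exact: (near h5 x).
  rewrite -(near h2 x)// -(near h3 x)// -(near h1 x)//.
  by rewrite (near h6 x)// mul0r.
have p0 := pi_gt0 R; have p2 := pi_ge2 R.
(* Below this bound [sin (pi s) <= pi s < 1/2], hence [4 sin^2 < 1] and the logarithm is
   negative. *)
have p2i : 0 < (2 * pi)^-1 :> R by rewrite invr_gt0 mulr_gt0.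
have p2i4 : (2 * pi)^-1 <= 1 / 4 :> R.
  by rewrite -[1 / 4]invrK lef_pV2 ?posrE ?invr_gt0 ?mulr_gt0// invf_div divr1; lra.
have p2i1 : (2 * pi)^-1 <= 1 :> R by lra.
have [x /andP[x0 x1] xE] := ae_circle_itv (lexx 0) p2i p2i1 ae0.
have [y /andP[y0 y1] yE] : exists2 y : circle R, 1 / 4 < circle_sec y < 1 / 2 &
    a * sawtooth y + b * log_sine y = 0.
  by apply: ae_circle_itv ae0; lra.
have sx : 0 < sawtooth x by rewrite /sawtooth; lra.
have sy : 0 < sawtooth y by rewrite /sawtooth; lra.
have lx : log_sine x < 0.
  apply: ln_lt0; rewrite log_sine_arg_gt0 ?gt_eqF//= log_sine_arg -mulrA two_sub_cos.
  have x2 : 2 * (pi * circle_sec x) < 1.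
    by rewrite mulrA -ltr_pdivlMl ?mulr_gt0// mulr1.
  have px : 0 < pi * circle_sec x by rewrite mulr_gt0.
  have := sin_sub_le (pi * circle_sec x) 0; rewrite sin0 !subr0 (gtr0_norm px).
  rewrite ler_norml => /andP[h1 h2].
  have : 0 < (1 - 2 * sin (pi * circle_sec x)) * (1 + 2 * sin (pi * circle_sec x)).
    by rewrite mulr_gt0//; lra.
  by lra.
have ly : 0 < log_sine y.
  apply: ln_gt0; rewrite log_sine_arg.
  suff : cos (2 * pi * circle_sec y) <= 0 by lra.
  rewrite (_ : 2 * pi * _ = 2 * pi * circle_sec y - pi + pi); last by ring.
  rewrite cosDpi oppr_le0; apply: cos_ge0_pihalf.
  have h1 : pi * (1 / 4) < pi * circle_sec y by rewrite ltr_pM2l.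
  have h2 : pi * circle_sec y < pi * (1 / 2) by rewrite ltr_pM2l.
  by apply/andP; split; lra.
have ab1 : a * b * sawtooth x = b ^+ 2 * - log_sine x.
  by have := congr1 (fun z => b * z) xE; rewrite mulr0; lra.
have ab2 : a * b * sawtooth y = b ^+ 2 * - log_sine y.
  by have := congr1 (fun z => b * z) yE; rewrite mulr0; lra.
have ab_ge : 0 <= a * b.
  by rewrite -(pmulr_lge0 _ sx) ab1 mulr_ge0 ?sqr_ge0// oppr_ge0 ltW.
have ab_le : a * b <= 0.
  by rewrite -(pmulr_lle0 _ sy) ab2 mulrN oppr_le0 mulr_ge0 ?sqr_ge0// ltW.
have ab_0 : a * b = 0 by apply/le_anti; rewrite ab_le ab_ge.
have b_0 : b = 0.
  move: ab2; rewrite ab_0 mul0r => /esym/eqP.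
  by rewrite mulf_eq0 oppr_eq0 (gt_eqF ly) orbF sqrf_eq0 => /eqP.
split=> //; move: xE; rewrite b_0 mul0r addr0 => /eqP.
by rewrite mulf_eq0 (gt_eqF sx) orbF => /eqP.
Unshelve. all: by end_near. Qed.

(** The span is invariant under all [d], so [E_all_eq0] turns independence into injectivity of the
    two coefficients of frequency 1. *)
Lemma coef_saw_log_inj (a b : R) (v := a *: saw_vec R 0 + b *: log_vec) :
  wave_coef 1 0 v = 0 -> wave_coef 1 (pi / 2) v = 0 -> a = 0 /\ b = 0.
Proof.
move=> c0 s0; have vE d : (2 <= d)%N -> E R d v.
  move=> d2; have d0 := ltnW d2; apply: E_linear => //; first exact: saw_vec0_E.
  by rewrite -[_ *: _]addr0; apply: E_linear => //; [exact: log_vec_E|exact: E0].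
exact: saw_log_independent (E_all_eq0 vE c0 s0).
Qed.

Theorem E_all_dimension :
  has_dimension (\bigcap_(d in [set d : nat | (2 <= d)%N]) E R d) 2.
Proof.
pose e (i : 'I_2) := if i == 0 then saw_vec R 0 else log_vec.
have sumE (c : 'I_2 -> R) : \sum_(i < 2) c i *: e i =
    c 0 *: saw_vec R 0 + c 1 *: log_vec.
  by rewrite !big_ord_recl big_ord0 addr0 /e /=; congr (_ + c _ *: _); exact/val_inj.
exists e; split.
  move=> c; rewrite sumE => /saw_log_independent[c0 c1] i.
  by have [->//|i0] := eqVneq i 0; rewrite -c1; congr c; apply/val_inj;
     case: i i0 => -[|[|]].
have spanE v : (exists a b, v = a *: saw_vec R 0 + b *: log_vec) -> spanned e v.
  move=> [a [b ->]]; exists (fun i => if i == 0 then a else b).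
  by rewrite sumE.
have combE a b d : (2 <= d)%N -> E R d (a *: saw_vec R 0 + b *: log_vec).
  move=> d2; have d0 := ltnW d2; apply: E_linear => //; first exact: saw_vec0_E.
  by rewrite -[_ *: _]addr0; apply: E_linear => //; [exact: log_vec_E|exact: E0].
apply/seteqP; split => v; last first.
  by move=> [c ->] d /= d2; rewrite sumE; exact: combE.
move=> vE; apply: spanE.
pose cb := wave_coef 1 0 (saw_vec R 0); pose sb := wave_coef 1 (pi / 2) (saw_vec R 0).
pose cl := wave_coef 1 0 log_vec; pose sl := wave_coef 1 (pi / 2) log_vec.
(* If the determinant vanished, [(cl, - cb)] and [(sl, - sb)] would lie in the kernel, so all four
   entries would be 0 and [(1, 0)] would lie in it too. *)
have det0 : cb * sl - cl * sb != 0.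
  apply/negP => /eqP det.
  have coefE th a b : wave_coef 1 th (a *: saw_vec R 0 + b *: log_vec) =
    a * wave_coef 1 th (saw_vec R 0) + b * wave_coef 1 th log_vec by rewrite wave_coefD !wave_coefZ.
  have [||cl0 /eqP] := @coef_saw_log_inj cl (- cb).
  - by rewrite coefE -/cb -/cl; ring.
  - by rewrite coefE -/sb -/sl; move: det; lra.
  rewrite oppr_eq0 => /eqP cb0.
  have [||sl0 /eqP] := @coef_saw_log_inj sl (- sb).
  - by rewrite coefE -/cb -/cl cl0 cb0; ring.
  - by rewrite coefE -/sb -/sl; ring.
  rewrite oppr_eq0 => /eqP sb0.
  have [||/eqP] := @coef_saw_log_inj 1 0.
  - by rewrite coefE -/cb -/cl cl0 cb0; ring.
  - by rewrite coefE -/sb -/sl sl0 sb0; ring.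
  by rewrite oner_eq0.
pose cv := wave_coef 1 0 v; pose sv := wave_coef 1 (pi / 2) v.
(* Cramer's rule for the two coefficients of frequency 1; the difference with [v] is invariant under
   all [d] and has both of them equal to 0. *)
exists ((cv * sl - cl * sv) / (cb * sl - cl * sb)), ((cb * sv - cv * sb) / (cb * sl - cl * sb)).
apply/eqP; rewrite -subr_eq0 addrC -scaleN1r; apply/eqP; apply: E_all_eq0.
- by move=> d d2; apply: E_linear; [exact: ltnW|exact: combE|exact: vE].
- by rewrite wave_coefD wave_coefZ wave_coefD !wave_coefZ -/cb -/cl -/cv; field.
- by rewrite wave_coefD wave_coefZ wave_coefD !wave_coefZ -/sb -/sl -/sv; field.
Qed.

(** In the span of [n] vectors, [n + 1] dilated sawtooths would satisfy a linear relation, which the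
    triangular coefficients exclude. *)
Theorem E2_E3_infinite : infinite_dimensional (E R 2 `&` E R 3).
Proof.
move=> n e Espan.
have /choice[A AE] : forall i : 'I_n.+1, exists c : 'I_n -> R,
    saw_vec R i = \sum_(k < n) c k *: e k.
  by move=> i; apply: Espan; split; exact: saw_vec_E.
pose M : 'M[R]_(n.+1, n) := \matrix_(i, k) A i k.
have kerM : kermx M != 0.
  rewrite -mxrank_eq0 mxrank_ker -lt0n subn_gt0.
  exact: leq_ltn_trans (rank_leq_col M) (ltnSn n).
have /rowV0Pn[u /sub_kermxP uM u0] := kerM.
have sum0 : \sum_(i < n.+1) u 0 i *: saw_vec R i = 0.
  under eq_bigr do rewrite AE scaler_sumr.
  rewrite exchange_big big1// => k _.
  under eq_bigr do rewrite scalerA.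
  have : (u *m M) 0 k = 0 by rewrite uM mxE.
  rewrite mxE -scaler_suml => uMk.
  rewrite [X in X *: _](_ : _ = 0) ?scale0r// -[RHS]uMk.
  by apply: eq_bigr => i _; rewrite mxE.
have [i0 ui0] : exists i, u 0 i != 0.
  apply: contrapT => h; case/eqP: u0; apply/rowP => i; rewrite mxE.
  by apply/eqP; apply: contrapT => /negP ui; apply: h; exists i.
(* At the least index [j] with a nonzero coefficient, frequency [6 j + 1] is absent from all later
   vectors. The relation then forces the coefficients of frequency 1 of the sawtooth to vanish,
   contrary to [coef_saw_log_inj]. *)
have [j uj jmin] := @arg_minnP _ i0 (fun i => u 0 i != 0) val ui0.
suff all0 th : wave_coef 1 th (saw_vec R 0) = 0.
  have [||/eqP] := @coef_saw_log_inj 1 0.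
  - by rewrite scale1r scale0r addr0.
  - by rewrite scale1r scale0r addr0.
  by rewrite oner_eq0.
have := congr1 (wave_coef (6 * j).+1 th) sum0; rewrite wave_coef0.
rewrite (wave_coef_sum _ _ (fun i => u 0 i) (fun i : 'I_n.+1 => saw_vec R i)).
rewrite (bigD1 j)//= big1 => [|i ij]; last first.
  have [ui0'|ui] := eqVneq (u 0 i) 0; first by rewrite ui0' mul0r.
  rewrite coef_saw_vec_gt ?mulr0// ltn_neqAle jmin// andbT eq_sym.
  exact: ij.
rewrite addr0 coef_saw_vec_eq => /eqP; rewrite mulf_eq0 (negbTE uj) => /eqP.
by [].
Qed.

End basis.

Theorem theorem1p7 (R : realType) :
  infinite_dimensional (E R 2 `&` E R 3) /\
  has_dimension (\bigcap_(d in [set d : nat | (2 <= d)%N]) E R d) 2.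
Proof. by split; [exact: E2_E3_infinite|exact: E_all_dimension]. Qed.
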